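(* Let $\alpha\in\mathbb{R}$, $\omega>\omega_\alpha$, $\tilde\omega>0$. If $\beta > \beta^*$, all minimizers for $c_\beta$ are vector and singular.
   Context: Functions are complex-valued on $\mathbb{R}^2$ and $\|\cdot\|_p$ is the $L^p(\mathbb{R}^2)$ norm. For $\lambda>0$, $\mathcal{G}_\lambda$ is the Green's function of $-\Delta+\lambda$ on $\mathbb{R}^2$, i.e. the $L^2$ solution of $(-\Delta+\lambda)\mathcal{G}_\lambda=\delta_0$. Put $\theta_\lambda:=\frac{\log(\sqrt{\lambda}/2)+\gamma}{2\pi}$ ($\gamma$ the Euler–Mascheroni constant) and $\omega_\alpha:=4e^{-4\pi\alpha-2\gamma}$, so $\alpha+\theta_\lambda>0$ for $\lambda>\omega_\alpha$. Let $$H^1_\alpha(\mathbb{R}^2):=\{u\in L^2(\mathbb{R}^2): \exists\, q\in\mathbb{C},\ \lambda>0 \text{ with } \phi_\lambda:=u-q\mathcal{G}_\lambda\in H^1(\mathbb{R}^2)\};$$ the charge $q=q(u)$ is uniquely determined by $u$ and independent of $\lambda$. For $\omega>\omega_\alpha$ and $u=\phi_\lambda+q\mathcal{G}_\lambda\in H^1_\alpha(\mathbb{R}^2)$, $$\langle(-\Delta_\alpha+\omega)u,u\rangle:=\|\nabla\phi_\lambda\|_2^2+\lambda\|\phi_\lambda\|_2^2+(\omega-\lambda)\|u\|_2^2+(\alpha+\theta_\lambda)|q|^2,$$ which does not depend on $\lambda$ (one fixes $\omega_\alpha<\lambda\le\omega$). Let $\mathbb{H}_\alpha:=H^1_\alpha(\mathbb{R}^2)\times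 H^1(\mathbb{R}^2)$ and, for $(u,v)\in\mathbb{H}_\alpha$, $\beta\ge0$, $$I_\beta(u,v):=\tfrac12\big(\langle(-\Delta_\alpha+\omega)u,u\rangle+\|\nabla v\|_2^2+\tilde\omega\|v\|_2^2\big)-\tfrac14(\|u\|_4^4+\|v\|_4^4)-\tfrac\beta2\int_{\mathbb{R}^2}|uv|^2,$$ $$G_\beta(u,v):=\langle(-\Delta_\alpha+\omega)u,u\rangle+\|\nabla v\|_2^2+\tilde\omega\|v\|_2^2-(\|u\|_4^4+\|v\|_4^4)-2\beta\int_{\mathbb{R}^2}|uv|^2,$$ $\mathcal{N}_\beta:=\{(u,v)\in\mathbb{H}_\alpha\setminus\{(0,0)\}: G_\beta(u,v)=0\}$, $c_\beta:=\inf_{\mathcal{N}_\beta}I_\beta$. A minimizer for $c_\beta$ is $(u,v)\in\mathcal N_\beta$ with $I_\beta(u,v)=c_\beta$. Put $\beta^*:=\max\{\beta\ge0:c_\beta=c_0\}$ (the maximum exists). A pair $(u,v)$ is vector if $u\neq0$ and $v\ne0$; it is singular if $q(u)\neq0$. *)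

(* Defs.v *)
From HB Require Import structures.
From mathcomp Require Import all_boot all_order all_algebra.
From mathcomp Require Import complex.
From mathcomp Require Import all_classical all_reals all_analysis.
Import Order.TTheory GRing.Theory Num.Theory.
Import numFieldNormedType.Exports Normc.

Set Implicit Arguments.
Unset Strict Implicit.
Unset Printing Implicit Defensive.

Local Open Scope classical_set_scope.
Local Open Scope ring_scope.
Local Open Scope complex_scope.

(* Elements of L^2, H^1, ... are represented by (Borel) functions; every notion
   below is invariant under almost everywhere equality, and "u = 0" is always
   meant almost everywhere. *)

Section Plane.
Variable R : realType.

Definition leb2 :
    {measure set (measurableTypeR R * measurableTypeR R)%type -> \bar R} :=
  (@lebesgue_measure R \x @lebesgue_measure R)%E.

Definition cmeasurable (u : R * R -> R[i]) : Prop :=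
  measurable_fun [set: measurableTypeR R * measurableTypeR R]
    (fun x => complex.Re (u x)) /\
  measurable_fun [set: measurableTypeR R * measurableTypeR R]
    (fun x => complex.Im (u x)).

Definition cnorm (p : R) (u : R * R -> R[i]) : R :=
  fine ('N[leb2]_(p%:E)[ (fun x => (normc (u x))%:E) ])%E.

Definition L2 (u : R * R -> R[i]) : Prop :=
  cmeasurable u /\ finite_norm leb2 2%:E (fun x => normc (u x)).

Definition cintegral (u : R * R -> R[i]) : R[i] :=
  (\int[leb2]_x complex.Re (u x))%R +i* (\int[leb2]_x complex.Im (u x))%R.

Definition e1 : R * R := (1, 0).
Definition e2 : R * R := (0, 1).

Fixpoint Cn (n : nat) (f : R * R -> R) : Prop :=
  if n is m.+1 then
    [/\ continuous f,
        forall x, derivable f x e1,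
        forall x, derivable f x e2,
        Cn m ('D_e1 f) & Cn m ('D_e2 f)]
  else continuous f.

(* Real-valued test functions; by linearity they define the same
   distributional identities as complex-valued ones. *)
Definition test_function (f : R * R -> R) : Prop :=
  (forall n, Cn n f) /\ compact (closure [set x | f x != 0]).

Definition laplacian (f : R * R -> R) (x : R * R) : R :=
  'D_e1 ('D_e1 f) x + 'D_e2 ('D_e2 f) x.

Definition is_weak_derivative (e : R * R) (u g : R * R -> R[i]) : Prop :=
  forall f, test_function f ->
    cintegral (fun x => u x * ('D_e f x)%:C) =
    - cintegral (fun x => g x * (f x)%:C).

Definition H1 (u : R * R -> R[i]) : Prop :=
  [/\ L2 u,
      exists g, L2 g /\ is_weak_derivative e1 u g &
      exists g, L2 g /\ is_weak_derivative e2 u g].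

Definition weak_derivative (e : R * R) (u : R * R -> R[i]) : R * R -> R[i] :=
  xget (cst 0) [set g | L2 g /\ is_weak_derivative e u g].

(* ||grad u||_2^2 *)
Definition dirichlet (u : R * R -> R[i]) : R :=
  cnorm 2 (weak_derivative e1 u) ^+ 2 + cnorm 2 (weak_derivative e2 u) ^+ 2.

(* g is the L^2 solution of (- Laplacian + l) g = delta_0 in the sense of
   distributions (unique up to almost everywhere equality) *)
Definition is_green (l : R) (g : R * R -> R[i]) : Prop :=
  L2 g /\
  forall f, test_function f ->
    cintegral (fun x => g x * (- laplacian f x + l * f x)%:C) = (f (0, 0))%:C.

Definition ae_zero (u : R * R -> R[i]) : Prop :=
  {ae leb2, forall x, u x = 0}.

End Plane.

Section Constants.
Variable R : realType.

Definition euler_gamma : R :=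
  limn (fun n : nat => \sum_(1 <= k < n.+1) (k%:R)^-1 - ln (n%:R) : R).

Definition theta (l : R) : R :=
  (ln (Num.sqrt l / 2) + euler_gamma) / (2 * pi).

Definition omega_ (alpha : R) : R :=
  4 * expR (- (4 * pi * alpha) - 2 * euler_gamma).

End Constants.

(* G is the family of Green's functions, indexed by l > 0. *)
Section Problem.
Variables (R : realType) (G : R -> R * R -> R[i]).
Implicit Types (u v : R * R -> R[i]) (uv : (R * R -> R[i]) * (R * R -> R[i])).

Definition regular_part (l : R) (q : R[i]) u : R * R -> R[i] :=
  fun x => u x - q * G l x.

Definition is_charge u (q : R[i]) : Prop :=
  exists l : R, 0 < l /\ H1 (regular_part l q u).

Definition H1alpha u : Prop := L2 u /\ exists q, is_charge u q.

Definition charge_of u : R[i] := xget 0 [set q | is_charge u q].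

(* <(- Delta_alpha + omega) u, u>, computed with the decomposition
   u = phi_l + q G_l *)
Definition qform (alpha omega l : R) u : R :=
  let phi := regular_part l (charge_of u) u in
  dirichlet phi + l * cnorm 2 phi ^+ 2 + (omega - l) * cnorm 2 u ^+ 2
  + (alpha + theta l) * normc (charge_of u) ^+ 2.

Variables (alpha omega tomega l : R).

Definition coupling u v : R :=
  (\int[@leb2 R]_x (normc (u x * v x) ^+ 2))%R.

Definition energy (beta : R) uv : R :=
  2^-1 * (qform alpha omega l uv.1 + dirichlet uv.2 + tomega * cnorm 2 uv.2 ^+ 2)
  - 4^-1 * (cnorm 4 uv.1 ^+ 4 + cnorm 4 uv.2 ^+ 4)
  - beta / 2 * coupling uv.1 uv.2.

Definition nehari_functional (beta : R) uv : R :=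
  qform alpha omega l uv.1 + dirichlet uv.2 + tomega * cnorm 2 uv.2 ^+ 2
  - (cnorm 4 uv.1 ^+ 4 + cnorm 4 uv.2 ^+ 4)
  - 2 * beta * coupling uv.1 uv.2.

Definition nehari (beta : R) : set ((R * R -> R[i]) * (R * R -> R[i])) :=
  [set uv | [/\ H1alpha uv.1, H1 uv.2,
                ~ (ae_zero uv.1 /\ ae_zero uv.2) &
                nehari_functional beta uv = 0]].

Definition ground_level (beta : R) : \bar R :=
  ereal_inf [set (energy beta uv)%:E | uv in nehari beta].

Definition is_minimizer (beta : R) uv : Prop :=
  nehari beta uv /\ (energy beta uv)%:E = ground_level beta.

Definition same_level : set R :=
  [set beta | 0 <= beta /\ ground_level beta = ground_level 0].

Definition is_beta_star (b : R) : Prop := same_level b /\ ubound same_level b.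

Definition vector_pair uv : Prop := ~ ae_zero uv.1 /\ ~ ae_zero uv.2.

Definition singular_pair uv : Prop := charge_of uv.1 != 0.

End Problem.

(* Main.v *)
Require Import Defs.
From HB Require Import structures.
From mathcomp Require Import all_boot all_order all_algebra.
From mathcomp Require Import complex ring lra.
From mathcomp Require Import all_classical all_reals all_analysis.
From mathcomp Require Import measurable_realfun.
Import Order.TTheory GRing.Theory Num.Theory.
Import numFieldNormedType.Exports Normc.
Set Implicit Arguments.
Unset Strict Implicit.
Unset Printing Implicit Defensive.
Local Open Scope classical_set_scope.
Local Open Scope ring_scope.

(* If one component of a minimizer for [c_beta] vanished, the coupling term
   would vanish and the pair would compete for [c_0]; since [c_beta <= c_0] by
   scaling, this gives [c_beta = c_0], against [beta > beta^*].

   Suppose now that the charge of [u] is zero, so that [u] lies in [H^1]. Write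
   [Q] and [F] for the quadratic and quartic parts of the functional. Scaling
   onto the Nehari manifold turns minimality into [Q (u, v) F w <= (Q w)^2] for
   all admissible pairs [w]. As [Q] and [F] are invariant under reflections
   [x |-> z - x], one may perturb the reflected pair by a multiple of the
   singular direction [(G_lambda, 0)]; such a perturbation leaves the regular
   part unchanged, so to first order it only sees the [L^2] part of [Q]. Hence
   [K = (|u|^2 + beta |v|^2) u - (omega - lambda) u] satisfies
   [int K (z - x) conj (G_lambda x) dx = 0] for every [z]. Integrating this
   against [- Delta f + lambda f] gives [int K f = 0] for every test function
   [f], so [K = 0]. Testing with the direction [u] itself then yields
   [|grad u|^2 + omega |u|^2 = (omega - lambda) |u|^2], that is [u = 0].

   The integrals above require [G_lambda] to be in [L^4]: its mollifications are
   bounded, by the maximum principle, by the supersolution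
   [A log (1 + M / (|x|^2 + E))], whose fourth power is integrable near the
   origin uniformly in [E]. That [H^1] embeds in [L^4] is Ladyzhenskaya's
   inequality, again applied to mollifications. *)

(** * Integrals and the plane Lebesgue measure *)

(** The singular direction exists at the origin only, so the test point is moved by reflecting the
    pair instead. A charge-free [u] permits this; a charged one would leave the space. Reflections
    are preferred to translations because they turn the pairing with the Green's function into a
    convolution at once. The contradiction comes from comparing two kinds of directions. A regular
    direction sees the whole operator $-\Delta+\omega$, while the singular one only sees
    $\omega-\lambda$, since $-\Delta+\lambda$ acts on the unchanged regular part. The difference of
    the two equations is $(-\Delta+\lambda)u=0$. The direction [u] is the only regular one used, so
    no polarized Dirichlet form is needed. Nor is the constraint differentiated: convexity bounds
    the quartic part from below to first order along a line, and an inequality valid for steps of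
    both signs yields the first-order identity. The charge is defined by a choice, so its uniqueness
    has to be proved before the form can be evaluated on scaled or perturbed functions. *)

Section Integration.
Context d (T : measurableType d) (R : realType)
  (mu : {measure set T -> \bar R}).
Implicit Types f g h : T -> R.

(** [Rintegral] is 0 when the extended integral is infinite, so linearity and monotonicity are used
    under this predicate. *)
Definition summable_fun f := mu.-integrable setT (EFin \o f).
Local Notation sf := summable_fun.
Local Notation J := (Rintegral mu setT).

Lemma sf_meas f : sf f -> measurable_fun setT f.
Proof. by move=> /integrableP[/measurable_EFinP]. Qed.

Lemma sf_le f g : measurable_fun setT f -> (forall x, `|f x| <= g x) ->
  sf g -> sf f.
Proof.
move=> mf fg ig; apply: le_integrable ig => //; first exact/measurable_EFinP.
by move=> x _ /=; rewrite lee_fin (le_trans (fg x))// ler_norm.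
Qed.

Lemma sfD f g : sf f -> sf g -> sf (fun x => f x + g x).
Proof. by move=> hf hg; have := integrableD measurableT hf hg. Qed.

Lemma sfB f g : sf f -> sf g -> sf (fun x => f x - g x).
Proof. by move=> hf hg; have := integrableB measurableT hf hg. Qed.

Lemma sfZ c f : sf f -> sf (fun x => c * f x).
Proof. by move=> hf; have := integrableZl measurableT c hf. Qed.

Lemma sfN f : sf f -> sf (fun x => - f x).
Proof. by move=> hf; have := integrableN hf. Qed.

Lemma sf_norm f : sf f -> sf (fun x => `|f x|).
Proof. exact: integrable_norm. Qed.

Lemma JD f g : sf f -> sf g -> J (fun x => f x + g x) = J f + J g.
Proof. by move=> *; rewrite RintegralD. Qed.

Lemma JB f g : sf f -> sf g -> J (fun x => f x - g x) = J f - J g.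
Proof. by move=> *; rewrite RintegralB. Qed.

Lemma JZ c f : sf f -> J (fun x => c * f x) = c * J f.
Proof. by move=> *; rewrite RintegralZl. Qed.

Lemma JN f : sf f -> J (fun x => - f x) = - J f.
Proof.
move=> hf; rewrite -mulN1r -JZ//; congr Rintegral; apply/funext => x.
by rewrite mulN1r.
Qed.

Lemma J0 : J (fun=> 0) = 0.
Proof. by rewrite /Rintegral integral0. Qed.

Lemma leJ f g : sf f -> sf g -> (forall x, f x <= g x) -> J f <= J g.
Proof. by move=> hf hg fg; apply: le_Rintegral => // x _; exact: fg. Qed.

Lemma J_ge0 f : (forall x, 0 <= f x) -> 0 <= J f.
Proof. by move=> f0; apply: Rintegral_ge0 => x _; exact: f0. Qed.

Lemma normJ f : sf f -> `|J f| <= J (fun x => `|f x|).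
Proof. by move=> hf; apply: le_normr_Rintegral. Qed.

Lemma normJ_le f g : sf f -> sf g -> (forall x, `|f x| <= g x) -> `|J f| <= J g.
Proof.
move=> hf hg fg; apply: (le_trans (normJ hf)); apply: leJ => //.
exact: sf_norm.
Qed.

Lemma EFin_J f : sf f -> (J f)%:E = (\int[mu]_x (f x)%:E)%E.
Proof. by move=> hf; rewrite /Rintegral fineK//; exact: integrable_fin_num. Qed.

Lemma ge0_sfP f : measurable_fun setT f -> (forall x, 0 <= f x) ->
  sf f <-> (\int[mu]_x (f x)%:E < +oo)%E.
Proof.
move=> mf f0; have E : (\int[mu]_x `|(f x)%:E| = \int[mu]_x (f x)%:E)%E.
  by apply: eq_integral => x _; rewrite /= ger0_norm.
split => [/integrableP[_]|h]; first by rewrite E.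
by apply/integrableP; split; [exact/measurable_EFinP|rewrite E].
Qed.

Lemma ge0_sf_le f C : measurable_fun setT f -> (forall x, 0 <= f x) ->
  (\int[mu]_x (f x)%:E <= C%:E)%E -> sf f /\ J f <= C.
Proof.
move=> mf f0 h.
have hf : sf f by apply/ge0_sfP => //; exact: (le_lt_trans h (ltry _)).
by split => //; rewrite -lee_fin EFin_J.
Qed.

Lemma ae_impl (Q1 Q2 : T -> Prop) : (forall x, Q1 x -> Q2 x) ->
  {ae mu, forall x, Q1 x} -> {ae mu, forall x, Q2 x}.
Proof. by move=> h; apply: filterS. Qed.

Lemma ae_impl2 (Q1 Q2 Q3 : T -> Prop) : (forall x, Q1 x -> Q2 x -> Q3 x) ->
  {ae mu, forall x, Q1 x} -> {ae mu, forall x, Q2 x} -> {ae mu, forall x, Q3 x}.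
Proof. by move=> h; apply: filterS2. Qed.

Lemma J_eq0_ae f : sf f -> (forall x, 0 <= f x) -> J f = 0 ->
  {ae mu, forall x, f x = 0}.
Proof.
move=> hf f0 J0.
have : (\int[mu]_x `|(f x)%:E| = 0)%E.
  rewrite -[RHS](congr1 EFin J0) EFin_J//.
  by apply: eq_integral => x _; rewrite /= ger0_norm.
have mf : measurable_fun setT (EFin \o f) by exact/measurable_EFinP/sf_meas.
move/(ae_eq_integral_abs mu measurableT mf).
by apply: filterS => x /(_ Logic.I) [].
Qed.

Lemma eq_ae_J f g : measurable_fun setT f -> measurable_fun setT g ->
  {ae mu, forall x, f x = g x} -> J f = J g.
Proof.
move=> mf mg fg; congr fine; apply: ae_eq_integral => //.
- exact/measurable_EFinP.
- exact/measurable_EFinP.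
- by apply: filterS fg => x /= ->.
Qed.

Lemma dominated_J (f_ : nat -> T -> R) f g :
  (forall n, measurable_fun setT (f_ n)) -> measurable_fun setT f -> sf g ->
  (forall n x, `|f_ n x| <= g x) -> (forall x, f_ n x @[n --> \oo] --> f x) ->
  sf f /\ J (f_ n) @[n --> \oo] --> J f.
Proof.
move=> mf_ mf hg fg cf.
have [] := @dominated_convergence _ _ _ mu setT measurableT
  (fun n => EFin \o f_ n) (EFin \o f) (EFin \o g).
- by move=> n; exact/measurable_EFinP.
- exact/measurable_EFinP.
- by apply: aeW => x _; apply: cvg_EFin; [exact: nearW|exact: cf].
- exact: hg.
- by apply: aeW => x n _ /=; rewrite lee_fin.
move=> hf _ hc; split => //; rewrite /Rintegral.
apply: fine_cvg; rewrite fineK//; exact: integrable_fin_num.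
Qed.

Lemma fatou_J (f_ : nat -> T -> R) f C :
  (forall n, sf (f_ n)) -> (forall n x, 0 <= f_ n x) -> (forall n, J (f_ n) <= C) ->
  (forall x, f_ n x @[n --> \oo] --> f x) -> sf f /\ J f <= C.
Proof.
move=> hf f0 fC cf.
have mf : measurable_fun setT f.
  by apply: (measurable_fun_cvg (fun n => sf_meas (hf n))) => x _; exact: cf.
have ff0 x : 0 <= f x.
  rewrite -(cvg_lim (@Rhausdorff R) (cf x)); apply: limr_ge; first exact: cvgP (cf x).
  by near=> n.
apply: ge0_sf_le => //.
have := @fatou _ T R mu setT measurableT (fun n x => (f_ n x)%:E) _ _.
have -> : (fun x => limn_einf (fun n => (f_ n x)%:E)) = (fun x => (f x)%:E).
  apply/funext => x; have c : (f_ n x)%:E @[n --> \oo] --> (f x)%:E.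
    by apply: cvg_EFin; [exact: nearW|exact: cf].
  by rewrite is_cvg_limn_einfE; [exact: cvg_lim|exact: cvgP c].
move=> /(_ _ _)/le_trans; apply.
- by move=> n; apply/measurable_EFinP; exact: sf_meas.
- by move=> n x _; rewrite lee_fin.
rewrite limn_einf_lim; apply: lime_le; first exact: is_cvg_einfs.
near=> n; apply: (@le_trans _ _ (\int[mu]_x (f_ n x)%:E)%E).
  by apply: ereal_inf_lbound; exists n => /=.
by rewrite -EFin_J// lee_fin.
Unshelve. all: end_near. Qed.

End Integration.

(** * Invariance of the plane Lebesgue measure under reflections, and Fubini's theorem *)

Section PlaneMeasure.
Variable R : realType.
Local Notation leb := (@lebesgue_measure R).
Local Notation mu := (@leb2 R).
Local Notation P := (measurableTypeR R * measurableTypeR R)%type.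

Let leb2_sigma_finite : sigma_finite setT mu.
Proof.
have /sigma_finiteP[F [TF ndF Foo]] := sigma_finiteT leb.
exists (fun n => F n `*` F n).
  apply/seteqP; split => // -[x y] _.
  have [[n _ Fnx] [k _ Fky]] : (\bigcup_n F n) x /\ (\bigcup_n F n) y by rewrite -TF.
  exists (maxn n k) => //; split.
  - by move: x Fnx; exact/subsetPset/ndF/leq_maxl.
  - by move: y Fky; exact/subsetPset/ndF/leq_maxr.
move=> k; have [mF Fk] := Foo k.
split; first exact: measurableX.
by rewrite [ltLHS]product_measure1E// lte_mul_pinfty// ge0_fin_numE.
Qed.

(** The measure is [leb2] itself; packing it with sigma-finiteness lets Tonelli and Fubini apply to
    the product of two planes. *)
Definition leb2_sigma : {sigma_finite_measure set P -> \bar R}.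
Proof.
pose H := @Measure_isSigmaFinite.Build _ P R mu leb2_sigma_finite.
exact (HB.pack (Measure.sort mu) H).
Defined.

(** The basic change of variables: it is an involution, it is the one that occurs in convolutions,
    and every translation is a product of two of them. *)
Definition flip (z x : P) : P := (z.1 - x.1, z.2 - x.2).

Lemma measurable_fst_plane : measurable_fun [set: P] (fun x => x.1 : R).
Proof. exact: measurable_fst. Qed.

Lemma measurable_snd_plane : measurable_fun [set: P] (fun x => x.2 : R).
Proof. exact: measurable_snd. Qed.

Lemma measurable_flip z : measurable_fun setT (flip z).
Proof.
apply: measurable_fun_pair.
- apply: (measurable_funB (f := fun=> z.1 : R)) => //; exact: measurable_fst_plane.
- apply: (measurable_funB (f := fun=> z.2 : R)) => //; exact: measurable_snd_plane.
Qed.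

Definition flip1 (c : R) : measurableTypeR R -> measurableTypeR R := fun x => c - x.

Lemma measurable_flip1 c : measurable_fun setT (flip1 c).
Proof. exact: (measurable_funB (f := fun=> c : R)). Qed.

(** Lebesgue measure is determined by its values on the intervals []a, b]]; the reflection turns
    such an interval into one closed on the other side, of the same length. *)
Lemma leb_flip (c : R) (A : set (measurableTypeR R)) : measurable A ->
  leb ((fun x => c - x) @^-1` A) = leb A.
Proof.
move=> mA.
pose nu := pushforward leb (mfun_Sub (mem_set (@measurable_flip1 c))).
have nuE B : nu B = leb ((fun x => c - x) @^-1` B) by [].
rewrite -nuE; apply/esym.
apply: (@lebesgue_measure_unique R nu) => //.
move=> X [[a b] /= _ <-].
rewrite [RHS](nuE `]a, b]%classic) (_ : _ @^-1` _ = `[c - b, c - a[%classic); last first.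
  by apply/seteqP; split => x /=; rewrite !in_itv/= => /andP[? ?]; apply/andP; split; lra.
rewrite !lebesgue_measure_itv/=.
rewrite !lte_fin; case: ifPn; case: ifPn; rewrite -?leNgt => // h1 h2.
- by congr EFin; lra.
- by exfalso; lra.
- by exfalso; lra.
Qed.

Lemma leb2_flip z (A : set P) : measurable A -> mu (flip z @^-1` A) = mu A.
Proof.
move=> mA.
pose nu := pushforward mu [the {mfun P >-> P} of mfun_Sub (mem_set (@measurable_flip z))].
rewrite -[LHS]/(nu A); apply/esym.
apply: product_measure_unique => // X Y mX mY.
rewrite -[LHS]/(mu (flip z @^-1` (X `*` Y))).
rewrite (_ : _ @^-1` _ = ((fun x => z.1 - x) @^-1` X) `*` ((fun x => z.2 - x) @^-1` Y))//.
have mpre (c : R) (B : set (measurableTypeR R)) : measurable B ->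
    measurable ((fun x => c - x) @^-1` B : set (measurableTypeR R)).
  move=> mB; rewrite -[X in measurable X]setTI.
  by apply: (measurable_funB (f := fun=> c : R)) => //.
rewrite [LHS]product_measure1E; [|exact: mpre|exact: mpre].
congr (_ * _)%E; exact: leb_flip.
Qed.

Local Notation sf := (summable_fun mu).
Local Notation J := (Rintegral mu setT).
Implicit Types f g : P -> R.

Lemma meas_flip z f : measurable_fun setT f -> measurable_fun setT (fun x => f (flip z x)).
Proof. by move=> mf; apply: (measurableT_comp mf); exact: measurable_flip. Qed.

Lemma ge0_int_flip z (f : P -> \bar R) : measurable_fun setT f -> (forall x, 0 <= f x)%E ->
  (\int[mu]_x f (flip z x) = \int[mu]_x f x)%E.
Proof.
move=> mf f0.
pose nu := pushforward mu [the {mfun P >-> P} of mfun_Sub (mem_set (@measurable_flip z))].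
transitivity (\int[nu]_x f x)%E.
  by rewrite ge0_integral_pushforward// preimage_setT.
apply: eq_measure_integral => A mA _; exact: leb2_flip.
Qed.

Lemma sf_flip z f : sf f -> sf (fun x => f (flip z x)).
Proof.
move=> hf; apply/integrableP; split.
  by apply/measurable_EFinP; apply: meas_flip; exact: sf_meas hf.
rewrite (ge0_int_flip z (f := fun x => `|(f x)%:E|%E))//.
  by case/integrableP : hf.
by apply: measurableT_comp => //; apply/measurable_EFinP; exact: sf_meas hf.
Qed.

Lemma J_flip z f : sf f -> J (fun x => f (flip z x)) = J f.
Proof.
move=> hf.
pose nu := pushforward mu [the {mfun P >-> P} of mfun_Sub (mem_set (@measurable_flip z))].
congr fine.
transitivity (\int[nu]_x (f x)%:E)%E.
  rewrite integral_pushforward ?preimage_setT//.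
  - by apply/measurable_EFinP; exact: sf_meas hf.
  - exact: (sf_flip z hf).
apply: eq_measure_integral => A mA _; exact: leb2_flip.
Qed.

Definition translate (z x : P) : P := (x.1 + z.1, x.2 + z.2).

Lemma translateE z x : translate z x = flip (0, 0) (flip (- z.1, - z.2) x).
Proof. by rewrite /translate /flip /=; congr pair; ring. Qed.

Lemma meas_translate z f : measurable_fun setT f -> measurable_fun setT (fun x => f (translate z x)).
Proof.
move=> /(meas_flip (0, 0))/(meas_flip (- z.1, - z.2)).
by under eq_fun do rewrite -translateE.
Qed.

Lemma sf_translate z f : sf f -> sf (fun x => f (translate z x)).
Proof.
move=> /(sf_flip (0, 0))/(sf_flip (- z.1, - z.2)).
by rewrite (_ : (fun x => f (flip _ _)) = (fun x => f (translate z x)))//; apply/funext => x; rewrite -translateE.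
Qed.

Lemma J_translate z f : sf f -> J (fun x => f (translate z x)) = J f.
Proof.
move=> hf; rewrite -[RHS](J_flip (0, 0))// -[RHS](J_flip (- z.1, - z.2)); last exact: sf_flip.
by congr Rintegral; apply/funext => x; rewrite -translateE.
Qed.

(** The bound [g] on the inner integrals of the absolute values gives joint integrability. The
    sections are assumed integrable at every point, so no exceptional null set has to be carried
    along. *)
Lemma fubini_plane (F : P * P -> R) (g : P -> R) : measurable_fun setT F ->
  (forall x, sf (fun y => F (x, y))) -> (forall y, sf (fun x => F (x, y))) ->
  sf g -> (forall x, J (fun y => `|F (x, y)|) <= g x) ->
  J (fun x => J (fun y => F (x, y))) = J (fun y => J (fun x => F (x, y))).
Proof.
move=> mF hF hF' hg Fg.
have iF : ((leb2_sigma \x leb2_sigma)%E).-integrable setT (EFin \o F).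
  apply/integrable12ltyP; first exact/measurable_EFinP.
  apply: (@le_lt_trans _ _ (\int[mu]_x (g x)%:E)%E); last first.
    by rewrite -EFin_J// ltry.
  apply: ge0_le_integral.
  - by [].
  - by move=> x _; apply: integral_ge0.
  - apply: (@measurable_fun_fubini_tonelli_F _ _ _ _ _ leb2_sigma (fun xy => `|(F xy)%:E|%E)).
    + by apply: measurableT_comp => //; exact/measurable_EFinP.
    + by [].
  - by apply/measurable_EFinP; exact: sf_meas hg.
  - move=> x _; rewrite -EFin_J; last by apply: sf_norm; exact: hF.
    by rewrite lee_fin.
have : (\int[mu]_x \int[mu]_y (EFin \o F) (x, y) = \int[mu]_y \int[mu]_x (EFin \o F) (x, y))%E := Fubini iF.
move=> /(congr1 fine) E; rewrite /Rintegral.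
transitivity (fine (\int[mu]_x \int[mu]_y (EFin \o F) (x, y))%E).
  congr fine; apply: eq_integral => x _; rewrite -EFin_J//; exact: hF.
rewrite E; congr fine; apply: eq_integral => x _; rewrite -EFin_J//; exact: hF'.
Qed.

End PlaneMeasure.
#[global] Arguments leb2 : simpl never.

(** * Test functions *)

Section Smooth1.
Variable R : realType.
Implicit Types (p q : R -> R).

(** Carrying the whole sequence of derivatives makes smoothness a coinductive property, proved
    through [smooth1_closed]. *)
Definition smooth1 p := exists D : nat -> R -> R,
  D 0%N = p /\ forall n x, is_derive x (1 : R) (D n) (D n.+1 x).

Lemma smooth1_derive p : smooth1 p ->
  exists2 p', smooth1 p' & forall x, is_derive x (1 : R) p (p' x).
Proof.
move=> [D [<- DD]]; exists (D 1%N); last exact: DD.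
by exists (fun n => D n.+1); split.
Qed.

Lemma smooth1_continuous p : smooth1 p -> continuous p.
Proof.
move=> /smooth1_derive[p' _ pp'] x.
by apply: differentiable_continuous; apply/derivable1_diffP; case: (pp' x).
Qed.

(** A class closed under differentiation contains only smooth functions: iterating a choice of
    derivative inside the class produces the sequence [D]. *)
Lemma smooth1_closed (S : (R -> R) -> Prop) :
  (forall p, S p -> exists2 p', S p' & forall x, is_derive x (1 : R) p (p' x)) ->
  forall p, S p -> smooth1 p.
Proof.
move=> h p Sp.
have /choice[d dP] : forall u : {p | S p}, exists v : {p | S p},
    forall x, is_derive x (1 : R) (sval u) (sval v x).
  move=> [u Su]; have [v Sv uv] := h u Su; by exists (exist _ v Sv).
exists (fun n => sval (iter n d (exist _ p Sp))); split => // n x; exact: dP.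
Qed.

Lemma smooth1_affine p a c : smooth1 p -> smooth1 (fun x => p (a + c * x)).
Proof.
move=> hp.
(* The factor [c'] collects the powers of [c] that the chain rule brings out. *)
pose S q := exists p c', smooth1 p /\ q = (fun x => c' * p (a + c * x)).
apply: (@smooth1_closed S); last first.
  by exists p, 1; split => //; apply/funext => x; rewrite mul1r.
move=> q [p0 [c' [/smooth1_derive[p' sp' pp'] ->]]].
exists (fun x => (c' * c) * p' (a + c * x)); first by exists p', (c' * c).
move=> x.
have h : is_derive x 1 (fun x => a + c * x) c.
  have := is_deriveD (is_derive_cst a x 1) (is_deriveZ c (is_derive_id x (1 : R))).
  by rewrite add0r /GRing.scale/= mulr1.
have := @is_derive1_comp _ p0 (fun x => a + c * x) x _ _ (pp' _) h.
move=> h2; have := is_deriveZ c' h2.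
rewrite [c' *: _](_ : _ = c' * c * p' (a + c * x)) //.
by rewrite /GRing.scale/= mulrAC mulrA.
Qed.

Lemma smooth1M p q : smooth1 p -> smooth1 q -> smooth1 (fun x => p x * q x).
Proof.
move=> hp hq.
(* By the Leibniz rule, finite sums of products of smooth functions are closed under
   differentiation. *)
pose S r := exists s : seq ((R -> R) * (R -> R)),
  (forall u, List.In u s -> smooth1 u.1 /\ smooth1 u.2) /\
  r = (fun x => \sum_(u <- s) u.1 x * u.2 x).
apply: (@smooth1_closed S); last first.
  exists [:: (p, q)]; split; first by move=> u [<-|].
  by apply/funext => x; rewrite big_seq1.
move=> r [s [hs ->]]; elim: s hs => [|[u v] s IH] hs.
  exists (fun=> 0).
    by exists [::]; split => //; apply/funext => x; rewrite big_nil.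
  move=> x; under eq_fun do rewrite big_nil; exact: is_derive_cst.
have [|r' [s' [hs' r'E]] rr'] := IH; first by move=> w ws; apply: hs; right.
have [/smooth1_derive[u' su' uu'] /smooth1_derive[v' sv' vv']] := hs (u, v) (or_introl erefl).
have [su sv] := hs (u, v) (or_introl erefl).
exists (fun x => (u' x * v x + u x * v' x) + r' x).
  exists [:: (u', v), (u, v') & s']; split; first by move=> w [<-|[<-|/hs']].
  by apply/funext => x; rewrite r'E !big_cons/= addrA.
move=> x; under eq_fun do rewrite big_cons/=.
apply: is_deriveD.
have := is_deriveM (uu' x) (vv' x).
by rewrite [X in is_derive _ _ _ X](_ : _ = u' x * v x + u x * v' x)// addrC /GRing.scale/= mulrC.
Qed.

End Smooth1.

(** * The flat function exp(-1/t) *)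

Section ExpBump.
Variable R : realType.

Definition expbump (t : R) : R := if 0 < t then expR (- t^-1) else 0.

(** All derivatives of exp(-1/t) have this form: a polynomial in 1/t times exp(-1/t). *)
Let B (q : {poly R}) (t : R) : R := if 0 < t then q.[t^-1] * expR (- t^-1) else 0.

Lemma powX_le_expR n (s : R) : 0 <= s -> s ^+ n <= n`!%:R * expR s.
Proof.
move=> s0; case: n => [|n]; first by rewrite expr0 fact0 mul1r -[leLHS]expR0 ler_expR.
have h := expR_ge1Dxn n s0.
have : s ^+ n.+1 / n.+1`!%:R <= expR s by apply: le_trans h; rewrite lerDr.
by rewrite ler_pdivrMr ?ltr0n ?fact_gt0// mulrC.
Qed.

Lemma poly_le_expR (q : {poly R}) : exists C : R, forall s, 0 <= s -> `|q.[s]| <= C * expR s.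
Proof.
exists (\sum_(i < size q) `|q`_i| * i`!%:R) => s s0.
rewrite horner_coef mulr_suml (le_trans (ler_norm_sum _ _ _))//.
apply: ler_sum => i _; rewrite normrM -mulrA ler_wpM2l// ger0_norm ?exprn_ge0//.
exact: powX_le_expR.
Qed.

(** With $s = 1/t$ this is $|s^2 q(s)| \le C e^s$. A quadratic bound makes the difference quotient
    at 0 tend to 0. *)
Let B_sq q : exists C : R, forall t, `|B q t| <= C * t ^+ 2.
Proof.
have [C HC] := poly_le_expR (q * 'X^2).
exists C => t; rewrite /B; case: ifPn => [t0|]; last first.
  rewrite normr0 => _; rewrite mulr_ge0 ?sqr_ge0//.
  by have := HC 0 (lexx _); rewrite expR0 mulr1; apply: le_trans.
have ti : 0 <= t^-1 by rewrite invr_ge0 ltW.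
have := HC _ ti; rewrite hornerM hornerXn normrM => h.
rewrite expRN normrM [`|(expR _)^-1|]ger0_norm ?invr_ge0 ?expR_ge0//.
rewrite ler_pdivrMr ?expR_gt0// mulrAC.
by move: h; rewrite [`|_ ^+ 2|]ger0_norm ?sqr_ge0// exprVn ler_pdivrMr ?exprn_gt0.
Qed.

(** For t > 0 the chain rule gives $t^{-2}(q - q')(1/t)e^{-1/t}$, hence the polynomial $X^2(q -
    q')$; at 0 the derivative vanishes by [B_sq]. *)
Let B_derive q t : is_derive t (1 : R) (B q) (B ('X^2 * (q - q^`())) t).
Proof.
have [t0|t0|->] := ltgtP t 0.
- rewrite {2}/B ltNge (ltW t0)/=.
  have E : {near t, cst 0 =1 B q}.
    near=> s; rewrite /B ltNge (_ : s <= 0)//; near: s.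
    by apply: filterS (lt_nbhsl t0) => s /= /ltW.
  apply: (near_eq_is_derive E); exact: is_derive_cst.
- have E : {near t, (fun s => q.[s^-1] * expR (- s^-1)) =1 B q}.
    near=> s; rewrite /B (_ : 0 < s)//; near: s; exact: lt_nbhsr.
  apply: (near_eq_is_derive E).
  rewrite /B t0.
  have tn0 : t != 0 by rewrite gt_eqF.
  have hi : is_derive t 1 (fun s : R => s^-1) (- t ^- 2).
    have := @is_deriveV R id t 1 1 tn0 (is_derive_id _ _).
    by rewrite [_ *: 1]mulr1.
  have h1 := @is_derive1_comp _ (horner q) (fun s => s^-1) t _ _ (is_derive_poly q _) hi.
  have h2 := @is_derive1_comp _ expR (fun s => - s^-1) t _ _ (is_derive_expR _) (is_deriveN hi).
  have := is_deriveM h1 h2.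
  rewrite [X in is_derive _ _ _ X](_ : _ = ('X^2 * (q - q^`())).[t^-1] * expR (- t^-1))//.
  rewrite hornerM hornerXn hornerD hornerN /GRing.scale/= exprVn; ring.
- rewrite {2}/B ltxx.
  have [C HC] := B_sq q.
  have B0 : B q 0 = 0 by rewrite /B ltxx.
  have c0 : h^-1 *: ((B q \o shift 0) (h *: 1) - B q 0) @[h --> 0^'] --> (0 : R).
    rewrite B0; apply/cvgrPdist_le => e e0.
    near=> h; rewrite sub0r normrN /= subr0 addr0 [h *: 1]mulr1 normrM normrV ?unitfE; last first.
      by near: h; exact: nbhs_dnbhs_neq.
    rewrite mulrC ler_pdivrMr ?normr_gt0; last by near: h; exact: nbhs_dnbhs_neq.
    apply: (le_trans (HC h)); rewrite -[h ^+ 2]real_normK ?num_real// expr2 mulrA ler_wpM2r//.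
    rewrite (@le_trans _ _ ((1 + `|C|) * `|h|))//.
      by rewrite ler_wpM2r// (le_trans (ler_norm _))// lerDr.
    have C1 : 0 < 1 + `|C| by rewrite ltr_pwDl.
    rewrite -ler_pdivlMl//.
    near: h; apply: dnbhs0_le; rewrite mulr_gt0// invr_gt0 ltr_pwDl//.
  split; first by apply/cvg_ex; exists 0.
  exact/cvg_lim.
Unshelve. all: end_near. Qed.

Lemma smooth1_expbump : smooth1 expbump.
Proof.
apply: (@smooth1_closed _ (fun p => exists q, p = B q)).
  by move=> _ [q ->]; exists (B ('X^2 * (q - q^`()))); [exists ('X^2 * (q - q^`()))|exact: B_derive].
by exists 1; apply/funext => t; rewrite /B /expbump hornerE mul1r.
Qed.

Lemma expbump_ge0 t : 0 <= expbump t.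
Proof. by rewrite /expbump; case: ifP => // _; exact: expR_ge0. Qed.

Lemma expbump_le1 t : expbump t <= 1.
Proof.
rewrite /expbump; case: ifPn => // t0.
by rewrite -[leRHS]expR0 ler_expR lerNl oppr0 invr_ge0 ltW.
Qed.

Lemma expbump_gt0 t : 0 < t -> 0 < expbump t.
Proof. by rewrite /expbump => ->; exact: expR_gt0. Qed.

Lemma expbump_le0 t : t <= 0 -> expbump t = 0.
Proof. by rewrite /expbump ltNge => ->. Qed.

End ExpBump.

(** * Directional derivatives and smooth functions on the plane *)

Section PlaneCalculus.
Variable R : realType.
Local Notation PT := (R * R)%type.
Implicit Types (f g : PT -> R) (x e : PT).

(** Directional derivatives become ordinary derivatives along a line, to which the one-variable
    theorems apply. *)
Lemma is_derive_line f x e (t l : R) :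
  is_derive (t *: e + x) e f l <-> is_derive t (1 : R) (fun s : R => f (s *: e + x)) l.
Proof.
have E : (fun h : R => h^-1 *: ((f \o shift (t *: e + x)) (h *: e) - f (t *: e + x))) =
         (fun h : R => h^-1 *: (((fun s : R => f (s *: e + x)) \o shift t) (h *: 1) - f (t *: e + x))).
  by apply/funext => h /=; rewrite [h *: (1 : R)]mulr1 scalerDl addrA.
split => -[h1 h2].
- by split; [rewrite /derivable -E|rewrite /derive -E].
- by split; [rewrite /derivable E|rewrite /derive E].
Qed.

Lemma derive_line f x e (t : R) : derivable f (t *: e + x) e ->
  is_derive t (1 : R) (fun s : R => f (s *: e + x)) ('D_e f (t *: e + x)).
Proof. by move=> h; apply/is_derive_line; split. Qed.

Definition axis e := e = e1 R \/ e = e2 R.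

Definition smooth f := forall n, Cn n f.

Lemma CnP n f : Cn n.+1 f <-> [/\ continuous f,
  forall e, axis e -> forall x, derivable f x e & forall e, axis e -> Cn n ('D_e f)].
Proof.
split=> [[cf d1 d2 h1 h2]|[cf d h]].
  split; first exact: cf.
  - by move=> e [->|->]; [exact: d1|exact: d2].
  - by move=> e [->|->]; [exact: h1|exact: h2].
by split => //; [apply: d; left|apply: d; right|apply: h; left|apply: h; right].
Qed.

Lemma Cn_continuous n f : Cn n f -> continuous f.
Proof. by case: n => // n /CnP[]. Qed.

Lemma CnW n f : Cn n.+1 f -> Cn n f.
Proof.
elim: n f => [f /CnP[]//|n IH f] /CnP[cf df h]; apply/CnP; split => // e he.
exact/IH/h.
Qed.

Lemma Cn_cst n (c : R) : Cn n (cst c : PT -> R).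
Proof.
elim: n c => [c|n IH c]; first exact: cst_continuous.
apply/CnP; split => [|e he x|e he]; first exact: cst_continuous.
  exact: derivable_cst.
by rewrite (_ : 'D_e (cst c) = cst 0)//; apply/funext => x; rewrite derive_cst.
Qed.

Lemma CnD n f g : Cn n f -> Cn n g -> Cn n (fun x => f x + g x).
Proof.
elim: n f g => [f g cf cg x|n IH f g]; first exact: continuousD (cf x) (cg x).
move=> /CnP[cf df Df] /CnP[cg dg Dg]; apply/CnP; split => [x|e he x|e he].
- exact: continuousD (cf x) (cg x).
- exact: derivableD (df e he x) (dg e he x).
- rewrite (_ : 'D_e _ = fun x => 'D_e f x + 'D_e g x); first exact: IH (Df e he) (Dg e he).
  by apply/funext => x; rewrite [LHS]deriveD//; [exact: df|exact: dg].
Qed.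

Lemma CnM n f g : Cn n f -> Cn n g -> Cn n (fun x => f x * g x).
Proof.
elim: n f g => [f g cf cg x|n IH f g]; first exact: continuousM (cf x) (cg x).
move=> Cf Cg; have [cf df Df] := (CnP _ _).1 Cf; have [cg dg Dg] := (CnP _ _).1 Cg.
apply/CnP; split => [x|e he x|e he].
- exact: continuousM (cf x) (cg x).
- exact: derivableM (df e he x) (dg e he x).
- rewrite (_ : 'D_e _ = fun x => f x * 'D_e g x + g x * 'D_e f x).
    by apply: CnD; apply: IH => //; [exact: CnW|exact: Dg|exact: CnW|exact: Df].
  by apply/funext => x; rewrite [LHS]deriveM//; [exact: df|exact: dg].
Qed.

Lemma CnZ n c f : Cn n f -> Cn n (fun x => c * f x).
Proof. by move=> hf; apply: CnM => //; exact: Cn_cst. Qed.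

Lemma derive_affine f c (s : R) e x : derivable f (c + s *: x) e ->
  is_derive x e (fun y => f (c + s *: y)) (s * 'D_e f (c + s *: x)).
Proof.
move=> df.
rewrite -[x]add0r -[0](scale0r e); apply/is_derive_line.
have -> : (fun t : R => f (c + s *: (t *: e + x))) =
          (fun t : R => f (t *: e + (c + s *: x))) \o (fun t => s * t).
  apply/funext => t /=; congr f; rewrite scalerDr scalerA.
  by rewrite addrCA [s * t *: e + _]addrC addrC.
rewrite scale0r add0r mulrC.
apply: is_derive1_comp.
  rewrite mulr0.
  have := @derive_line f (c + s *: x) e 0.
  by rewrite scale0r add0r; apply.
by have := is_deriveZ s (is_derive_id (0 : R) (1 : R)); rewrite /GRing.scale/= mulr1.
Qed.

Lemma Cn_affine n f c (s : R) : Cn n f -> Cn n (fun x => f (c + s *: x)).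
Proof.
have caff : continuous (fun x : PT => c + s *: x).
  by move=> x; apply: continuousD; [exact: cst_continuous|exact: scaler_continuous].
have ccomp (g : PT -> R) : continuous g -> continuous (fun x => g (c + s *: x)).
  by move=> cg x; apply: (@continuous_comp _ _ _ (fun x : PT => c + s *: x) g); [exact: caff|exact: cg].
elim: n f => [f|n IH f]; first exact: ccomp.
move=> /CnP[cf df Df]; apply/CnP; split => [|e he x|e he]; first exact: ccomp.
  by case: (@derive_affine f c s e x (df e he _)).
rewrite (_ : 'D_e _ = fun x => s * 'D_e f (c + s *: x)).
  by apply: CnZ; exact: (IH _ (Df e he)).
by apply/funext => x; case: (@derive_affine f c s e x (df e he _)).
Qed.

Lemma smoothD f g : smooth f -> smooth g -> smooth (fun x => f x + g x).
Proof. by move=> hf hg n; apply: CnD. Qed.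
Lemma smoothM f g : smooth f -> smooth g -> smooth (fun x => f x * g x).
Proof. by move=> hf hg n; apply: CnM. Qed.
Lemma smooth_cst (c : R) : smooth (cst c).
Proof. by move=> n; apply: Cn_cst. Qed.
Lemma smooth_derive f e : axis e -> smooth f -> smooth ('D_e f).
Proof. by move=> he hf n; have /CnP[_ _] := hf n.+1; apply. Qed.
Lemma smooth_derivable f e x : axis e -> smooth f -> derivable f x e.
Proof. by move=> he hf; have /CnP[_ + _] := hf 1%N; apply. Qed.
Lemma smooth_continuous f : smooth f -> continuous f.
Proof. by move=> hf; exact: (Cn_continuous (hf 0%N)). Qed.

Lemma is_derive_tensor1 (p q : R -> R) x (l : R) : is_derive x.1 (1 : R) p l ->
  is_derive x (e1 R) (fun x => p x.1 * q x.2) (l * q x.2).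
Proof.
move=> hp; rewrite -[x]add0r -[0](scale0r (e1 R)); apply/is_derive_line.
rewrite scale0r add0r.
rewrite (_ : (fun s => _) = (fun s => q x.2 * p (s + x.1))); last first.
  apply/funext => s /=; rewrite mulrC; congr (q _ * p _).
    by rewrite [s *: 0]mulr0 add0r.
  by rewrite [s *: 1]mulr1.
have h : is_derive (0 : R) 1 (fun s : R => s + x.1) 1.
  by have := is_deriveD (is_derive_id (0 : R) 1) (is_derive_cst x.1 (0 : R) 1); rewrite addr0.
have := @is_derive1_comp _ p (fun s => s + x.1) 0 l 1.
rewrite add0r mulr1 => /(_ hp h) /(is_deriveZ (q x.2)).
by rewrite /GRing.scale/= [q x.2 * l]mulrC.
Qed.

Lemma is_derive_tensor2 (p q : R -> R) x (l : R) : is_derive x.2 (1 : R) q l ->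
  is_derive x (e2 R) (fun x => p x.1 * q x.2) (p x.1 * l).
Proof.
move=> hp; rewrite -[x]add0r -[0](scale0r (e2 R)); apply/is_derive_line.
rewrite scale0r add0r.
rewrite (_ : (fun s => _) = (fun s => p x.1 * q (s + x.2))); last first.
  apply/funext => s /=; congr (p _ * q _).
    by rewrite [s *: 0]mulr0 add0r.
  by rewrite [s *: 1]mulr1.
have h : is_derive (0 : R) 1 (fun s : R => s + x.2) 1.
  by have := is_deriveD (is_derive_id (0 : R) 1) (is_derive_cst x.2 (0 : R) 1); rewrite addr0.
have := @is_derive1_comp _ q (fun s => s + x.2) 0 l 1.
by rewrite add0r mulr1 => /(_ hp h) /(is_deriveZ (p x.1)).
Qed.

Lemma smooth_tensor p q : smooth1 p -> smooth1 q -> smooth (fun x => p x.1 * q x.2).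
Proof.
move=> + + n; elim: n p q => [p q|n IH p q] hp hq.
  move=> x; apply: continuousM; apply: continuous_comp.
  - exact: cvg_fst.
  - exact: smooth1_continuous.
  - exact: cvg_snd.
  - exact: smooth1_continuous.
have [p' sp' pp'] := smooth1_derive hp; have [q' sq' qq'] := smooth1_derive hq.
apply/CnP; split.
- exact: (Cn_continuous (IH _ _ hp hq)).
- move=> e [] -> x.
    by case: (@is_derive_tensor1 p q x _ (pp' _)).
  by case: (@is_derive_tensor2 p q x _ (qq' _)).
- move=> e [] ->.
    rewrite (_ : 'D__ _ = fun x => p' x.1 * q x.2); first exact: IH.
    by apply/funext => x; case: (@is_derive_tensor1 p q x _ (pp' _)).
  rewrite (_ : 'D__ _ = fun x => p x.1 * q' x.2); first exact: IH.
  by apply/funext => x; case: (@is_derive_tensor2 p q x _ (qq' _)).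
Qed.

End PlaneCalculus.

(** * Compactly supported test functions and their measurability *)

Section TestFunctions.
Variable R : realType.
Local Notation PT := (R * R)%type.
Local Notation P := (measurableTypeR R * measurableTypeR R)%type.
Local Notation mu := (@leb2 R).
Local Notation sf := (summable_fun mu).
Local Notation J := (Rintegral mu setT).
Implicit Types (f g : PT -> R) (x e : PT) (M : R).

(** The closed ball of the product norm, which is the maximum of the coordinates; being a rectangle,
    it has an explicit measure. *)
Definition box M : set PT := [set x | `|x.1| <= M /\ `|x.2| <= M].

Definition supported f M := forall x, ~ box M x -> f x = 0.

Lemma box_setX M : box M = `[-M, M]%classic `*` `[-M, M]%classic.
Proof. by apply/seteqP; split => x /=; rewrite /box/= !in_itv/= !ler_norml. Qed.

Lemma box_compact M : compact (box M).
Proof. by rewrite box_setX; apply: compact_setX; exact: segment_compact. Qed.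

Lemma box_closed M : closed (box M).
Proof.
by apply: compact_closed; [exact: norm_hausdorff|exact: box_compact].
Qed.

Lemma box_norm M x : box M x <-> `|x| <= M.
Proof. by rewrite /box/= prod_normE ge_max; split => [[-> ->]//|/andP]. Qed.

Lemma le_box M M' : M <= M' -> box M `<=` box M'.
Proof. by move=> MM' x [h1 h2]; split; exact: le_trans MM'. Qed.

Lemma test_supported f : test_function f -> exists2 M, 0 < M & supported f M.
Proof.
move=> [_ /compact_bounded[M [_ HM]]].
have [M0 MM0] : exists M0, M < M0 /\ 0 < M0.
  by exists (`|M| + 1); have := ler_norm M; have := normr_ge0 M; split; lra.
exists M0; first by case: MM0.
move=> x nbx; apply: contra_notP nbx => fx.
apply/box_norm; apply: (HM M0); first by case: MM0.
by apply: subset_closure; exact/eqP.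
Qed.

Lemma supported_test f M : smooth f -> supported f M -> test_function f.
Proof.
move=> sf fM; split => //; apply: (@subclosed_compact _ _ (box M)).
- exact: closed_closure.
- exact: box_compact.
- have -> : box M = closure (box M) by apply/closure_id; exact: box_closed.
  apply: closure_subset => x /= /eqP fx; apply: contra_notP fx; exact: fM.
Qed.

Lemma test_smooth f : test_function f -> smooth f. Proof. by case. Qed.

Lemma le_supported f M M' : M <= M' -> supported f M -> supported f M'.
Proof. by move=> MM' fM x nx; apply: fM; apply: contra_not nx; exact: le_box. Qed.

Lemma test_add f g : test_function f -> test_function g -> test_function (fun x => f x + g x).
Proof.
move=> tf tg; have [M M0 fM] := test_supported tf; have [N N0 gN] := test_supported tg.
apply: (@supported_test _ (Num.max M N)).
  by apply: smoothD; exact: test_smooth.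
have hM : M <= Num.max M N by rewrite le_max lexx.
have hN : N <= Num.max M N by rewrite le_max lexx orbT.
by move=> x nx; rewrite (le_supported hM fM)// (le_supported hN gN)// addr0.
Qed.

Lemma test_mull f g : smooth f -> test_function g -> test_function (fun x => f x * g x).
Proof.
move=> sf tg; have [N N0 gN] := test_supported tg.
apply: (@supported_test _ N); first by apply: smoothM => //; exact: test_smooth.
by move=> x /gN ->; rewrite mulr0.
Qed.

Lemma test_mul f g : test_function f -> test_function g -> test_function (fun x => f x * g x).
Proof. by move=> /test_smooth; exact: test_mull. Qed.

Lemma test_scale (c : R) f : test_function f -> test_function (fun x => c * f x).
Proof. by apply: test_mull; exact: smooth_cst. Qed.

Lemma test_opp f : test_function f -> test_function (fun x => - f x).
Proof. by move=> /(test_scale (-1)); under eq_fun do rewrite mulN1r. Qed.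

Lemma test0 : test_function (fun _ : PT => 0 : R).
Proof. by apply: (@supported_test _ 0) => //; exact: smooth_cst. Qed.

Lemma supported_derive f M e : supported f M -> supported ('D_e f) M.
Proof.
move=> fM x nx.
have E : \forall y \near x, (cst 0 : PT -> R) y = f y.
  have : open (~` box M) by apply: closed_openC; exact: box_closed.
  rewrite openE => /(_ x nx); apply: filterS => y ny.
  by rewrite fM.
by rewrite -(near_eq_derive _ E) derive_cst.
Qed.

Lemma test_derive f e : axis e -> test_function f -> test_function ('D_e f).
Proof.
move=> he tf; have [M _ fM] := test_supported tf.
apply: (@supported_test _ M); last exact: supported_derive.
exact/smooth_derive/test_smooth.
Qed.

Lemma test_affine f c (s : R) : s != 0 -> test_function f -> test_function (fun x => f (c + s *: x)).
Proof.
move=> s0 tf; have [M _ fM] := test_supported tf.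
apply: (@supported_test _ ((`|c| + M) / `|s|)).
  move=> n; apply: Cn_affine; exact: test_smooth.
move=> x nx; apply: fM; apply: contra_not nx => /box_norm h.
apply/box_norm; rewrite ler_pdivlMr ?normr_gt0// mulrC -normrZ.
rewrite (_ : s *: x = (c + s *: x) - c); last by rewrite addrC addKr.
by rewrite (le_trans (ler_normB _ _))// addrC lerD2l.
Qed.

Lemma test_bounded f : test_function f -> exists2 C : R, 0 < C & forall x, `|f x| <= C.
Proof.
move=> tf; have [M M0 fM] := test_supported tf.
have [||c _ hc] := @compact_EVT_max _ R (fun x => `|f x|) (box M) _ (@box_compact M).
- by exists 0; rewrite /box/= normr0 ltW.
- apply: continuous_subspaceT => x; apply: continuous_comp; last exact: norm_continuous.
  exact/smooth_continuous/test_smooth.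
exists (`|f c| + 1); first by rewrite ltr_wpDl.
move=> x; have [bx|nbx] := pselect (box M x).
  by rewrite (le_trans (hc x _)) ?inE// lerDl.
by rewrite fM// normr0 addr_ge0.
Qed.

(** This links the topology of the plane with the product sigma-algebra: an open set is the
    countable union of the rational squares it contains. *)
Lemma open_measurable_plane (U : set PT) : open U -> measurable (U : set P).
Proof.
move=> oU.
pose bx (a b r : rat) : set P := `]ratr a - ratr r, ratr a + ratr r[%classic `*` `]ratr b - ratr r, ratr b + ratr r[%classic.
pose F a b r := if `[< bx a b r `<=` U >] then bx a b r else set0.
rewrite (_ : (U : set P) = \bigcup_a \bigcup_b \bigcup_r F a b r); last first.
  apply/seteqP; split; last first.
    by move=> x [a _ [b _ [r _]]]; rewrite /F; case: asboolP => // h /h.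
  move=> x Ux.
  have : nbhs x U by move: oU; rewrite openE => /(_ x Ux).
  move=> /nbhs_ballP[e /= e0 eU].
  have [r /andP[r0 re]] : exists r : rat, 0 < (ratr r : R) < e / 2.
    have e2 : 0 < e / 2 by rewrite divr_gt0.
    by have [r] := rat_in_itvoo e2; rewrite in_itv; exists r.
  have h1 : x.1 - ratr r < x.1 + ratr r by lra.
  have h2 : x.2 - ratr r < x.2 + ratr r by lra.
  have [a ha] := rat_in_itvoo h1; have [b hb] := rat_in_itvoo h2.
  move: ha hb; rewrite !in_itv/= => /andP[a1 a2] /andP[b1 b2].
  exists a => //; exists b => //; exists r => //.
  rewrite /F; case: asboolP => [_|[]].
    by split => /=; rewrite in_itv/=; apply/andP; split; lra.
  move=> y [/=]; rewrite !in_itv/= => /andP[h3 h4] /andP[h5 h6].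
  apply: eU; split; rewrite /ball/= ltr_norml; apply/andP; split; lra.
apply: bigcupT_measurable_rat => a; apply: bigcupT_measurable_rat => b; apply: bigcupT_measurable_rat => r.
rewrite /F; case: ifP => _; last exact: measurable0.
by apply: measurableX; exact: measurable_itv.
Qed.

Lemma continuous_measurable_plane f : continuous f -> measurable_fun [set: P] f.
Proof.
move=> cf; apply: (measurability _ (RGenOInfty.measurableE R)).
move=> _ [_ [a ->] <-]; rewrite setTI; apply: open_measurable_plane.
apply: open_comp; last exact: interval_open.
by move=> x _; exact: cf.
Qed.

Lemma test_measurable f : test_function f -> measurable_fun [set: P] f.
Proof. by move=> /test_smooth/smooth_continuous; exact: continuous_measurable_plane. Qed.

Lemma measurable_box M : measurable (box M : set P).
Proof. by rewrite box_setX; apply: measurableX; exact: measurable_itv. Qed.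

Lemma leb2_box M : 0 <= M -> mu (box M) = ((2 * M) ^+ 2)%:E.
Proof.
move=> M0; rewrite box_setX.
have E : lebesgue_measure (`[- M, M]%classic : set (measurableTypeR R)) = (2 * M)%:E.
  rewrite lebesgue_measure_itv/= lte_fin.
  case: ltP => h; first by rewrite -EFinB; congr EFin; ring.
  by congr EFin; lra.
rewrite -[RHS]/((2 * M)%:E * (2 * M)%:E)%E -E.
by apply: product_measure1E; exact: measurable_itv.
Qed.

Lemma sf_box M : 0 <= M -> sf (\1_(box M)).
Proof.
move=> M0; apply/ge0_sfP.
- by apply: measurable_indic; exact: measurable_box.
- by move=> x; rewrite indicE.
- rewrite integral_indic ?setIT//; last exact: measurable_box.
  by rewrite leb2_box// ltry.
Qed.

Lemma J_box M : 0 <= M -> J (\1_(box M)) = (2 * M) ^+ 2.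
Proof.
move=> M0; rewrite /Rintegral integral_indic ?setIT//; last exact: measurable_box.
by rewrite leb2_box.
Qed.

Lemma supported_le f M C x : supported f M -> (forall x, `|f x| <= C) -> `|f x| <= C * \1_(box M) x.
Proof.
move=> fM fC; rewrite indicE; case: (pselect (box M x)) => h.
  by rewrite mem_set// mulr1.
by rewrite memNset// mulr0 fM// normr0.
Qed.

Lemma test_sf f : test_function f -> sf f.
Proof.
move=> tf; have [M M0 fM] := test_supported tf; have [C C0 fC] := test_bounded tf.
apply: (@sf_le _ P R mu f (fun x => C * \1_(box M) x)); [exact: test_measurable| |].
- by move=> x; exact: supported_le.
- by apply: sfZ; apply: sf_box; exact: ltW.
Qed.

End TestFunctions.

(** * Density of test functions and the fundamental lemma *)

Section Density.
Variable R : realType.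
Local Notation PT := (R * R)%type.
Local Notation P := (measurableTypeR R * measurableTypeR R)%type.
Local Notation mu := (@leb2 R).
Local Notation sf := (summable_fun mu).
Local Notation J := (Rintegral mu setT).
Implicit Types (f g h : PT -> R) (x : PT).

(** A smooth function that tends pointwise to the indicator of []a, b[] as [n] grows and vanishes
    outside this interval for every [n]. *)
Definition itv_bump (a b : R) (n : nat) (t : R) : R :=
  expbump (- (n.+1%:R * a) + n.+1%:R * t) * expbump (n.+1%:R * b + - n.+1%:R * t).

Lemma smooth1_itv_bump a b n : smooth1 (itv_bump a b n).
Proof. by apply: smooth1M; apply: smooth1_affine; exact: smooth1_expbump. Qed.

Lemma itv_bump01 a b n t : 0 <= itv_bump a b n t <= 1.
Proof.
rewrite mulr_ge0 ?expbump_ge0//= -[leRHS]mulr1.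
by apply: ler_pM => //; rewrite ?expbump_ge0 ?expbump_le1.
Qed.

Lemma itv_bump_out a b n t : ~~ (a < t < b) -> itv_bump a b n t = 0.
Proof.
have n0 : 0 < n.+1%:R :> R by [].
rewrite negb_and -!leNgt => /orP[h|h]; rewrite /itv_bump.
- by rewrite expbump_le0 ?mul0r// addrC subr_le0 ler_wpM2l// ltW.
- by rewrite [X in _ * X]expbump_le0 ?mulr0// mulNr subr_le0 ler_wpM2l// ltW.
Qed.

Lemma itv_bump_gt0 a b n t : a < t < b -> 0 < itv_bump a b n t.
Proof.
move=> /andP[at_ tb]; rewrite mulr_gt0// expbump_gt0//.
- by rewrite addrC subr_gt0 ltr_pM2l.
- by rewrite mulNr subr_gt0 ltr_pM2l.
Qed.

(** Squeezed between $1 - 1/(c(n+1))$ and 1, since $e^{-1/u} \ge 1 - 1/u$. *)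
Lemma expbump_cvg (u : nat -> R) (c : R) : 0 < c ->
  (forall n, n.+1%:R * c <= u n) -> expbump (u n) @[n --> \oo] --> (1 : R).
Proof.
move=> c0 hu.
apply: (@squeeze_cvgr _ _ _ _ (fun n : nat => 1 - c^-1 * n.+1%:R^-1) (fun=> 1)).
- near=> n.
  have u0 : 0 < u n by apply: lt_le_trans (hu n); rewrite mulr_gt0.
  rewrite expbump_le1 andbT /expbump u0.
  apply: le_trans (expR_ge1Dx _).
  rewrite lerD2l lerN2 -invfM lef_pV2 ?posrE ?mulr_gt0//.
  by rewrite mulrC.
- rewrite -[X in _ --> X]subr0; apply: cvgB; first exact: cvg_cst.
  rewrite -[X in _ --> X](mulr0 c^-1); apply: cvgM; first exact: cvg_cst.
  exact: cvg_harmonic.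
- exact: cvg_cst.
Unshelve. all: end_near. Qed.

Lemma itv_bump_cvg a b t : itv_bump a b n t @[n --> \oo] --> (((a < t < b)%R : nat)%:R : R).
Proof.
have [/andP[at_ tb]|nt] := boolP (a < t < b); last first.
  by under eq_fun do rewrite (itv_bump_out _ nt); exact: cvg_cst.
rewrite /= -[X in _ --> X](mulr1 1); apply: cvgM.
- apply: (@expbump_cvg _ (t - a)); first by rewrite subr_gt0.
  by move=> n; rewrite mulrBr addrC.
- apply: (@expbump_cvg _ (b - t)); first by rewrite subr_gt0.
  by move=> n; rewrite mulrBr mulNr.
Qed.

Definition rect_bump (a b c d : R) (n : nat) : PT -> R :=
  fun x => itv_bump a b n x.1 * itv_bump c d n x.2.

Lemma test_rect_bump a b c d n : test_function (rect_bump a b c d n).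
Proof.
apply: (@supported_test _ _ (`|a| + `|b| + `|c| + `|d|)).
  by apply: smooth_tensor; exact: smooth1_itv_bump.
have N := (ler_norm, normr_ge0).
have [a1 a2] : - a <= `|a| /\ 0 <= `|a| by rewrite -normrN; split; [exact: ler_norm|].
have [b1 b2] : b <= `|b| /\ 0 <= `|b| by rewrite ler_norm.
have [c1 c2] : - c <= `|c| /\ 0 <= `|c| by rewrite -normrN; split; [exact: ler_norm|].
have [d1 d2] : d <= `|d| /\ 0 <= `|d| by rewrite ler_norm.
have a3 : a <= `|a| := ler_norm a. have c3 : c <= `|c| := ler_norm c.
have b3 : - b <= `|b| by rewrite -normrN ler_norm.
have d3 : - d <= `|d| by rewrite -normrN ler_norm.
move=> x nx; rewrite /rect_bump.
have [h|h] := boolP (a < x.1 < b); last by rewrite itv_bump_out// mul0r.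
have [k|k] := boolP (c < x.2 < d); last by rewrite [X in _ * X]itv_bump_out// mulr0.
exfalso; apply: nx; move/andP: h => [h1 h2]; move/andP: k => [k1 k2].
split; rewrite ler_norml; apply/andP; split; lra.
Qed.

Lemma rect_bump01 a b c d n x : 0 <= rect_bump a b c d n x <= 1.
Proof.
have /andP[h1 h2] := itv_bump01 a b n x.1; have /andP[h3 h4] := itv_bump01 c d n x.2.
by rewrite mulr_ge0//= mulr_ile1.
Qed.

Definition cutoff (n : nat) : PT -> R :=
  rect_bump (- n.+1%:R) n.+1%:R (- n.+1%:R) n.+1%:R n.

Lemma test_cutoff n : test_function (cutoff n).
Proof. exact: test_rect_bump. Qed.

Lemma cutoff01 n x : 0 <= cutoff n x <= 1.
Proof. exact: rect_bump01. Qed.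

Lemma cutoff_gt0 x : exists n, 0 < cutoff n x.
Proof.
have [n hn] : exists n : nat, `|x.1| + `|x.2| < n.+1%:R.
  exists (Num.Def.archi_bound (`|x.1| + `|x.2|)).
  rewrite (lt_trans (archi_boundP _)) ?addr_ge0// ltr_nat//.
exists n; have n1 := normr_ge0 x.1; have n2 := normr_ge0 x.2.
apply: mulr_gt0; apply: itv_bump_gt0; rewrite -ltr_norml; lra.
Qed.

Lemma cutoff_cvg x : cutoff n x @[n --> \oo] --> (1 : R).
Proof.
have h (t : R) : itv_bump (- n.+1%:R) n.+1%:R n t @[n --> \oo] --> (1 : R).
  have [N hN] : exists N : nat, `|t| + 1 < N%:R.
    by exists (Num.Def.archi_bound (`|t| + 1)); rewrite archi_boundP// addr_ge0.
  suff : itv_bump (- n.+1%:R) n.+1%:R n t @[n --> \oo] --> (1 * 1 : R) by rewrite mulr1.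
  rewrite -(cvg_shiftn N).
  have k n : N%:R <= (n + N).+1%:R :> R by rewrite ler_nat leqW// leq_addl.
  have k' n : n.+1%:R <= (n + N).+1%:R :> R by rewrite ler_nat ltnS leq_addr.
  have tn := ler_norm t; have tn' : - t <= `|t| by rewrite -normrN ler_norm.
  apply: cvgM; apply: (@expbump_cvg _ 1) => // n.
  - have := k n; have := k' n; set m := (n + N).+1%:R => h1 h2.
    rewrite mulr1 (le_trans h1)// (_ : _ + _ = m * (m + t)); last by ring.
    by rewrite -[leLHS]mulr1 ler_wpM2l ?ler0n//; lra.
  - have := k n; have := k' n; set m := (n + N).+1%:R => h1 h2.
    rewrite mulr1 (le_trans h1)// (_ : _ + _ = m * (m - t)); last by ring.
    by rewrite -[leLHS]mulr1 ler_wpM2l ?ler0n//; lra.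
by rewrite -[X in _ --> X](mulr1 1); apply: cvgM; exact: h.
Qed.

Section Approx.
Variable g : PT -> R.
Hypothesis g0 : forall x, 0 <= g x.
Hypothesis hg : sf g.

(** Approximation in the weighted space $L^1(g)$. Values are kept in [0, 1] so that [g] itself
    dominates all differences and products of approximants stay controlled. *)
Definition approximable h := [/\ measurable_fun [set: P] h,
  forall x, 0 <= h x <= 1 & forall e : R, 0 < e -> exists f,
  [/\ test_function f, forall x, 0 <= f x <= 1 & J (fun x => `|f x - h x| * g x) <= e]].

Lemma norm_sub01 (a b : R) : 0 <= a <= 1 -> 0 <= b <= 1 -> `|a - b| <= 1.
Proof. by move=> /andP[? ?] /andP[? ?]; rewrite ler_norml; apply/andP; split; lra. Qed.

Lemma sf_approx f h : measurable_fun [set: P] f -> measurable_fun [set: P] h ->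
  (forall x, 0 <= f x <= 1) -> (forall x, 0 <= h x <= 1) -> sf (fun x => `|f x - h x| * g x).
Proof.
move=> mf mh f01 h01; apply: (@sf_le _ P R mu _ g) => //.
- apply: measurable_funM; last exact: sf_meas hg.
  by apply: measurableT_comp => //; exact: measurable_funB.
- move=> x; rewrite normrM normr_id (ger0_norm (g0 x)).
  by rewrite -[leRHS]mul1r ler_wpM2r// norm_sub01.
Qed.

Lemma approximable_near h : measurable_fun [set: P] h -> (forall x, 0 <= h x <= 1) ->
  (forall e : R, 0 < e -> exists2 k, approximable k & J (fun x => `|k x - h x| * g x) <= e) ->
  approximable h.
Proof.
move=> mh h01 H; split => // e e0.
have e2 : 0 < e / 2 by rewrite divr_gt0.
have [k [mk k01 /(_ _ e2)[f [tf f01 hf]]] hk] := H _ e2.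
exists f; split => //.
have mf := test_measurable tf.
apply: (@le_trans _ _ (J (fun x => `|f x - k x| * g x + `|k x - h x| * g x))).
  apply: leJ; [exact: sf_approx|by apply: sfD; exact: sf_approx|].
  by move=> x; rewrite -mulrDl ler_wpM2r// ler_distD.
rewrite JD; [lra|exact: sf_approx|exact: sf_approx].
Qed.

Lemma approximable_test f : test_function f -> (forall x, 0 <= f x <= 1) -> approximable f.
Proof.
move=> tf f01; split => //; first exact: test_measurable.
move=> e e0; exists f; split => //.
by under eq_fun do rewrite subrr normr0 mul0r; rewrite J0 ltW.
Qed.

Lemma approximable_lim (h_ : nat -> PT -> R) h :
  (forall n, approximable (h_ n)) -> (forall x, h_ n x @[n --> \oo] --> h x) -> approximable h.
Proof.
move=> hh ch.
have m_ n : measurable_fun [set: P] (h_ n) by case: (hh n).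
have h01_ n x : 0 <= h_ n x <= 1 by case: (hh n).
have h01 x : 0 <= h x <= 1.
  apply/andP; split.
    by rewrite -(cvg_lim _ (ch x))//; apply: limr_ge; [exact: cvgP (ch x)|near=> n; case/andP: (h01_ n x)].
  by rewrite -(cvg_lim _ (ch x))//; apply: limr_le; [exact: cvgP (ch x)|near=> n; case/andP: (h01_ n x)].
have mh : measurable_fun [set: P] h by apply: (measurable_fun_cvg m_) => x _; exact: ch.
apply: approximable_near => // e e0.
have [_ c0] : sf (fun=> 0) /\ J (fun x => `|h_ n x - h x| * g x) @[n --> \oo] --> J (fun _ : P => 0 : R).
  apply: (@dominated_J _ P R mu (fun n x => `|h_ n x - h x| * g x) (fun=> 0) g) => //.
  - by move=> n; exact: sf_meas (sf_approx (m_ n) mh (h01_ n) h01).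
  - move=> n x; rewrite normrM normr_id (ger0_norm (g0 x)).
    by rewrite -[leRHS]mul1r ler_wpM2r// norm_sub01.
  - move=> x; rewrite -[X in _ --> X](mul0r (g x)); apply: cvgM; last exact: cvg_cst.
    have H : `|h_ n x - h x| @[n --> \oo] --> `|h x - h x|.
      by apply: cvg_norm; apply: cvgB; [exact: ch|exact: cvg_cst].
    by move: H; rewrite subrr normr0.
move: c0; rewrite J0 => /cvgrPdist_le/(_ _ e0)[N _ /(_ N (leqnn _))].
by rewrite sub0r normrN => hN; exists (h_ N) => //; rewrite (le_trans (ler_norm _)).
Unshelve. all: end_near. Qed.

Lemma approximable1 : approximable (fun=> 1).
Proof.
apply: (@approximable_lim cutoff); last exact: cutoff_cvg.
by move=> n; apply: approximable_test; [exact: test_cutoff|exact: cutoff01].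
Qed.

Lemma approximableM h k : approximable h -> approximable k -> approximable (fun x => h x * k x).
Proof.
move=> [mh h01 ah] [mk k01 ak].
have hk01 x : 0 <= h x * k x <= 1.
  by case/andP: (h01 x) => ? ?; case/andP: (k01 x) => ? ?; rewrite mulr_ge0//= mulr_ile1.
split => //; first exact: measurable_funM.
move=> e e0; have e2 : 0 < e / 2 by rewrite divr_gt0.
have [f [tf f01 Hf]] := ah _ e2; have [f' [tf' f01' Hf']] := ak _ e2.
have ff01 x : 0 <= f x * f' x <= 1.
  by case/andP: (f01 x) => ? ?; case/andP: (f01' x) => ? ?; rewrite mulr_ge0//= mulr_ile1.
exists (fun x => f x * f' x); split => //; first exact: test_mul.
have mf := test_measurable tf. have mf' := test_measurable tf'.
apply: (@le_trans _ _ (J (fun x => `|f x - h x| * g x + `|f' x - k x| * g x))).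
  apply: leJ.
  - by apply: sf_approx => //; exact: measurable_funM.
  - by apply: sfD; exact: sf_approx.
  move=> x; rewrite -mulrDl ler_wpM2r//.
  rewrite (_ : _ - _ = (f x - h x) * f' x + h x * (f' x - k x)); last by ring.
  rewrite (le_trans (ler_normD _ _))// !normrM lerD//.
    by rewrite ler_piMr//; case/andP: (f01' x) => ? ?; rewrite ger0_norm.
  by rewrite ler_piMl//; case/andP: (h01 x) => ? ?; rewrite ger0_norm.
rewrite JD; [lra|exact: sf_approx|exact: sf_approx].
Qed.

Lemma approximableC h : approximable h -> approximable (fun x => 1 - h x).
Proof.
move=> [mh h01 ah].
have C01 (f : PT -> R) : (forall x, 0 <= f x <= 1) -> (forall x, 0 <= 1 - f x <= 1).
  by move=> f01 x; case/andP: (f01 x) => ? ?; apply/andP; split; lra.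
apply: approximable_near.
- exact: measurable_funB.
- exact: C01.
move=> e e0; have [f [tf f01 Hf]] := ah _ e0.
exists (fun x => 1 - f x); last first.
  apply: le_trans Hf; rewrite le_eqVlt; apply/orP; left; apply/eqP.
  by congr Rintegral; apply/funext => x; rewrite (_ : 1 - f x - _ = - (f x - h x)) ?normrN//; ring.
(* [1 - f] is not compactly supported, but it is the pointwise limit of its cut-off versions. *)
apply: (@approximable_lim (fun n x => cutoff n x * (1 - f x))).
  move=> n; apply: approximable_test.
    rewrite (_ : (fun x => _) = (fun x => (1 - f x) * cutoff n x)).
      apply: test_mull; last exact: test_cutoff.
      apply: smoothD; first exact: smooth_cst.
      exact/test_smooth/test_opp.
    by apply/funext => x; rewrite mulrC.
  move=> x; case/andP: (cutoff01 n x) => ? ?; case/andP: (C01 f f01 x) => ? ?.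
  by rewrite mulr_ge0//= mulr_ile1.
move=> x; rewrite -[X in _ --> X]mul1r; apply: cvgM; last exact: cvg_cst.
exact: cutoff_cvg.
Qed.

Lemma approximable_half h k : approximable h -> approximable k ->
  approximable (fun x => (h x + k x) / 2).
Proof.
move=> [mh h01 ah] [mk k01 ak].
have H01 (f f' : PT -> R) : (forall x, 0 <= f x <= 1) -> (forall x, 0 <= f' x <= 1) ->
    (forall x, 0 <= (f x + f' x) / 2 <= 1).
  by move=> f01 f01' x; case/andP: (f01 x) => ? ?; case/andP: (f01' x) => ? ?; apply/andP; split; lra.
split; [|exact: H01|].
  by apply: measurable_funM => //; exact: measurable_funD.
move=> e e0.
have [f [tf f01 Hf]] := ah _ e0; have [f' [tf' f01' Hf']] := ak _ e0.
have mf := test_measurable tf. have mf' := test_measurable tf'.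
exists (fun x => (f x + f' x) / 2); split; [|exact: H01|].
  rewrite (_ : (fun x => _) = (fun x => 2^-1 * (f x + f' x))); last by apply/funext => x; rewrite mulrC.
  by apply: test_scale; exact: test_add.
apply: (@le_trans _ _ (J (fun x => 2^-1 * (`|f x - h x| * g x + `|f' x - k x| * g x)))).
  apply: leJ.
  - apply: sf_approx; [| |exact: H01|exact: H01].
      by apply: measurable_funM => //; exact: measurable_funD.
    by apply: measurable_funM => //; exact: measurable_funD.
  - by apply: sfZ; apply: sfD; exact: sf_approx.
  move=> x; rewrite -mulrDl mulrA ler_wpM2r//.
  rewrite (_ : _ - _ = 2^-1 * ((f x - h x) + (f' x - k x))); last by field.
  by rewrite normrM ger0_norm// ler_wpM2l// ler_normD.
rewrite JZ ?JD; [lra| | |]; try exact: sf_approx.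
by apply: sfD; exact: sf_approx.
Qed.

End Approx.
End Density.

(** * From indicators of rectangles to measurable functions *)

Section DensityMeasurable.
Variable R : realType.
Local Notation PT := (R * R)%type.
Local Notation P := (measurableTypeR R * measurableTypeR R)%type.
Local Notation mu := (@leb2 R).
Local Notation sf := (summable_fun mu).
Local Notation J := (Rintegral mu setT).
Implicit Types (f h : PT -> R) (x : PT).
Variable g : PT -> R.
Hypothesis g0 : forall x, 0 <= g x.
Hypothesis hg : sf g.
Local Notation approx := (approximable g).

Lemma approximable_indicC (A : set P) : approx (\1_A) -> approx (\1_(~` A)).
Proof.
move=> /(approximableC g0 hg); congr approximable; apply/funext => x.
by rewrite !indicE in_setC; case: (_ \in _); rewrite /= ?subrr ?subr0.
Qed.

Lemma approximable_indicI (A B : set P) : approx (\1_A) -> approx (\1_B) -> approx (\1_(A `&` B)).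
Proof. by move=> hA hB; have := approximableM g0 hg hA hB; rewrite indicI. Qed.

Lemma approximable_indicU (A B : set P) : approx (\1_A) -> approx (\1_B) -> approx (\1_(A `|` B)).
Proof.
move=> /approximable_indicC hA /approximable_indicC hB.
by rewrite -[_ `|` _]setCK setCU; apply: approximable_indicC; exact: approximable_indicI.
Qed.

Lemma approximable_indic_bigcup (F : nat -> set P) : (forall n, approx (\1_(F n))) ->
  approx (\1_(\bigcup_n F n)).
Proof.
move=> hF.
have h0 : approx (\1_(set0 : set P)).
  rewrite -[set0]setCK setC0; apply: approximable_indicC.
  by rewrite indicT; exact: approximable1.
have hn n : approx (\1_(\big[setU/set0]_(i < n) F i)).
  elim: n => [|n IH]; first by rewrite big_ord0.
  by rewrite big_ord_recr/=; exact: approximable_indicU.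
apply: (approximable_lim g0 hg hn) => x.
have [[k _ Fkx]|nx] := pselect ((\bigcup_n F n) x).
  rewrite indicE mem_set; last by exists k.
  apply: cvg_near_cst; near=> n.
  rewrite indicE mem_set//.
  rewrite -bigcup_mkord; exists k => //=; near: n; exact: nbhs_infty_gt.
rewrite indicE memNset//.
apply: cvg_near_cst; near=> n.
rewrite indicE memNset//.
by rewrite -bigcup_mkord => -[k _ Fkx]; apply: nx; exists k.
Unshelve. all: end_near. Qed.

Lemma approximable_rect a b c d : approx (\1_(`]a, b[%classic `*` `]c, d[%classic : set P)).
Proof.
apply: (approximable_lim g0 hg (h_ := rect_bump a b c d)).
  by move=> n; apply: approximable_test; [exact: test_rect_bump|exact: rect_bump01].
move=> x; rewrite (_ : \1__ x = (((a < x.1 < b)%R : nat)%:R : R) * (((c < x.2 < d)%R : nat)%:R : R)).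
  by apply: cvgM; exact: itv_bump_cvg.
rewrite indicE -natrM mulnb; congr ((nat_of_bool _)%:R).
apply/idP/idP; first by rewrite inE/= !in_itv/= => -[-> ->].
by move=> /andP[h1 h2]; rewrite inE/= !in_itv/=.
Qed.

Lemma setT_itvs : [set: R] = \bigcup_n (`]- n%:R, n%:R[%classic : set R).
Proof.
apply/seteqP; split => // t _.
exists (Num.Def.archi_bound `|t|) => //=.
by rewrite in_itv/= -ltr_norml archi_boundP.
Qed.

Lemma approximable_sigma : sigma_algebra setT [set A : set P | approx (\1_A)].
Proof.
split => /=.
- rewrite -[set0]setCK setC0; apply: approximable_indicC.
  by rewrite indicT; exact: approximable1.
- by move=> A; rewrite setTD; exact: approximable_indicC.
- exact: approximable_indic_bigcup.
Qed.

(** The good sets [A] form a sigma-algebra, so it is enough to treat open intervals, whose strips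
    are countable unions of bounded rectangles. *)
Lemma approximable_fst (A : set (measurableTypeR R)) : measurable A -> approx (\1_(A `*` setT : set P)).
Proof.
have -> : (measurable : set (set (measurableTypeR R))) = <<s @RGenOpens.G R >>.
  exact: RGenOpens.measurableE.
move: A; apply: smallest_sub.
  split => /=.
  - rewrite set0X; have [h _ _] := approximable_sigma; exact: h.
  - move=> A hA; rewrite setTD.
    rewrite (_ : _ `*` _ = ~` (A `*` setT)); first exact: approximable_indicC.
    by apply/seteqP; split => [[x y]/= [h _] []|[x y]/= h]//; split => // Ax; apply: h.
  - move=> F hF; rewrite (_ : _ `*` _ = \bigcup_n (F n `*` setT)); first exact: approximable_indic_bigcup.
    by rewrite setX_bigcupl.
move=> _ [a [b ->]].
rewrite [X in _ `*` X](_ : _ = \bigcup_n (`]- n%:R, n%:R[%classic : set R)); last exact: setT_itvs.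
rewrite setX_bigcupr; apply: approximable_indic_bigcup => n.
exact: approximable_rect.
Qed.

Lemma approximable_snd (A : set (measurableTypeR R)) : measurable A -> approx (\1_(setT `*` A : set P)).
Proof.
have -> : (measurable : set (set (measurableTypeR R))) = <<s @RGenOpens.G R >>.
  exact: RGenOpens.measurableE.
move: A; apply: smallest_sub.
  split => /=.
  - rewrite setX0; have [h _ _] := approximable_sigma; exact: h.
  - move=> A hA; rewrite setTD.
    rewrite (_ : _ `*` _ = ~` (setT `*` A)); first exact: approximable_indicC.
    by apply/seteqP; split => [[x y]/= [_ h] []|[x y]/= h]//; split => // Ax; apply: h.
  - move=> F hF; rewrite (_ : _ `*` _ = \bigcup_n (setT `*` F n)); first exact: approximable_indic_bigcup.
    by rewrite setX_bigcupr.
move=> _ [a [b ->]].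
rewrite [X in X `*` _](_ : _ = \bigcup_n (`]- n%:R, n%:R[%classic : set R)); last exact: setT_itvs.
rewrite setX_bigcupl; apply: approximable_indic_bigcup => n.
exact: approximable_rect.
Qed.

Lemma approximable_indic (A : set P) : measurable A -> approx (\1_A).
Proof.
rewrite measurable_prod_measurableType; move: A.
apply: smallest_sub; first exact: approximable_sigma.
move=> _ [A mA [B mB <-]] /=.
rewrite (_ : A `*` B = (A `*` setT) `&` (setT `*` B)).
  by apply: approximable_indicI; [exact: approximable_fst|exact: approximable_snd].
by rewrite -setXI setIT setTI.
Qed.

(* Horner scheme for the binary expansion of [h]. *)
Lemma approximable_measurable h : measurable_fun [set: P] h -> (forall x, 0 <= h x <= 1) -> approx h.
Proof.
move=> mh h01.
have H n : forall h, measurable_fun [set: P] h -> (forall x, 0 <= h x <= 1) ->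
    exists2 k, approx k & forall x, `|k x - h x| <= 2^-1 ^+ n.
  elim: n => [|n IH] {}h {}mh {}h01.
    exists (fun=> 1); first exact: approximable1.
    by move=> x; rewrite expr0 norm_sub01// ler01 lexx.
  pose A : set P := [set x | 2^-1 <= h x].
  have mA : measurable A.
    by rewrite -[A]setTI; apply: (@measurable_fun_le _ P R setT (fun=> 2^-1) h).
  have [||k ak hk] := IH (fun x => 2 * h x - \1_A x).
  - by apply: measurable_funB; [exact: measurable_funM|exact: measurable_indic].
  - move=> x; rewrite indicE; case/andP: (h01 x) => ? ?.
    have [|] := boolP (x \in A); rewrite ?inE ?notin_setE/= => Ax.
      by rewrite /A/= in Ax; apply/andP; split; lra.
    by move/negP : Ax; rewrite -ltNge => Ax; apply/andP; split; lra.
  exists (fun x => (\1_A x + k x) / 2).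
    by apply: approximable_half => //; exact: approximable_indic.
  move=> x; rewrite (_ : _ - h x = 2^-1 * (k x - (2 * h x - \1_A x))); last by field.
  by rewrite normrM ger0_norm// exprS ler_wpM2l.
have /choice[k_ hk] : forall n, exists k, approx k /\ forall x, `|k x - h x| <= 2^-1 ^+ n.
  by move=> n; have [k ? ?] := H n h mh h01; exists k.
apply: (approximable_lim g0 hg (h_ := k_)); first by move=> n; case: (hk n).
move=> x; apply/cvgrPdist_le => e e0.
have c0 : (2^-1 : R) ^+ n @[n --> \oo] --> (0 : R).
  by apply: cvg_expr; rewrite ger0_norm// invf_lt1// ltr1n.
move/cvgrPdist_le : c0 => /(_ _ e0); apply: filterS => n.
rewrite sub0r normrN => h1; rewrite distrC; apply: (le_trans ((hk n).2 x)).
exact: le_trans (ler_norm _) h1.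
Qed.

End DensityMeasurable.

(** * The fundamental lemma of the calculus of variations *)

Section FundamentalLemma.
Variable R : realType.
Local Notation PT := (R * R)%type.
Local Notation P := (measurableTypeR R * measurableTypeR R)%type.
Local Notation mu := (@leb2 R).
Local Notation sf := (summable_fun mu).
Local Notation J := (Rintegral mu setT).
Implicit Types (f h w : PT -> R) (x : PT).

Definition locsum w := measurable_fun [set: P] w /\ forall f, test_function f -> sf (fun x => w x * f x).

Lemma ae_zero_cutoff w : (forall n, {ae mu, forall x, w x * cutoff n x = 0}) ->
  {ae mu, forall x, w x = 0}.
Proof.
move=> h; have := ae_foralln h.
apply: filterS => x hx; have [n cn] := cutoff_gt0 x.
by have /eqP := hx n; rewrite mulf_eq0 => /orP[/eqP//|/eqP c0]; move: cn; rewrite c0 ltxx.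
Qed.

(** Test functions approximate the indicator of the set where [w] is positive, in $L^1$ weighted by
    [w] times a cutoff; so the positive part of [w] has integral 0 against each cutoff. *)
Lemma test_orthogonal_le0 w : locsum w -> (forall f, test_function f -> J (fun x => w x * f x) = 0) ->
  {ae mu, forall x, w x <= 0}.
Proof.
move=> [mw lw] hw.
pose A : set P := [set x | 0 < w x].
have mA : measurable A.
  rewrite -[A]setTI (_ : A = w @^-1` `]0, +oo[%classic); first exact: mw.
  by apply/seteqP; split => x; rewrite /A/= in_itv/= andbT.
suff : {ae mu, forall x, w x * \1_A x = 0}.
  apply: ae_impl => x; rewrite indicE; have [|] := boolP (x \in A).
    by rewrite inE /A/= mulr1 => + /eqP => /gt_eqF ->.
  by rewrite notin_setE /A/= => /negP; rewrite -leNgt.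
apply: ae_zero_cutoff => n.
have tc := test_cutoff R n.
have c0 x : 0 <= cutoff n x by case/andP: (cutoff01 n x).
pose g x := `|w x * cutoff n x|.
have hg : sf g by apply: sf_norm; exact: lw.
have g0 x : 0 <= g x by exact: normr_ge0.
have sA : sf (fun x => \1_A x * (w x * cutoff n x)).
  apply: (@sf_le _ P R mu _ g) => //.
    apply: measurable_funM; first exact: measurable_indic.
    exact: (sf_meas (lw _ tc)).
  move=> x; rewrite normrM /g ler_piMl// indicE; case: (_ \in _); rewrite ?normr1 ?normr0//.
have J0 : J (fun x => \1_A x * (w x * cutoff n x)) = 0.
  apply/eqP; rewrite -normr_le0; apply/ler_addgt0Pr => e e0; rewrite add0r.
  have [_ _ /(_ _ e0)[f [tf f01 hf]]] := approximable_indic g0 hg mA.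
  have tfc := test_mul tf tc.
  have E : J (fun x => f x * (w x * cutoff n x)) = 0.
    by rewrite -(hw _ tfc); congr Rintegral; apply/funext => x; ring.
  have sfc : sf (fun x => f x * (w x * cutoff n x)).
    by have := lw _ tfc; under eq_fun do rewrite mulrCA.
  rewrite -[X in `|X|]subr0 -E -JB//; apply: le_trans hf.
  apply: normJ_le.
  - exact: sfB.
  - have mi : measurable_fun [set: P] (\1_A : P -> R) by exact: measurable_indic.
    apply: sf_approx => //; first exact: test_measurable.
    by move=> x; rewrite indicE; case: (_ \in _); rewrite lexx ler01.
  - by move=> x; rewrite -mulrBl normrM distrC.
apply: (@ae_impl _ _ _ mu (fun x => \1_A x * (w x * cutoff n x) = 0)).
  by move=> x; rewrite mulrA [_ * w x]mulrC.
apply: (J_eq0_ae sA _ J0).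
  move=> x; rewrite indicE; have [|] := boolP (x \in A); last by rewrite mul0r.
  by rewrite inE mul1r /A/= => /ltW w0; rewrite mulr_ge0.
Qed.

Lemma test_orthogonal w : locsum w -> (forall f, test_function f -> J (fun x => w x * f x) = 0) ->
  {ae mu, forall x, w x = 0}.
Proof.
move=> lw hw; have h1 := test_orthogonal_le0 lw hw.
have h2 : {ae mu, forall x, - w x <= 0}.
  apply: (@test_orthogonal_le0 (fun x => - w x)).
    case: lw => mw lw; split; first exact: measurableT_comp.
    by move=> f tf; have := sfN (lw f tf); under eq_fun do rewrite -mulNr.
  move=> f tf; under eq_fun do rewrite mulNr.
  by rewrite JN ?hw ?oppr0//; apply: lw.2.
move: h1 h2; apply: ae_impl2 => x h1 h2; apply/eqP; rewrite eq_le h1/= -oppr_le0//.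
Qed.

End FundamentalLemma.

(** * A dual bound for the integral of a fourth power *)

Section LowerSemicontinuity.
Variable R : realType.
Local Notation PT := (R * R)%type.
Local Notation P := (measurableTypeR R * measurableTypeR R)%type.
Local Notation mu := (@leb2 R).
Local Notation sf := (summable_fun mu).
Local Notation J := (Rintegral mu setT).
Implicit Types (f h w : PT -> R) (x : PT).

Let cube_lip (f h : R) : 0 <= f <= 1 -> 0 <= h <= 1 -> `|f ^+ 3 - h ^+ 3| <= 3 * `|f - h|.
Proof.
move=> /andP[f0 f1] /andP[h0 h1].
rewrite (_ : _ - _ = (f ^+ 2 + f * h + h ^+ 2) * (f - h)); last by ring.
by rewrite normrM ler_wpM2r// ger0_norm ?addr_ge0 ?mulr_ge0 ?exprn_ge0//; nra.
Qed.

Let fourth_lip (f h : R) : 0 <= f <= 1 -> 0 <= h <= 1 -> `|f ^+ 4 - h ^+ 4| <= 4 * `|f - h|.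
Proof.
move=> /andP[f0 f1] /andP[h0 h1].
rewrite (_ : _ - _ = ((f ^+ 2 + h ^+ 2) * (f + h)) * (f - h)); last by ring.
have ? : f ^+ 2 <= 1 by rewrite expr_le1.
have ? : h ^+ 2 <= 1 by rewrite expr_le1.
rewrite normrM ler_wpM2r// ger0_norm ?mulr_ge0 ?addr_ge0 ?exprn_ge0//.
apply: (@le_trans _ _ (2 * 2)); last by lra.
by apply: ler_pM; rewrite ?addr_ge0 ?exprn_ge0//; lra.
Qed.

(** Here [N * h] stands for a truncated positive part of [w], [f] for a test function close to [h],
    and [c] for a cutoff. Since $cNh \le w$ where $h > 0$, the tangent expression at $cNh$ is at
    least $(cNh)^4$. The coefficients 12 arise as 4 times 3 and 3 times 4 from the Lipschitz bounds
    for cubes and fourth powers on [0, 1]. *)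
Let pointwise (c f h N w : R) : 0 <= c <= 1 -> 0 <= f <= 1 -> 0 <= h <= 1 -> 0 < N ->
  N * h <= Num.max w 0 ->
  (c * (N * h)) ^+ 4 - (12 * N ^+ 3 + 12 * N ^+ 4) * (`|f - h| * ((`|w| + 1) * c)) <=
  4 * (c * (N * f)) ^+ 3 * w - 3 * (c * (N * f)) ^+ 4.
Proof.
move=> c01 f01 h01 N0 hw.
have /andP[c0 c1] := c01; have /andP[f0 f1] := f01; have /andP[h0 h1] := h01.
have a3 := cube_lip f01 h01; have a4 := fourth_lip f01 h01.
have n0 := normr_ge0 (f - h); have w0 := normr_ge0 w.
have e3 : 4 * (c * (N * f)) ^+ 3 * w >= 4 * (c * (N * h)) ^+ 3 * w - 12 * N ^+ 3 * (`|f - h| * (`|w| * c)).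
  rewrite lerBlDr -lerBlDl.
  rewrite (_ : _ - _ = - (4 * (c * N) ^+ 3 * (f ^+ 3 - h ^+ 3) * w)); last by ring.
  rewrite (le_trans (ler_norm _))// normrN 3!normrM.
  rewrite [`|(_ * _) ^+ _|]ger0_norm ?normr_nat; last by rewrite exprn_ge0// mulr_ge0// ltW.
  rewrite (_ : 12 * _ * _ = 4 * (N ^+ 3 * c) * (3 * `|f - h|) * `|w|); last by ring.
  rewrite ler_wpM2r//; apply: ler_pM => //; first by rewrite mulr_ge0// exprn_ge0// mulr_ge0// ltW.
  rewrite ler_wpM2l// exprMn mulrC ler_wpM2l//; first by rewrite exprn_ge0// ltW.
  by rewrite exprS ler_piMr// expr_le1.
have e4 : 3 * (c * (N * f)) ^+ 4 <= 3 * (c * (N * h)) ^+ 4 + 12 * N ^+ 4 * (`|f - h| * c).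
  rewrite -lerBlDl (_ : _ - _ = 3 * (c * N) ^+ 4 * (f ^+ 4 - h ^+ 4)); last by ring.
  rewrite (le_trans (ler_norm _))// 2!normrM.
  rewrite [`|(_ * _) ^+ _|]ger0_norm ?normr_nat; last by rewrite exprn_ge0// mulr_ge0// ltW.
  rewrite (_ : 12 * _ * _ = 3 * (N ^+ 4 * c) * (4 * `|f - h|)); last by ring.
  apply: ler_pM => //; first by rewrite mulr_ge0// exprn_ge0// mulr_ge0// ltW.
  rewrite ler_wpM2l// exprMn mulrC ler_wpM2l//; first by rewrite exprn_ge0// ltW.
  by rewrite exprS ler_piMr// expr_le1.
have e5 : (c * (N * h)) ^+ 4 <= (c * (N * h)) ^+ 3 * w.
  have [->|hn0] := eqVneq h 0; first by rewrite !mulr0 !expr0n !mul0r.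
  have Nh0 : 0 < N * h by rewrite mulr_gt0// lt_neqAle eq_sym hn0.
  have {}hw : N * h <= w by move: hw; rewrite le_max => /orP[//|]; rewrite leNgt Nh0.
  rewrite [_ ^+ 4]exprSr ler_wpM2l//; first by rewrite exprn_ge0// mulr_ge0// ltW.
  by rewrite (le_trans _ hw)// ler_piMl// ltW.
have e6 : (12 * N ^+ 3 + 12 * N ^+ 4) * (`|f - h| * ((`|w| + 1) * c)) >=
   12 * N ^+ 3 * (`|f - h| * (`|w| * c)) + 12 * N ^+ 4 * (`|f - h| * c).
  rewrite -subr_ge0 (_ : _ - _ = 12 * N ^+ 3 * (`|f - h| * c) + 12 * N ^+ 4 * (`|f - h| * (`|w| * c))); last by ring.
  by rewrite addr_ge0// !mulr_ge0// ?exprn_ge0// ltW.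
lra.
Qed.

Section Bound.
Variables (w : PT -> R) (C : R).
Hypothesis lw : locsum w.
Hypothesis HC : forall h, test_function h -> J (fun x => 4 * h x ^+ 3 * w x - 3 * h x ^+ 4) <= C.

Let test_pow n f : test_function f -> test_function (fun x => f x ^+ n.+1).
Proof.
by move=> tf; elim: n => // n IH; under eq_fun do rewrite exprS; exact: test_mul.
Qed.

Let sf_tangent h : test_function h -> sf (fun x => 4 * h x ^+ 3 * w x - 3 * h x ^+ 4).
Proof.
move=> th; apply: sfB; last by apply: sfZ; apply: test_sf; exact: test_pow.
have := sfZ 4 (lw.2 _ (test_pow 2 th)).
by congr (summable_fun mu _); apply/funext => x; ring.
Qed.

Let level_bound n h (N : R) : measurable_fun [set: P] h -> (forall x, 0 <= h x <= 1) -> 0 < N ->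
  (forall x, N * h x <= Num.max (w x) 0) ->
  sf (fun x => (cutoff n x * (N * h x)) ^+ 4) /\ J (fun x => (cutoff n x * (N * h x)) ^+ 4) <= C.
Proof.
move=> mh h01 N0 hw; have tc := test_cutoff R n.
have c01 := @cutoff01 R n.
pose g x := (`|w x| + 1) * cutoff n x.
have g0 x : 0 <= g x by rewrite mulr_ge0 ?addr_ge0//; case/andP: (c01 x).
have hg : sf g.
  have -> : g = (fun x => `|w x * cutoff n x| + cutoff n x).
    by apply/funext => x; rewrite /g normrM (ger0_norm (_ : 0 <= cutoff n x)) ?mulrDl ?mul1r//; case/andP: (c01 x).
  by apply: sfD; [apply: sf_norm; exact: lw.2|exact: test_sf].
have sh : sf (fun x => (cutoff n x * (N * h x)) ^+ 4).
  apply: (@sf_le _ P R mu _ (fun x => N ^+ 4 * cutoff n x)).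
  - have mc := test_measurable tc.
    by apply: measurable_funX; apply: measurable_funM => //; exact: measurable_funM.
  - move=> x; case/andP: (c01 x) => ? ?; case/andP: (h01 x) => ? ?.
    have Nh0 : 0 <= N * h x by rewrite mulr_ge0// ltW.
    rewrite ger0_norm; last by rewrite exprn_ge0// mulr_ge0.
    rewrite exprMn mulrC; apply: ler_pM; [by rewrite exprn_ge0|by rewrite exprn_ge0| |].
    + by rewrite exprMn ler_piMr ?expr_le1// exprn_ge0// ltW.
    + by rewrite exprS ler_piMr// expr_le1.
  - by apply: sfZ; exact: test_sf.
split => //.
pose K := 12 * N ^+ 3 + 12 * N ^+ 4.
have K0 : 0 < K by rewrite addr_gt0// mulr_gt0// exprn_gt0.
apply/ler_addgt0Pr => e e0.
have [_ _ /(_ (e / K) (divr_gt0 e0 K0))[f [tf f01 hf]]] := approximable_measurable g0 hg mh h01.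
have tk : test_function (fun x => cutoff n x * (N * f x)).
  by apply: test_mul => //; exact: test_scale.
have sfh : sf (fun x => `|f x - h x| * g x) by apply: sf_approx => //; exact: test_measurable.
have : J (fun x => (cutoff n x * (N * h x)) ^+ 4 - K * (`|f x - h x| * g x)) <= C.
  apply: le_trans (HC tk); apply: leJ; [|exact: sf_tangent|].
    by apply: sfB => //; exact: sfZ.
  by move=> x; exact: pointwise.
rewrite JB ?JZ//; last exact: sfZ.
rewrite lerBlDr => /le_trans; apply; rewrite lerD2l mulrC -ler_pdivlMr//.
Qed.

(** The supremum over [h] of the tangents $4h^3w - 3h^4$ is $w^4$. Only bounded and compactly
    supported truncations of the optimal [h] are within reach of test functions, so the bound is
    proved for those and passed to the limit by Fatou's lemma. *)
Lemma fourth_pos_bound : sf (fun x => Num.max (w x) 0 ^+ 4) /\ J (fun x => Num.max (w x) 0 ^+ 4) <= C.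
Proof.
have mw := lw.1.
pose F n x := (cutoff n x * Num.min (Num.max (w x) 0) n.+1%:R) ^+ 4.
have m0 x n : 0 <= Num.min (Num.max (w x) 0) n.+1%:R by rewrite le_min ler0n le_max lexx orbT.
have hF n : sf (F n) /\ J (F n) <= C.
  pose h x := Num.min (Num.max (w x) 0) n.+1%:R / n.+1%:R.
  have E x : n.+1%:R * h x = Num.min (Num.max (w x) 0) n.+1%:R by rewrite /h mulrC divfK.
  have := @level_bound n h n.+1%:R.
  have -> : (fun x => (cutoff n x * (n.+1%:R * h x)) ^+ 4) = F n by apply/funext => x; rewrite /F E.
  apply => //.
  - apply: measurable_funM => //; apply: measurable_minr => //; exact: measurable_maxr.
  - by move=> x; rewrite divr_ge0//= ler_pdivrMr// mul1r ge_min lexx orbT.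
  - by move=> x; rewrite E ge_min lexx.
have F0 n x : 0 <= F n x.
  by rewrite exprn_ge0// mulr_ge0//; case/andP: (cutoff01 n x).
have cF x : F n x @[n --> \oo] --> (Num.max (w x) 0) ^+ 4.
  suff c1 : cutoff n x * Num.min (Num.max (w x) 0) n.+1%:R @[n --> \oo] --> 1 * Num.max (w x) 0.
    rewrite -[Num.max (w x) 0]mul1r.
    exact: (cvg_comp _ (fun t : R => t ^+ 4) c1 (@exprn_continuous R 4 _)).
  apply: cvgM; first exact: cutoff_cvg.
  apply: cvg_near_cst; near=> n.
  apply/min_idPl; near: n.
  exists (Num.Def.archi_bound (Num.max (w x) 0)) => // n /= hn.
  rewrite (le_trans (ltW (archi_boundP _)))//; first by rewrite le_max lexx orbT.
  by rewrite ler_nat leqW.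
exact: (@fatou_J _ P R mu F _ C (fun n => (hF n).1) F0 (fun n => (hF n).2) cF).
Unshelve. all: end_near. Qed.

End Bound.

Lemma lsc_fourth w C : locsum w ->
  (forall h, test_function h -> J (fun x => 4 * h x ^+ 3 * w x - 3 * h x ^+ 4) <= C) ->
  sf (fun x => w x ^+ 4).
Proof.
move=> lw hC; have [s1 _] := fourth_pos_bound lw hC.
have lw' : locsum (fun x => - w x).
  case: lw => mw lw; split; first exact: measurableT_comp.
  by move=> f tf; have := sfN (lw f tf); under eq_fun do rewrite -mulNr.
have [|s2 _] := @fourth_pos_bound (fun x => - w x) C lw'.
  (* Changing the sign of [h] amounts to changing the sign of [w]. *)
  move=> h th; have := hC _ (test_opp th); congr (_ <= C).
  by congr Rintegral; apply/funext => x; ring.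
have := sfD s1 s2; congr (summable_fun mu _); apply/funext => x.
have [w0|w0] := leP 0 (w x).
  by rewrite (max_idPr _) ?oppr_le0// expr0n addr0.
by rewrite (max_idPl _) ?oppr_ge0 ?ltW// expr0n add0r; ring.
Qed.

End LowerSemicontinuity.

(** * Square-integrable functions and mollification *)

Section SquareIntegrable.
Variable R : realType.
Local Notation PT := (R * R)%type.
Local Notation P := (measurableTypeR R * measurableTypeR R)%type.
Local Notation mu := (@leb2 R).
Local Notation sf := (summable_fun mu).
Local Notation J := (Rintegral mu setT).
Implicit Types (f h w : PT -> R) (x y e : PT).

Definition l2 w := measurable_fun [set: P] w /\ sf (fun x => w x ^+ 2).

Lemma norm_mul_le (a b : R) : `|a * b| <= a ^+ 2 + b ^+ 2.
Proof. by rewrite ler_norml; apply/andP; split; nra. Qed.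

Lemma l2_mul f h : l2 f -> l2 h -> sf (fun x => f x * h x).
Proof.
move=> [mf sff] [mh sh]; apply: (@sf_le _ P R mu _ (fun x => f x ^+ 2 + h x ^+ 2)).
- exact: measurable_funM.
- by move=> x; exact: norm_mul_le.
- exact: sfD.
Qed.

Lemma test_l2 f : test_function f -> l2 f.
Proof.
move=> tf; split; first exact: test_measurable.
exact: (test_sf (test_mul tf tf)).
Qed.

Lemma l2_locsum w : l2 w -> locsum w.
Proof. by move=> lw; split; [case: lw|move=> f tf; apply: l2_mul => //; exact: test_l2]. Qed.

Lemma l2_add f h : l2 f -> l2 h -> l2 (fun x => f x + h x).
Proof.
move=> lf lh; have [mf sff] := lf; have [mh sh] := lh; split; first exact: measurable_funD.
have := sfD (sfD sff sh) (sfZ 2 (l2_mul lf lh)).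
by congr (summable_fun mu _); apply/funext => x; ring.
Qed.

Lemma l2_scale (c : R) f : l2 f -> l2 (fun x => c * f x).
Proof.
move=> [mf sff]; split; first exact: measurable_funM.
by have := sfZ (c ^+ 2) sff; congr (summable_fun mu _); apply/funext => x; ring.
Qed.

Lemma l2_sub f h : l2 f -> l2 h -> l2 (fun x => f x - h x).
Proof.
move=> lf lh; have := l2_add lf (l2_scale (-1) lh).
by congr l2; apply/funext => x; ring.
Qed.

Lemma sf_mul_box w (M : R) : 0 <= M -> l2 w -> sf (fun x => `|w x| * \1_(box M) x).
Proof.
move=> M0 [mw sw]; have mb : measurable_fun [set: P] (\1_(box M) : P -> R).
  by apply: measurable_indic; exact: measurable_box.
apply: (@sf_le _ P R mu _ (fun x => w x ^+ 2 + \1_(box M) x)).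
- by apply: measurable_funM => //; exact: measurableT_comp.
- move=> x; rewrite normrM normr_id indicE; case: (_ \in _); rewrite ?normr0 ?normr1 ?mulr0 ?mulr1 ?addr0 ?sqr_ge0//.
  by rewrite /= mulr1n; have := normr_ge0 (w x); rewrite -(real_normK (num_real (w x))); nra.
- by apply: sfD => //; exact: sf_box.
Qed.

Lemma amgm (t a b : R) : 0 < t -> `|a * b| <= 2^-1 * (t^-1 * a ^+ 2 + t * b ^+ 2).
Proof.
move=> t0; rewrite -subr_ge0.
have -> : 2^-1 * (t^-1 * a ^+ 2 + t * b ^+ 2) - `|a * b| = (2 * t)^-1 * (`|a| - t * `|b|) ^+ 2.
  rewrite normrM -(real_normK (num_real a)) -(real_normK (num_real b)).
  by field; rewrite gt_eqF.
by rewrite mulr_ge0 ?sqr_ge0// invr_ge0 mulr_ge0// ltW.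
Qed.

Definition trans f y : PT -> R := fun x => f (x - y).

Lemma transE f y : trans f y = fun x => f (- y + (1 : R) *: x).
Proof. by apply/funext => x; rewrite /trans scale1r addrC. Qed.

Lemma test_trans f y : test_function f -> test_function (trans f y).
Proof. by move=> tf; rewrite transE; apply: test_affine. Qed.

Lemma derive_trans f y e : axis e -> test_function f -> 'D_e (trans f y) = trans ('D_e f) y.
Proof.
move=> he tf; rewrite 2!transE; apply/funext => x.
have := @derive_affine R f (- y) 1 e x (smooth_derivable he (test_smooth tf)).
by move=> [_ ->]; rewrite mul1r.
Qed.

Lemma sf_trans f y : sf f -> sf (trans f y).
Proof.
move=> hf; have := sf_translate (- y.1, - y.2) hf.
by congr (summable_fun mu _).
Qed.

Lemma J_trans f y : sf f -> J (trans f y) = J f.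
Proof. by move=> hf; rewrite -[RHS](J_translate (- y.1, - y.2) hf). Qed.

(** The mollification of [w], a convolution with the reflected kernel. The variable [y] enters
    through the test function alone, so derivatives fall on [rho]. *)
Definition cor w rho y := J (fun x => w x * trans rho y x).

Lemma sf_cor w rho y : l2 w -> test_function rho -> sf (fun x => w x * trans rho y x).
Proof. by move=> lw tr; apply: l2_mul => //; apply: test_l2; exact: test_trans. Qed.

Lemma cor_bound w rho y : l2 w -> test_function rho ->
  `|cor w rho y| <= J (fun x => w x ^+ 2) + J (fun x => rho x ^+ 2).
Proof.
move=> lw tr; have [_ sr] := test_l2 tr; have [_ sw] := lw.
rewrite -(J_trans y sr) -JD//; last exact: sf_trans.
apply: normJ_le; [exact: sf_cor|by apply: sfD => //; exact: sf_trans|].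
by move=> x; exact: norm_mul_le.
Qed.

(** Differentiation under the integral sign; the minus sign appears because [trans] subtracts
    [y]. *)
Lemma cor_derive w rho y e : axis e -> l2 w -> test_function rho ->
  is_derive y e (cor w rho) (- cor w ('D_e rho) y).
Proof.
move=> he lw tr; rewrite -[y]add0r -[0](scale0r e); apply/is_derive_line.
have tD := test_derive he tr.
have [M M0 DM] := test_supported tD; have [C C0 DC] := test_bounded tD.
pose f (t : R) x := w x * trans rho (t *: e + y) x.
have ne : `|e| <= 1.
  by apply/box_norm; case: he => ->; rewrite /box/= normr0 normr1.
have df x t : is_derive t (1 : R) (f ^~ x) (- (w x * trans ('D_e rho) (t *: e + y) x)).
  rewrite -mulrN; apply: is_deriveZ.
  rewrite /trans.
  rewrite (_ : (fun t => rho _) = (fun t : R => rho ((x - y) + (-1) *: (t *: e + 0)))); last first.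
    by apply/funext => s; rewrite addr0 scaleN1r opprD addrA addrAC.
  rewrite (_ : x - (t *: e + y) = (x - y) + (-1) *: (t *: e + 0)); last first.
    by rewrite addr0 scaleN1r opprD addrA addrAC.
  have := @derive_affine R rho (x - y) (-1) e (t *: e + 0) (smooth_derivable he (test_smooth tr)).
  by rewrite mulN1r => /is_derive_line.
have E : 'D_1 (cor w rho \o (fun t : R => t *: e + y)) 0 = 0 -> True by [].
have I0 : (0 : R) \in `]-1, 1[ by rewrite in_itv/=; apply/andP; split; lra.
(* While the parameter stays in []-1, 1[], all translates of ['D_e rho] are supported in one box,
   because $|e| \le 1$. *)
have := @cvg_differentiation_under_integral R _ P mu f setT measurableT 0 (-1) 1 I0 _ _
  (fun x => C * (`|w x| * \1_(box (M + 1 + `|y|)) x)) _ _ _.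
have part t x : partial1of2 f t x = - (w x * trans ('D_e rho) (t *: e + y) x).
  by rewrite partial1of2E; case: (df x t).
have -> : (fun h : R => h^-1 *: (J (f (h + 0)) - J (f 0))) =
   (fun h : R => h^-1 *: (((fun t : R => cor w rho (t *: e + y)) \o shift 0) (h *: (1 : R)) - cor w rho ((0 : R) *: e + y))).
  by apply/funext => h /=; rewrite [h *: (1 : R)]mulr1.
have -> : (\int[mu]_(x in setT) (partial1of2 f 0 x))%R = - cor w ('D_e rho) (0 *: e + y).
  rewrite -JN; last exact: sf_cor.
  by congr Rintegral; apply/funext => x; rewrite part.
move=> H; suff cv : h^-1 *: (((fun t : R => cor w rho (t *: e + y)) \o shift 0) (h *: (1 : R)) - cor w rho ((0 : R) *: e + y)) @[h --> 0^'] --> (- cor w ('D_e rho) (0 *: e + y)).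
  by split; [apply/cvg_ex; eexists; exact: cv|exact/cvg_lim].
apply: H.
- by move=> t _; exact: sf_cor.
- by move=> t x _ _; case: (df x t).
- by move=> x; rewrite !mulr_ge0// ?indicE// ltW.
- by apply: sfZ; apply: sf_mul_box => //; rewrite !addr_ge0// ltW.
- move=> t x; rewrite /= in_itv/= => /andP[t1 t2] _.
  rewrite part normrN normrM mulrCA ler_wpM2l//.
  have [bx|nbx] := pselect (box (M + 1 + `|y|) x).
    by rewrite indicE mem_set// mulr1; exact: DC.
  rewrite indicE memNset// mulr0 /trans DM ?normr0//.
  apply: contra_not nbx => /box_norm h; apply/box_norm.
  rewrite (_ : x = (x - (t *: e + y)) + (t *: e + y)); last by rewrite subrK.
  rewrite (le_trans (ler_normD _ _))// -addrA lerD//.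
  rewrite (le_trans (ler_normD _ _))// lerD2r normrZ -[leRHS]mulr1.
  by apply: ler_pM => //; rewrite ler_norml; apply/andP; split; lra.
Qed.

Lemma lipschitz_plane f (K : R) : (forall e, axis e -> forall x, derivable f x e) ->
  (forall e, axis e -> forall x, `|'D_e f x| <= K) ->
  forall x y, `|f x - f y| <= K * (`|x.1 - y.1| + `|x.2 - y.2|).
Proof.
move=> df dK x y.
have lip1 e z (s t : R) : axis e -> `|f (s *: e + z) - f (t *: e + z)| <= K * `|s - t|.
  move=> he.
  have D r : is_derive r (1 : R) (fun s : R => f (s *: e + z)) ('D_e f (r *: e + z)).
    exact/derive_line/df.
  have c : continuous (fun s : R => f (s *: e + z)).
    by move=> r; apply: differentiable_continuous; apply/derivable1_diffP; case: (D r).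
  wlog st : s t / t <= s.
    move=> H; have [|/ltW] := leP t s; first exact: H.
    by move=> /H; rewrite distrC [`|s - t|]distrC.
  have [r _ ->] := MVT_segment st (fun r _ => D r) (continuous_subspaceT c).
  by rewrite normrM; apply: ler_wpM2r => //; exact: dK.
rewrite mulrDr.
have E1 a b : (a, b) = a *: e1 R + (0, b) by rewrite /e1; congr pair; rewrite /= ?[_ *: _]mulr1 ?[_ *: _]mulr0 ?addr0 ?add0r.
have E2 a b : (a, b) = b *: e2 R + (a, 0) by rewrite /e2; congr pair; rewrite /= ?[_ *: _]mulr1 ?[_ *: _]mulr0 ?addr0 ?add0r.
apply: (@le_trans _ _ (`|f (x.1, x.2) - f (y.1, x.2)| + `|f (y.1, x.2) - f (y.1, y.2)|)).
  by case: x y => [x1 x2] [y1 y2] /=; exact: ler_distD.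
apply: lerD.
  by rewrite (E1 x.1) (E1 y.1); apply: lip1; left.
by rewrite (E2 y.1 x.2) (E2 y.1 y.2); apply: lip1; right.
Qed.

Lemma lipschitz_continuous f (K : R) : 0 <= K ->
  (forall x y, `|f x - f y| <= K * (`|x.1 - y.1| + `|x.2 - y.2|)) -> continuous f.
Proof.
move=> K0 L x.
have K1 (a : R) : (K + 1) * (a / (2 * (K + 1)) + a / (2 * (K + 1))) = a.
  by field; rewrite gt_eqF// ltr_wpDl.
apply/cvgrPdist_le => e e0.
near=> y.
apply: (le_trans (L x y)).
have h : `|x - y| <= e / (2 * (K + 1)).
  by near: y; apply: cvgr_dist_le; [exact: cvg_id|rewrite divr_gt0// mulr_gt0// ltr_wpDl].
have [h1 h2] : `|x.1 - y.1| <= e / (2 * (K + 1)) /\ `|x.2 - y.2| <= e / (2 * (K + 1)).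
  by move: h => /box_norm[].
apply: (@le_trans _ _ ((K + 1) * (e / (2 * (K + 1)) + e / (2 * (K + 1))))).
  by apply: ler_pM; rewrite ?addr_ge0//; lra.
by rewrite K1.
Unshelve. all: end_near. Qed.

(** The partial derivatives are again correlations with test functions, bounded uniformly in [y] by
    [cor_bound]; hence [cor w rho] is Lipschitz. *)
Lemma cor_continuous w rho : l2 w -> test_function rho -> continuous (cor w rho).
Proof.
move=> lw tr.
pose Kf e := J (fun x => ('D_e rho x) ^+ 2).
have Kf0 e : 0 <= Kf e by apply: J_ge0 => x; exact: sqr_ge0.
have Jw0 : 0 <= J (fun x => w x ^+ 2) by apply: J_ge0 => x; exact: sqr_ge0.
pose K := J (fun x => w x ^+ 2) + (Kf (e1 R) + Kf (e2 R)).
have K0 : 0 <= K by rewrite !addr_ge0.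
apply: (lipschitz_continuous K0); apply: lipschitz_plane => e he x.
  by case: (cor_derive x he lw tr).
have [_ ->] := cor_derive x he lw tr; rewrite normrN.
apply: (le_trans (cor_bound x lw (test_derive he tr))); rewrite lerD2l -/(Kf e).
case: he => ->.
- by apply: ler_wpDr; [exact: (Kf0 (e2 R))|exact: lexx].
- by apply: ler_wpDl; [exact: (Kf0 (e1 R))|exact: lexx].
Qed.

(** Far away the translated kernel only meets the tail of [w], whose square has a small integral. *)
Lemma cor_vanish w rho : l2 w -> test_function rho -> forall d : R, 0 < d ->
  exists2 M, 0 < M & forall y, ~ box M y -> `|cor w rho y| <= d.
Proof.
move=> lw tr d d0; have [mw sw] := lw; have [_ sr] := test_l2 tr.
have [L L0 rL] := test_supported tr.
have Jr0 : 0 <= J (fun x => rho x ^+ 2) by apply: J_ge0 => z; exact: sqr_ge0.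
(* This weight in Young's inequality gives $t\int\rho^2 \le d$. The tail is later made at most $dt$,
   which leaves half the sum of two terms bounded by [d]. *)
pose t := d / (J (fun x => rho x ^+ 2) + 1).
have t0 : 0 < t by rewrite divr_gt0// ltr_wpDl.
have mb M : measurable_fun [set: P] (\1_(~` box M) : P -> R).
  by apply: measurable_indic; apply: measurableC; exact: measurable_box.
pose F (n : nat) x := w x ^+ 2 * \1_(~` box n%:R) x.
have mF n : measurable_fun [set: P] (F n) by apply: measurable_funM => //; exact: measurable_funX.
have Fw n x : `|F n x| <= w x ^+ 2.
  rewrite normrM ger0_norm ?sqr_ge0// ler_piMr ?sqr_ge0// indicE.
  by case: (_ \in _); rewrite ?normr1 ?normr0.
have sF n : sf (F n) by apply: (@sf_le _ P R mu _ (fun x => w x ^+ 2)).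
have [_ cF] : sf (fun=> 0) /\ J (F n) @[n --> \oo] --> J (fun _ : P => 0 : R).
  apply: (@dominated_J _ P R mu F (fun=> 0) (fun x => w x ^+ 2)) => // x.
  apply: cvg_near_cst; near=> n.
  rewrite /F indicE memNset ?mulr0//; apply; apply/box_norm.
  near: n; exists (Num.Def.archi_bound `|x|) => // n /= hn.
  by rewrite (le_trans (ltW (archi_boundP _)))// ler_nat.
have [n hn] : exists n, J (F n) <= d * t.
  have dt0 : 0 < d * t by rewrite mulr_gt0.
  move: cF; rewrite J0 => /cvgrPdist_le/(_ _ dt0)[N _ /(_ N (leqnn _))].
  by rewrite sub0r normrN => h; exists N; exact: le_trans (ler_norm _) h.
exists (n%:R + L); first by rewrite ltr_wpDl.
move=> y ny.
have sT : sf (fun x => 2^-1 * (t^-1 * F n x + t * trans rho y x ^+ 2)).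
  by apply: sfZ; apply: sfD; apply: sfZ => //; exact: (sf_trans y sr).
apply: (@le_trans _ _ (J (fun x => 2^-1 * (t^-1 * F n x + t * trans rho y x ^+ 2)))).
  apply: normJ_le => //; first exact: sf_cor.
  move=> x; have [bx|nbx] := pselect (box n%:R x).
    have -> : trans rho y x = 0.
      apply: rL; apply: contra_not ny => /box_norm h; apply/box_norm.
      rewrite (_ : y = x - (x - y)); last by rewrite opprB addrC subrK.
      by rewrite (le_trans (ler_normB _ _))// lerD//; exact/box_norm.
    rewrite mulr0 normr0 expr0n mulr0 addr0; apply: mulr_ge0 => //; apply: mulr_ge0.
      by rewrite invr_ge0 ltW.
    by apply: mulr_ge0; rewrite ?sqr_ge0// indicE.
  rewrite /F indicE mem_set// mulr1.
  exact: amgm.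
have sT' := sfZ t^-1 (sF n); have sT'' := sfZ t (sf_trans y sr).
rewrite JZ ?JD ?JZ//; last 2 first.
- exact: (sf_trans y sr).
- exact: sfD.
have -> : J (fun x => trans rho y x ^+ 2) = J (fun x => rho x ^+ 2) := J_trans y sr.
have h1 : t^-1 * J (F n) <= d by rewrite mulrC ler_pdivrMr.
have h2 : t * J (fun x => rho x ^+ 2) <= d.
  rewrite /t -mulrA; apply: ler_piMr; first exact: ltW.
  by rewrite mulrC ler_pdivrMr ?mul1r ?lerDl// ltr_wpDl.
lra.
Unshelve. all: end_near. Qed.

End SquareIntegrable.

(** * Mollifiers: Jensen's inequality, weak convergence, existence *)

Section Mollification.
Variable R : realType.
Local Notation PT := (R * R)%type.
Local Notation P := (measurableTypeR R * measurableTypeR R)%type.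
Local Notation mu := (@leb2 R).
Local Notation sf := (summable_fun mu).
Local Notation J := (Rintegral mu setT).
Implicit Types (f h w rho : PT -> R) (x y e : PT).

Lemma measurable_sub2 f : measurable_fun [set: P] f ->
  measurable_fun [set: P * P] (fun p => f (p.1.1 - p.2.1, p.1.2 - p.2.2)).
Proof.
move=> mf; apply: (measurableT_comp mf).
have m1 (a : P * P -> P) (b : P -> R) : measurable_fun setT a -> measurable_fun setT b ->
    measurable_fun setT (fun p => b (a p)).
  by move=> ma mb; exact: (measurableT_comp mb ma).
apply: measurable_fun_pair; apply: measurable_funB; apply: m1.
- exact: measurable_fst.
- exact: measurable_fst_plane.
- exact: measurable_snd.
- exact: measurable_fst_plane.
- exact: measurable_fst.
- exact: measurable_snd_plane.
- exact: measurable_snd.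
- exact: measurable_snd_plane.
Qed.

Lemma tonelli_plane (F : P * P -> \bar R) : measurable_fun setT F -> (forall p, 0 <= F p)%E ->
  (\int[mu]_x \int[mu]_y F (x, y) = \int[mu]_y \int[mu]_x F (x, y))%E.
Proof. by move=> mF F0; exact: (@fubini_tonelli _ _ _ _ _ (leb2_sigma R) (leb2_sigma R) F mF F0). Qed.

Lemma sf_test_mul w rho : sf w -> test_function rho -> sf (fun x => w x * rho x).
Proof.
move=> sw tr; have [C C0 hC] := test_bounded tr.
apply: (@sf_le _ P R mu _ (fun x => C * `|w x|)).
- by apply: measurable_funM; [exact: sf_meas sw|exact: test_measurable].
- by move=> x; rewrite normrM mulrC ler_wpM2r.
- exact/sfZ/sf_norm.
Qed.

Section Kernel.
Variables (rho : PT -> R).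
Hypotheses (tr : test_function rho) (r0 : forall x, 0 <= rho x) (r1 : J rho = 1).

(** The variance of [w] under the probability density [trans rho y] is non-negative. *)
Lemma cor_jensen w y : l2 w -> (cor w rho y) ^+ 2 <= J (fun x => w x ^+ 2 * trans rho y x).
Proof.
move=> lw; have [mw sw] := lw.
set c := cor w rho y.
have tt := test_trans y tr.
have s1 := sf_test_mul sw tt; have s2 := sf_cor y lw tr; have s3 := test_sf tt.
have H : 0 <= J (fun x => (w x ^+ 2 * trans rho y x + (- (2 * c)) * (w x * trans rho y x)) + c ^+ 2 * trans rho y x).
  apply: J_ge0 => x.
  rewrite (_ : _ + _ = (w x - c) ^+ 2 * trans rho y x); last by ring.
  by rewrite mulr_ge0 ?sqr_ge0//; exact: r0.
move: H; rewrite JD ?JD ?JZ//; last 3 first.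
- exact: sfZ.
- by apply: sfD => //; exact: sfZ.
- exact: sfZ.
rewrite (J_trans y (test_sf tr)) r1 -/(cor w rho y) -/c => H.
rewrite -subr_ge0; apply: le_trans H _; rewrite le_eqVlt; apply/orP; left; apply/eqP; ring.
Qed.

(** Jensen's inequality, then Tonelli: the kernel also has mass 1 in the variable [y], by
    reflection. *)
Lemma cor_l2 w : l2 w -> l2 (cor w rho) /\ J (fun y => cor w rho y ^+ 2) <= J (fun x => w x ^+ 2).
Proof.
move=> lw; have [mw sw] := lw.
have mc : measurable_fun [set: P] (cor w rho).
  by apply: continuous_measurable_plane; exact: cor_continuous.
have mc2 : measurable_fun [set: P] (fun y => cor w rho y ^+ 2) by exact: measurable_funX.
have m1 : measurable_fun [set: P * P] (fun p => w p.1 ^+ 2 * rho (p.1.1 - p.2.1, p.1.2 - p.2.2)).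
  apply: measurable_funM; last by apply: measurable_sub2; exact: test_measurable.
  by apply: measurable_funX; apply: (measurableT_comp mw); exact: measurable_fst.
have [] : sf (fun y => cor w rho y ^+ 2) /\ J (fun y => cor w rho y ^+ 2) <= J (fun x => w x ^+ 2).
  apply: ge0_sf_le => //; first by move=> x; exact: sqr_ge0.
  apply: (@le_trans _ _ (\int[mu]_y \int[mu]_x (w x ^+ 2 * rho (x.1 - y.1, x.2 - y.2))%:E)%E).
    apply: ge0_le_integral => //.
    - by move=> y _; rewrite lee_fin sqr_ge0.
    - exact/measurable_EFinP.
    - have := @measurable_fun_fubini_tonelli_G _ _ _ _ _ (leb2_sigma R) (fun p : P * P => (w p.1 ^+ 2 * rho (p.1.1 - p.2.1, p.1.2 - p.2.2))%:E).
      apply; first exact/measurable_EFinP.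
      by move=> p; rewrite lee_fin mulr_ge0 ?sqr_ge0.
    - move=> y _; have := cor_jensen y lw; rewrite -lee_fin EFin_J//.
      by apply: sf_test_mul => //; exact: test_trans.
  rewrite -(tonelli_plane (F := fun p : P * P => (w p.1 ^+ 2 * rho (p.1.1 - p.2.1, p.1.2 - p.2.2))%:E)) /=; last 2 first.
  - exact/measurable_EFinP.
  - by move=> p; rewrite lee_fin mulr_ge0 ?sqr_ge0.
  rewrite EFin_J// le_eqVlt; apply/orP; left; apply/eqP.
  apply: eq_integral => x _.
  have sr := sf_flip x (test_sf tr).
  by rewrite -EFin_J ?JZ ?(J_flip x (test_sf tr)) ?r1 ?mulr1//; exact: sfZ.
by [].
Qed.

End Kernel.

(** Moves the mollification from [w] onto the test function, where it can be estimated uniformly. *)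
Lemma cor_pairing w rho h : l2 w -> test_function rho -> test_function h ->
  J (fun y => cor w rho y * h y) = J (fun x => w x * J (fun y => rho (x - y) * h y)).
Proof.
move=> lw tr th; have [mw sw] := lw.
have sh := test_sf th; have mh := test_measurable th.
have mF : measurable_fun [set: P * P] (fun p => w p.2 * rho (p.2 - p.1) * h p.1).
  apply: measurable_funM; last by apply: (measurableT_comp mh); exact: measurable_fst.
  apply: measurable_funM; first by apply: (measurableT_comp mw); exact: measurable_snd.
  have mswap : measurable_fun [set: P * P] (fun p => (p.2, p.1) : P * P).
    by apply: measurable_fun_pair; [exact: measurable_snd|exact: measurable_fst].
  exact: (measurableT_comp (measurable_sub2 (test_measurable tr)) mswap).
have s1 y : sf (fun x => w x * rho (x - y) * h y).
  have := sfZ (h y) (sf_cor y lw tr); congr (summable_fun mu _).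
  by apply/funext => x; rewrite mulrC.
have s2 x : sf (fun y => rho (x - y) * h y).
  exact: (sf_test_mul (sf_flip x (test_sf tr)) th).
have s3 x : sf (fun y => w x * rho (x - y) * h y).
  by have := sfZ (w x) (s2 x); congr (summable_fun mu _); apply/funext => y; rewrite mulrA.
have s4 : sf (fun y => (J (fun x => w x ^+ 2) + J (fun x => rho x ^+ 2)) * `|h y|).
  by apply: sfZ; exact: sf_norm.
have E := @fubini_plane R (fun p => w p.2 * rho (p.2 - p.1) * h p.1)
  (fun y => (J (fun x => w x ^+ 2) + J (fun x => rho x ^+ 2)) * `|h y|) mF s1 s3 s4.
have H y : J (fun x => `|w x * rho (x - y) * h y|) <= (J (fun x => w x ^+ 2) + J (fun x => rho x ^+ 2)) * `|h y|.
  under eq_fun do rewrite normrM.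
  have [_ sr] := test_l2 tr.
  rewrite (_ : (fun x => _) = (fun x => `|h y| * `|w x * trans rho y x|)); last first.
    by apply/funext => x; rewrite mulrC.
  rewrite JZ; last by apply: sf_norm; exact: sf_cor.
  rewrite mulrC ler_wpM2r// -(J_trans y sr) -JD//; last exact: sf_trans.
  apply: leJ; [by apply: sf_norm; exact: sf_cor|by apply: sfD => //; exact: sf_trans|].
  by move=> x; exact: norm_mul_le.
transitivity (J (fun y => J (fun x => w x * rho (x - y) * h y))).
  congr Rintegral; apply/funext => y; rewrite mulrC -JZ; last exact: sf_cor.
  by congr Rintegral; apply/funext => x; rewrite mulrC.
rewrite (E H); congr Rintegral; apply/funext => x /=; rewrite -JZ//.
by congr Rintegral; apply/funext => y; rewrite mulrA.
Qed.

Lemma test_lipschitz h : test_function h -> exists2 K : R, 0 < K &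
  forall x y, `|h x - h y| <= K * (`|x.1 - y.1| + `|x.2 - y.2|).
Proof.
move=> th.
have [K1 K10 h1] := test_bounded (test_derive (or_introl erefl : axis (e1 R)) th).
have [K2 K20 h2] := test_bounded (test_derive (or_intror erefl : axis (e2 R)) th).
exists (K1 + K2); first exact: addr_gt0.
apply: lipschitz_plane.
  by move=> e he x; apply: smooth_derivable => //; exact: test_smooth.
move=> e [] -> x.
  by apply: (le_trans (h1 x)); rewrite lerDl ltW.
by apply: (le_trans (h2 x)); rewrite lerDr ltW.
Qed.

(** [K] is fixed before the kernel, so the error is linear in the radius [d] for all kernels alike.
    The factor 2 comes from the two coordinates in the Lipschitz estimate, and [d <= 1] keeps every
    contribution in the box of size [M + 1]. *)
Lemma cor_approx w h : l2 w -> test_function h -> exists2 K : R, 0 <= K &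
  forall (d : R) rho, 0 < d <= 1 -> test_function rho -> (forall x, 0 <= rho x) -> J rho = 1 ->
    supported rho d -> `|J (fun y => cor w rho y * h y) - J (fun x => w x * h x)| <= K * d.
Proof.
move=> lw th; have [C C0 hC] := test_lipschitz th; have [M M0 hM] := test_supported th.
have M1 : 0 <= M + 1 by rewrite addr_ge0// ltW.
exists (2 * C * J (fun x => `|w x| * \1_(box (M + 1)) x)).
  by rewrite !mulr_ge0 ?(ltW C0)//; apply: J_ge0 => x; rewrite mulr_ge0// indicE.
move=> d rho /andP[d0 d1] tr r0 r1 rd.
rewrite cor_pairing//.
have s1 x := sf_flip x (test_sf tr).
have s2 x : sf (fun y => rho (x - y) * h y) := sf_test_mul (s1 x) th.
have key x : `|J (fun y => rho (x - y) * h y) - h x| <= 2 * C * d * \1_(box (M + 1)) x.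
  have E : J (fun y => rho (x - y) * h y) - h x = J (fun y => rho (x - y) * h y - h x * rho (x - y)).
    rewrite (JB (s2 x) (sfZ (h x) (s1 x))) (JZ (h x) (s1 x)).
    by rewrite (J_flip x (test_sf tr)) r1 mulr1.
  rewrite E.
  have s3 := sfZ (h x) (s1 x).
  have H : `|J (fun y => rho (x - y) * h y - h x * rho (x - y))| <=
      J (fun y => (2 * C * d * \1_(box (M + 1)) x) * rho (x - y)).
    apply: normJ_le; [exact: (sfB (s2 x) s3)|exact: (sfZ _ (s1 x))|].
    move=> y; rewrite (_ : _ - _ = - (h x - h y) * rho (x - y)); last by ring.
    rewrite normrM normrN (ger0_norm (r0 _)).
    have [bd|nbd] := pselect (box d (x - y)); last by rewrite rd// !mulr0.
    rewrite ler_wpM2r//.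
    have [bx|nbx] := pselect (box (M + 1) x).
      rewrite indicE mem_set// mulr1; apply: (le_trans (hC x y)).
      have [b1 b2] := bd.
      by rewrite -[2 * C]mulrC -mulrA ler_wpM2l ?(ltW C0)// mulr2n mulrDl mul1r lerD.
    rewrite hM; last by apply: contra_not nbx; apply: le_box; rewrite lerDl.
    rewrite hM ?subrr ?normr0 ?mulr_ge0 ?(ltW C0) ?(ltW d0) ?indicE//.
    apply: contra_not nbx => /box_norm yM; apply/box_norm.
    rewrite -[x](subrK y) (le_trans (ler_normD _ _))// addrC lerD//.
    by apply: le_trans d1; exact/box_norm.
  by move: H; rewrite (JZ _ (s1 x)) (J_flip x (test_sf tr)) r1 mulr1.
have mk : measurable_fun [set: P] (fun x => J (fun y => rho (x - y) * h y)).
  have lh := test_l2 th.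
  have -> : (fun x => J (fun y => rho (x - y) * h y)) = cor h (fun x => rho (0 - x)).
    apply/funext => x; congr Rintegral; apply/funext => y.
    by rewrite /trans sub0r opprB mulrC.
  apply: continuous_measurable_plane; apply: cor_continuous => //.
  have := @test_affine R rho 0 (-1) _ tr.
  by under eq_fun do rewrite scaleN1r; apply; rewrite oppr_eq0 oner_eq0.
have sb := sf_mul_box M1 lw.
have s4 : sf (fun x => w x * (J (fun y => rho (x - y) * h y) - h x)).
  apply: (@sf_le _ P R mu _ (fun x => 2 * C * d * (`|w x| * \1_(box (M + 1)) x))).
  - apply: measurable_funM; first by case: lw.
    by apply: measurable_funB => //; exact: test_measurable.
  - by move=> x; rewrite normrM mulrCA ler_wpM2l.
  - exact: sfZ.
have swh := (l2_locsum lw).2 _ th.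
have s5 : sf (fun x => w x * J (fun y => rho (x - y) * h y)).
  have := sfD s4 swh; congr (summable_fun mu _); apply/funext => x; ring.
rewrite -JB//.
rewrite (_ : _ * d = J (fun x => 2 * C * d * (`|w x| * \1_(box (M + 1)) x))); last first.
  by rewrite JZ//; ring.
apply: normJ_le; [exact: sfB|exact: sfZ|].
by move=> x; rewrite -mulrBr normrM mulrCA ler_wpM2l.
Qed.

(** The bound on the height is quadratic in the inverse radius; [green_fourth] needs it to place the
    kernel below a multiple of the source term of the supersolution. *)
Lemma mollifier : exists2 c : R, 0 < c & forall n : nat, exists rho : PT -> R,
  [/\ test_function rho, forall x, 0 <= rho x <= c * n.+1%:R ^+ 2, J rho = 1 & supported rho n.+1%:R^-1].
Proof.
pose phi := rect_bump (-1) 1 (-1) 1 0 : PT -> R.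
have tphi : test_function phi := test_rect_bump _ _ _ _ _.
have p01 x : 0 <= phi x <= 1 := rect_bump01 _ _ _ _ _ _.
have phi_box x : 0 < phi x -> box 1 x.
  rewrite /phi /rect_bump => h; apply/box_norm.
  have [h1|h1] := boolP (-1 < x.1 < 1); last by move: h; rewrite itv_bump_out// mul0r ltxx.
  have [h2|h2] := boolP (-1 < x.2 < 1); last by move: h; rewrite [X in _ * X]itv_bump_out// mulr0 ltxx.
  move/andP: h1 => [? ?]; move/andP: h2 => [? ?].
  by apply/box_norm; split; rewrite ler_norml; apply/andP; split; lra.
have [c0 c00 hc0] : exists2 c0 : R, 0 < c0 & forall x, box 2^-1 x -> c0 <= phi x.
  have hne : (box 2^-1 : set PT) !=set0 by exists 0; rewrite /box/= normr0.
  have [] := compact_EVT_min hne (@box_compact R 2^-1) (f := phi).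
    by apply: continuous_subspaceT; exact/smooth_continuous/test_smooth.
  move=> z; rewrite inE => -[z1 z2] hz.
  exists (phi z); last by move=> x bx; apply: hz; rewrite inE.
  move: z1 z2; rewrite !ler_norml => /andP[a1 a2] /andP[a3 a4].
  by apply: mulr_gt0; apply: itv_bump_gt0; apply/andP; split; lra.
exists c0^-1; first by rewrite invr_gt0.
move=> n; set N : R := n.+1%:R; have N0 : 0 < N by rewrite ltr0n.
pose f x := phi (0 + N *: x).
have tf : test_function f by apply: test_affine => //; rewrite gt_eqF.
have f01 x : 0 <= f x <= 1 by exact: p01.
pose Z := J f.
have Ni : 0 <= (2 * N)^-1 by rewrite invr_ge0 mulr_ge0// ltW.
(* [f] is at least [c0] on a square of area $1/N^2$, because [phi] is at least [c0] on
   [box 2^-1]. *)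
have hZ : c0 / N ^+ 2 <= Z.
  have -> : c0 / N ^+ 2 = J (fun x => c0 * \1_(box (2 * N)^-1) x).
    by rewrite JZ ?J_box//; [field; rewrite gt_eqF|exact: sf_box].
  apply: leJ; [by apply: sfZ; exact: sf_box|exact: test_sf|].
  move=> x; have [bx|nbx] := pselect (box (2 * N)^-1 x).
    rewrite indicE mem_set// mulr1; apply: hc0; apply/box_norm.
    rewrite add0r normrZ gtr0_norm// -ler_pdivlMl//.
    by rewrite -invfM mulrC; exact/box_norm.
  by rewrite indicE memNset// mulr0; case/andP: (f01 x).
have Z0 : 0 < Z by apply: lt_le_trans hZ; rewrite divr_gt0// exprn_gt0.
exists (fun x => Z^-1 * f x); split.
- exact: test_scale.
- move=> x; case/andP: (f01 x) => fx0 fx1; rewrite mulr_ge0 ?invr_ge0 ?(ltW Z0)//=.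
  apply: (@le_trans _ _ (Z^-1 * 1)); first by rewrite ler_wpM2l// invr_ge0 ltW.
  rewrite mulr1 -[leRHS]invrK lef_pV2 ?posrE ?invr_gt0//; last by rewrite mulr_gt0 ?invr_gt0// exprn_gt0.
  by rewrite invfM invrK.
- by rewrite JZ ?mulVf ?gt_eqF//; exact: test_sf.
- move=> x nx; apply/eqP; rewrite mulf_eq0; apply/orP; right; apply/eqP.
  apply: contra_notP nx => /eqP fx; apply/box_norm.
  have /phi_box/box_norm : 0 < phi (0 + N *: x) by rewrite lt_neqAle eq_sym fx; case/andP: (f01 x).
  by rewrite add0r normrZ gtr0_norm// mulrC -ler_pdivlMr// mul1r.
Qed.

Definition wderiv e u g := forall f, test_function f ->
  J (fun x => u x * 'D_e f x) = - J (fun x => g x * f x).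

(** The minus sign of [cor_derive] cancels that of integration by parts, so the mollified weak
    derivative is a classical one. *)
Lemma cor_wderiv e u g rho y : axis e -> l2 u -> test_function rho -> wderiv e u g ->
  is_derive y e (cor u rho) (cor g rho y).
Proof.
move=> he lu tr ug; have := cor_derive y he lu tr.
suff -> : - cor u ('D_e rho) y = cor g rho y by [].
rewrite /cor -derive_trans// ug ?opprK//; exact: test_trans.
Qed.

End Mollification.

(** * Ladyzhenskaya inequality for weak derivatives *)

Section Ladyzhenskaya.
Variable R : realType.
Local Notation PT := (R * R)%type.
Local Notation mR := (measurableTypeR R).
Local Notation P := (measurableTypeR R * measurableTypeR R)%type.
Local Notation mu := (@leb2 R).
Local Notation leb := (@lebesgue_measure R).
Local Notation sf := (summable_fun mu).
Local Notation J := (Rintegral mu setT).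
Implicit Types (f h w rho : PT -> R) (x y e : PT).

(* The fundamental theorem of calculus for [p ^ 2] together with [2 p q <= p ^ 2 + q ^ 2]. *)
Lemma sqr_le_integral (p q : R -> R) (a : R) : continuous p -> continuous q ->
  (forall t, is_derive t (1 : R) p (q t)) ->
  (forall d : R, 0 < d -> exists M, forall t, t < M -> `|p t| <= d) ->
  ((p a ^+ 2)%:E <= \int[leb]_t (p t ^+ 2 + q t ^+ 2)%:E)%E.
Proof.
move=> cp cq pq van.
have c2 (r : R -> R) : continuous r -> continuous (fun t => r t ^+ 2).
  move=> cr; have -> : (fun t => r t ^+ 2) = (fun t => r t * r t) by apply/funext => t; rewrite expr2.
  by move=> t; apply: continuousM; exact: cr.
have cpq : continuous (fun t => p t ^+ 2 + q t ^+ 2) by move=> t; exact: (continuousD (c2 p cp t) (c2 q cq t)).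
have mpq : measurable_fun [set: mR] (fun t => p t ^+ 2 + q t ^+ 2) by exact: continuous_measurable_fun.
have pq0 t : 0 <= p t ^+ 2 + q t ^+ 2 by rewrite addr_ge0// sqr_ge0.
apply/lee_addgt0Pr => d d0.
pose d1 := Num.min d 1.
have d10 : 0 < d1 by rewrite lt_min d0/=.
have [M hM] := van _ d10.
pose t0 := Num.min (M - 1) (a - 1).
have t0a : t0 < a by rewrite gt_min; apply/orP; right; lra.
have t0M : t0 < M by rewrite gt_min; apply/orP; left; lra.
have D t : is_derive t (1 : R) (fun t => p t ^+ 2) (2 * p t * q t).
  have := is_deriveM (pq t) (pq t); rewrite /GRing.scale/=.
  by congr is_derive; ring.
have cD : continuous (fun t => 2 * p t * q t).
  by move=> t; exact: (continuousM (continuousM (@cst_continuous _ _ (2 : R) t) (cp t)) (cq t)).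
have FTC : (\int[leb]_(t in `[t0, a]) (2 * p t * q t)%:E = (p a ^+ 2)%:E - (p t0 ^+ 2)%:E)%E.
  apply: (@continuous_FTC2 R (fun t => 2 * p t * q t) (fun t => p t ^+ 2) t0 a t0a).
  - exact: continuous_subspaceT.
  - split.
    + by move=> t _; case: (D t).
    + by apply: cvg_at_right_filter; exact: c2.
    + by apply: cvg_at_left_filter; exact: c2.
  - by move=> t _; rewrite derive1E; case: (D t).
have pt0 : p t0 ^+ 2 <= d.
  have h1 := hM _ t0M.
  rewrite -real_normK ?num_real// expr2 (@le_trans _ _ (d1 * 1))//.
    by apply: ler_pM => //; rewrite (le_trans h1)// ge_min lexx orbT.
  by rewrite mulr1 ge_min lexx.
have -> : ((p a ^+ 2)%:E = \int[leb]_(t in `[t0, a]) (2 * p t * q t)%:E + (p t0 ^+ 2)%:E)%E.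
  by rewrite FTC -EFinB -EFinD; congr EFin; ring.
apply: leeD; last by rewrite lee_fin.
apply: (@le_trans _ _ (\int[leb]_(t in `[t0, a]) (p t ^+ 2 + q t ^+ 2)%:E)%E).
  apply: le_integral.
  - exact: measurable_itv.
  - apply: continuous_compact_integrable; first exact: segment_compact.
    exact: continuous_subspaceT.
  - apply: continuous_compact_integrable; first exact: segment_compact.
    exact: continuous_subspaceT.
  - have A (x y : R) : 2 * x * y <= x ^+ 2 + y ^+ 2 by have := sqr_ge0 (x - y); nra.
    by move=> t _; rewrite lee_fin; exact: A.
apply: ge0_subset_integral => //; first exact/measurable_EFinP.
by move=> t _; rewrite lee_fin.
Qed.

(** Each of the two factors $U^2$ is bounded by a function of one variable, not the same one, so the
    double integral splits into a product. *)
Lemma fourth_le_product (U : PT -> R) (A B : R -> \bar R) (Ca Cb : R) : measurable_fun [set: P] U ->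
  measurable_fun [set: mR] A -> measurable_fun [set: mR] B ->
  (forall t, 0 <= A t)%E -> (forall t, 0 <= B t)%E ->
  (forall x, (U x ^+ 2)%:E <= A x.2)%E -> (forall x, (U x ^+ 2)%:E <= B x.1)%E ->
  (\int[leb]_t A t <= Ca%:E)%E -> (\int[leb]_t B t <= Cb%:E)%E ->
  sf (fun x => U x ^+ 4) /\ J (fun x => U x ^+ 4) <= Ca * Cb.
Proof.
move=> mU mA mB A0 B0 UA UB hA hB.
have U0 x : 0 <= U x ^+ 4 by rewrite (_ : 4%N = (2 * 2)%N)// exprM sqr_ge0.
have mU4 : measurable_fun [set: P] (fun x => U x ^+ 4) by exact: measurable_funX.
apply: ge0_sf_le => //.
have mf : measurable_fun [set: P] (fun x => (U x ^+ 4)%:E) by exact/measurable_EFinP.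
have -> : (\int[mu]_x (U x ^+ 4)%:E = \int[leb]_a \int[leb]_b (U (a, b) ^+ 4)%:E)%E.
  by apply: (@fubini_tonelli1 _ _ _ _ _ leb leb (fun x => (U x ^+ 4)%:E)) => // x; rewrite lee_fin.
apply: (@le_trans _ _ (\int[leb]_a (B a * \int[leb]_b A b))%E).
  apply: ge0_le_integral => //.
  - by move=> a _; apply: integral_ge0 => b _; rewrite lee_fin.
  - by apply: (@measurable_fun_fubini_tonelli_F _ _ _ _ _ leb (fun x => (U x ^+ 4)%:E)) => // x; rewrite lee_fin.
  - by apply: emeasurable_funM.
  - move=> a _; rewrite -ge0_integralZl//; last first.
    apply: ge0_le_integral => //.
    + by move=> b _; rewrite lee_fin.
    + by apply: (measurableT_comp mf); exact: measurable_pair1.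
    + exact: emeasurable_funM.
    + move=> b _; rewrite (_ : U (a, b) ^+ 4 = U (a, b) ^+ 2 * U (a, b) ^+ 2) ?EFinM; last by ring.
      by apply: lee_pmul; rewrite ?lee_fin ?sqr_ge0//; [exact: (UB (a, b))|exact: (UA (a, b))].
rewrite ge0_integralZr//; last by apply: integral_ge0.
rewrite muleC EFinM; apply: lee_pmul => //; exact: integral_ge0.
Qed.

Section Mollified.
Variables (u g1 g2 rho : PT -> R).
Hypotheses (lu : l2 u) (lg1 : l2 g1) (lg2 : l2 g2).
Hypotheses (d1 : wderiv (e1 R) u g1) (d2 : wderiv (e2 R) u g2).
Hypotheses (tr : test_function rho) (r0 : forall x, 0 <= rho x) (r1 : J rho = 1).

Let line1 (b t : R) : (t, b) = t *: e1 R + (0, b).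
Proof. by rewrite /e1; congr pair; rewrite /= ?[_ *: _]mulr1 ?[_ *: _]mulr0 ?addr0 ?add0r. Qed.

Let line2 (a t : R) : (a, t) = t *: e2 R + (a, 0).
Proof. by rewrite /e2; congr pair; rewrite /= ?[_ *: _]mulr1 ?[_ *: _]mulr0 ?addr0 ?add0r. Qed.

Let cont1 f b : continuous f -> continuous (fun t => f (t, b)).
Proof.
move=> cf t; apply: (@continuous_comp _ _ _ (fun t => (t, b)) f); last exact: cf.
exact: (cvg_pair cvg_id (cvg_cst b)).
Qed.

Let cont2 f a : continuous f -> continuous (fun t => f (a, t)).
Proof.
move=> cf t; apply: (@continuous_comp _ _ _ (fun t => (a, t)) f); last exact: cf.
exact: (cvg_pair (cvg_cst a) cvg_id).
Qed.

Let sum_sq_int g : l2 g -> (\int[mu]_x (cor u rho x ^+ 2 + cor g rho x ^+ 2)%:E <=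
  (J (fun x => u x ^+ 2) + J (fun x => g x ^+ 2))%:E)%E.
Proof.
move=> lg; have [[_ su] hu] := cor_l2 tr r0 r1 lu; have [[_ sg] hg] := cor_l2 tr r0 r1 lg.
by rewrite -EFin_J ?JD ?lee_fin ?lerD//; exact: sfD.
Qed.

(** The one-variable bounds are integrals over horizontal and vertical lines. The final bound is
    free of [rho] because mollification does not increase the $L^2$ norm. *)
Lemma cor_fourth : sf (fun x => cor u rho x ^+ 4) /\ J (fun x => cor u rho x ^+ 4) <=
  (J (fun x => u x ^+ 2) + J (fun x => g1 x ^+ 2)) * (J (fun x => u x ^+ 2) + J (fun x => g2 x ^+ 2)).
Proof.
have cU := cor_continuous lu tr; have c1 := cor_continuous lg1 tr; have c2 := cor_continuous lg2 tr.
have mc (g : PT -> R) : continuous g -> measurable_fun [set: P] g by exact: continuous_measurable_plane.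
have mF (g : PT -> R) : continuous g -> measurable_fun [set: P] (fun x => (cor u rho x ^+ 2 + g x ^+ 2)%:E).
  by move=> cg; apply/measurable_EFinP; apply: measurable_funD; apply: measurable_funX; exact: mc.
have F0 (g : PT -> R) x : (0 <= (cor u rho x ^+ 2 + g x ^+ 2)%:E)%E by rewrite lee_fin addr_ge0// sqr_ge0.
apply: (@fourth_le_product _ (fun b => \int[leb]_s (cor u rho (s, b) ^+ 2 + cor g1 rho (s, b) ^+ 2)%:E)%E
  (fun a => \int[leb]_s (cor u rho (a, s) ^+ 2 + cor g2 rho (a, s) ^+ 2)%:E)%E).
- exact: mc.
- by apply: (@measurable_fun_fubini_tonelli_G _ _ _ _ _ leb (fun x => (cor u rho x ^+ 2 + cor g1 rho x ^+ 2)%:E)) => //; exact: mF.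
- by apply: (@measurable_fun_fubini_tonelli_F _ _ _ _ _ leb (fun x => (cor u rho x ^+ 2 + cor g2 rho x ^+ 2)%:E)) => //; exact: mF.
- by move=> t; apply: integral_ge0 => s _.
- by move=> t; apply: integral_ge0 => s _.
- move=> [a b] /=; apply: (@sqr_le_integral (fun t => cor u rho (t, b)) (fun t => cor g1 rho (t, b))).
  + exact: cont1.
  + exact: cont1.
  + move=> t; under eq_fun do rewrite line1; rewrite line1; apply/is_derive_line.
    by apply: cor_wderiv => //; left.
  + move=> d d0; have [M M0 hM] := cor_vanish lu tr d0.
    exists (- M) => t tM; apply: hM => -[/= + _].
    by rewrite ler_norml => /andP[h _]; move: tM; rewrite ltNge h.
- move=> [a b] /=; apply: (@sqr_le_integral (fun t => cor u rho (a, t)) (fun t => cor g2 rho (a, t))).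
  + exact: cont2.
  + exact: cont2.
  + move=> t; under eq_fun do rewrite line2; rewrite line2; apply/is_derive_line.
    by apply: cor_wderiv => //; right.
  + move=> d d0; have [M M0 hM] := cor_vanish lu tr d0.
    exists (- M) => t tM; apply: hM => -[/= _].
    by rewrite ler_norml => /andP[h _]; move: tM; rewrite ltNge h.
- apply: le_trans (sum_sq_int lg1); rewrite le_eqVlt; apply/orP; left; apply/eqP.
  by rewrite -(@fubini_tonelli2 _ _ _ _ _ leb leb (fun x => (cor u rho x ^+ 2 + cor g1 rho x ^+ 2)%:E))//; exact: mF.
- apply: le_trans (sum_sq_int lg2); rewrite le_eqVlt; apply/orP; left; apply/eqP.
  by rewrite -(@fubini_tonelli1 _ _ _ _ _ leb leb (fun x => (cor u rho x ^+ 2 + cor g2 rho x ^+ 2)%:E))//; exact: mF.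
Qed.

End Mollified.

(** Only weak convergence of the mollifications is at hand, so the uniform bound reaches [w] through
    the dual formulation of [lsc_fourth]. *)
Lemma sf_fourth_of_mollified w C : l2 w ->
  (forall n, exists rho, [/\ test_function rho, forall x, 0 <= rho x, J rho = 1, supported rho n.+1%:R^-1 &
     sf (fun x => cor w rho x ^+ 4) /\ J (fun x => cor w rho x ^+ 4) <= C]) ->
  sf (fun x => w x ^+ 4).
Proof.
move=> lw H; have lcw := l2_locsum lw; apply: (lsc_fourth (C := C) lcw) => h th.
have th3 : test_function (fun x => h x ^+ 3).
  by have := test_mul th (test_mul th th); congr test_function; apply/funext => x; ring.
have th4 : test_function (fun x => h x ^+ 4).
  by have := test_mul th th3; congr test_function; apply/funext => x; ring.
have [K K0 hK] := cor_approx lw th3.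
have sh4 := test_sf th4.
have s3 := lcw.2 _ th3.
apply/ler_addgt0Pr => d d0.
(* This makes the error $4K/(n+1)$ of weak convergence at most [d]. *)
have [n hn] : exists n : nat, 4 * K / d < n.+1%:R.
  exists (Num.Def.archi_bound (4 * K / d)); rewrite (lt_le_trans (archi_boundP _)) ?ler_nat//.
  by rewrite divr_ge0 ?mulr_ge0// ltW.
have [rho [tr r0 r1 sr [s4 h4]]] := H n.
have lU := (cor_l2 tr r0 r1 lw).1.
have sU3 := (l2_locsum lU).2 _ th3.
have /hK/(_ tr r0 r1 sr) h5 : 0 < (n.+1%:R^-1 : R) <= 1.
  by rewrite invr_gt0 ltr0n/= invf_le1 ?ltr0n// ler1n.
have E (v : PT -> R) : sf (fun x => v x * h x ^+ 3) ->
    sf (fun x => 4 * h x ^+ 3 * v x - 3 * h x ^+ 4) /\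
    J (fun x => 4 * h x ^+ 3 * v x - 3 * h x ^+ 4) = 4 * J (fun x => v x * h x ^+ 3) - 3 * J (fun x => h x ^+ 4).
  move=> sv; have -> : (fun x => 4 * h x ^+ 3 * v x - 3 * h x ^+ 4) = (fun x => 4 * (v x * h x ^+ 3) - 3 * h x ^+ 4).
    by apply/funext => x; ring.
  by split; [apply: sfB; exact: sfZ|rewrite JB ?JZ//; exact: sfZ].
have [_ ->] := E w s3; have [sE EU] := E _ sU3.
have h6 : J (fun x => 4 * h x ^+ 3 * cor w rho x - 3 * h x ^+ 4) <= C.
  apply: le_trans h4; apply: leJ => // x.
  rewrite -subr_ge0.
  (* The fourth power lies above its tangent at [h x]; the factorization makes this evident. *)
  rewrite (_ : _ - _ = (cor w rho x - h x) ^+ 2 * ((cor w rho x + h x) ^+ 2 + 2 * h x ^+ 2)); last by ring.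
  by rewrite mulr_ge0 ?sqr_ge0// addr_ge0 ?sqr_ge0// mulr_ge0 ?sqr_ge0.
rewrite EU in h6.
have h7 : 4 * (K / n.+1%:R) <= d.
  have n0 : 0 < n.+1%:R :> R by [].
  by rewrite mulrA ler_pdivrMr// -ler_pdivrMl// mulrC ltW.
move: h5; rewrite ler_norml => /andP[h8 _].
move: h6 h7 h8; set a := J (fun x => cor w rho x * h x ^+ 3).
set b := J (fun x => w x * h x ^+ 3); set k := K / n.+1%:R.
by move=> h6 h7 h8; move: (J (fun x => h x ^+ 4)) h6 => c h6; clearbody a b k; lra.
Qed.

Lemma weak_ladyzhenskaya u g1 g2 : l2 u -> l2 g1 -> l2 g2 ->
  wderiv (e1 R) u g1 -> wderiv (e2 R) u g2 -> sf (fun x => u x ^+ 4).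
Proof.
move=> lu lg1 lg2 d1 d2.
apply: (sf_fourth_of_mollified (C := (J (fun x => u x ^+ 2) + J (fun x => g1 x ^+ 2)) *
  (J (fun x => u x ^+ 2) + J (fun x => g2 x ^+ 2))) lu) => n.
have [c c0 /(_ n)[rho [tr r01 r1 sr]]] := mollifier R.
have r0 x : 0 <= rho x by case/andP: (r01 x).
have [s4 h4] := cor_fourth lu lg1 lg2 d1 d2 tr r0 r1.
by exists rho.
Qed.

End Ladyzhenskaya.

(** * Comparison principle and fourth-power integrability of the Green's function *)

Section SecondDerivative.
Variable R : realType.

(** [f'] vanishes at [c]; if [b] were positive, [f'] would be positive just to the right of [c], and
    the mean value theorem would produce a larger value of [f]. *)
Lemma second_derivative_max (f f' : R -> R) (c b : R) :
  (forall t, is_derive t (1 : R) f (f' t)) -> is_derive c (1 : R) f' b ->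
  (forall t, f t <= f c) -> b <= 0.
Proof.
move=> ff' f'b fmax; rewrite leNgt; apply/negP => b0.
have f'c : f' c = 0.
  have := @derive1_at_max R f (c - 1) (c + 1) c.
  case.
  - lra.
  - by move=> t _; case: (ff' t).
  - by rewrite in_itv/=; apply/andP; split; lra.
  - by move=> t _; exact: fmax.
  by move=> _ <-; case: (ff' c).
have [d1 d2] := f'b.
have cv : h^-1 *: ((f' \o shift c) (h *: (1 : R)) - f' c) @[h --> 0^'] --> b.
  by rewrite -d2; exact: d1.
have /cvgrPdist_lt/(_ _ b0) := cv.
move=> [e /= e0 He].
have ep t : 0 < t < e -> 0 < f' (t + c).
  move=> /andP[t0 te].
  have := He t; rewrite /ball_/= sub0r normrN gtr0_norm// => /(_ te (lt0r_neq0 t0)).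
  rewrite f'c subr0 [t *: (1 : R)]mulr1 ltr_norml => /andP[_ h].
  have : 0 < t^-1 * f' (t + c) by rewrite -[t^-1 * _]/(t^-1 *: f' (t + c)); lra.
  by rewrite pmulr_rgt0 ?invr_gt0.
have ce : c < c + e / 2 by rewrite ltrDl divr_gt0.
have [|z] := @MVT R f f' c (c + e / 2) ce (fun t _ => ff' t).
  apply: derivable_within_continuous => t _; by case: (ff' t).
rewrite in_itv/= => /andP[z1 z2] E.
have : 0 < f' z.
  by rewrite -(subrK c z); apply: ep; apply/andP; split; lra.
move=> fz; have := fmax (c + e / 2); rewrite -subr_le0 E leNgt => /negP; apply.
by rewrite mulr_gt0// subr_gt0.
Qed.

Lemma is_derive_ln_sqr (k t : R) : 0 < k ->
  is_derive t (1 : R) (fun t => ln (t ^+ 2 + k)) (2 * t / (t ^+ 2 + k)).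
Proof.
move=> k0; have s0 : 0 < t ^+ 2 + k by rewrite ltr_wpDl// sqr_ge0.
have d : is_derive t (1 : R) (fun t => t ^+ 2 + k) (2 * t).
  have -> : (fun t : R => t ^+ 2 + k) = (fun t => t * t + k) by apply/funext => r; rewrite expr2.
  have := is_deriveD (is_deriveM (is_derive_id t (1 : R)) (is_derive_id t (1 : R))) (is_derive_cst k t (1 : R)).
  by rewrite [X in is_derive _ _ _ X](_ : _ = 2 * t)// /GRing.scale/=; ring.
have := @is_derive1_comp _ _ (fun t => t ^+ 2 + k) t _ _ (is_derive1_ln s0) d.
by congr is_derive; rewrite mulrC.
Qed.

Lemma is_derive_ln_sqr2 (k t : R) : 0 < k ->
  is_derive t (1 : R) (fun t => 2 * t / (t ^+ 2 + k)) ((2 * (t ^+ 2 + k) - 4 * t ^+ 2) / (t ^+ 2 + k) ^+ 2).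
Proof.
move=> k0; have s0 : t ^+ 2 + k != 0 by rewrite gt_eqF// ltr_wpDl// sqr_ge0.
have d : is_derive t (1 : R) (fun t => t ^+ 2 + k) (2 * t).
  have -> : (fun t : R => t ^+ 2 + k) = (fun t => t * t + k) by apply/funext => r; rewrite expr2.
  have := is_deriveD (is_deriveM (is_derive_id t (1 : R)) (is_derive_id t (1 : R))) (is_derive_cst k t (1 : R)).
  by rewrite [X in is_derive _ _ _ X](_ : _ = 2 * t)// /GRing.scale/=; ring.
have d2 : is_derive t (1 : R) (fun t => 2 * t) 2.
  by have := is_deriveZ 2 (is_derive_id t (1 : R)); rewrite [2 *: (1 : R)]mulr1.
have := is_deriveM d2 (@is_deriveV R _ t _ 1 s0 d).
by rewrite [X in is_derive _ _ _ X](_ : _ = (2 * (t ^+ 2 + k) - 4 * t ^+ 2) / (t ^+ 2 + k) ^+ 2)// /GRing.scale/=; field.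
Qed.

End SecondDerivative.

(** * The logarithmic supersolution *)

Section Barrier.
Variable R : realType.
Local Notation PT := (R * R)%type.
Implicit Types (x y z : PT) (M E A : R).

(** A positive, decaying substitute for $-2\log|x|$: [E] is the squared scale at which the
    singularity is smoothed, [M] the squared scale of the decay. The sums are nested so that along
    the first axis each logarithm has the form $\ln(t^2 + k)$. *)
Definition barrier M E x : R := ln (x.1 ^+ 2 + (x.2 ^+ 2 + (M + E))) - ln (x.1 ^+ 2 + (x.2 ^+ 2 + E)).

(** This is $\ln(1 - a) \le -a$ at $a = M/(s + M)$. *)
Lemma barrier_ge M E x : 0 < M -> 0 < E -> M / (x.1 ^+ 2 + x.2 ^+ 2 + E + M) <= barrier M E x.
Proof.
move=> M0 E0; rewrite /barrier; set s := x.1 ^+ 2 + (x.2 ^+ 2 + E).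
have s0 : 0 < s by rewrite ltr_wpDl ?sqr_ge0// ltr_wpDl ?sqr_ge0.
have -> : x.1 ^+ 2 + (x.2 ^+ 2 + (M + E)) = s + M by rewrite /s; ring.
have -> : x.1 ^+ 2 + x.2 ^+ 2 + E + M = s + M by rewrite /s; ring.
have sM : 0 < s + M by rewrite addr_gt0.
have := @le_ln1Dx R (- (M / (s + M))) => /(_ _).
have -> : 1 - M / (s + M) = s / (s + M) by field; rewrite gt_eqF.
rewrite ln_div ?posrE// => H.
have : ln s - ln (s + M) <= - (M / (s + M)) by apply: H; rewrite ltrN2 ltr_pdivrMr// mul1r ltrDr.
lra.
Qed.

Lemma barrier_ge0 M E x : 0 < M -> 0 < E -> 0 <= barrier M E x.
Proof.
move=> M0 E0; apply: le_trans (barrier_ge x M0 E0).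
by rewrite divr_ge0 ?addr_ge0 ?sqr_ge0// ltW.
Qed.

Lemma barrierE M E x : 0 < M -> 0 < E ->
  barrier M E x = ln (1 + M / (x.1 ^+ 2 + x.2 ^+ 2 + E)).
Proof.
move=> M0 E0; rewrite /barrier.
have s0 : 0 < x.1 ^+ 2 + x.2 ^+ 2 + E by rewrite ltr_wpDl// addr_ge0// sqr_ge0.
have -> : 1 + M / (x.1 ^+ 2 + x.2 ^+ 2 + E) = (x.1 ^+ 2 + (x.2 ^+ 2 + (M + E))) / (x.1 ^+ 2 + x.2 ^+ 2 + E).
  by field; rewrite gt_eqF.
by rewrite ln_div ?posrE ?addrA// !ltr_wpDl ?addr_ge0 ?sqr_ge0//; lra.
Qed.

Lemma barrier_continuous M E : 0 < M -> 0 < E -> continuous (barrier M E).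
Proof.
move=> M0 E0.
have H (k : R) : 0 < k -> continuous (fun x : PT => ln (x.1 ^+ 2 + (x.2 ^+ 2 + k)) : R).
  move=> k0 x.
  apply: (@continuous_comp _ _ _ (fun x : PT => x.1 ^+ 2 + (x.2 ^+ 2 + k)) (@ln R)); last first.
    by apply: continuous_ln; rewrite !ltr_wpDl ?sqr_ge0.
  have c1 : {for x, continuous (fun x : PT => x.1 * x.1)}.
    by apply: continuousM; exact: cvg_fst.
  have c2 : {for x, continuous (fun x : PT => x.2 * x.2)}.
    by apply: continuousM; exact: cvg_snd.
  rewrite (_ : (fun x : PT => _) = (fun x : PT => x.1 * x.1 + (x.2 * x.2 + k))); last first.
    by apply/funext => y; rewrite !expr2.
  by apply: (continuousD c1); apply: (continuousD c2); exact: cst_continuous.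
by move=> x; exact: (continuousB (H _ (addr_gt0 M0 E0) x) (H _ E0 x)).
Qed.

(* The parenthesis is the Laplacian of the barrier, so that the barrier is a
   supersolution: [- Delta b + l b >= 4 E / (r ^ 2 + E) ^ 2]. *)
Lemma barrier_super M E (l s : R) x : 0 < M -> 0 < E -> l * M = 4 ->
  s = x.1 ^+ 2 + x.2 ^+ 2 + E ->
  4 * E / s ^+ 2 <= - (4 * (M + E) / (s + M) ^+ 2 - 4 * E / s ^+ 2) + l * barrier M E x.
Proof.
move=> M0 E0 lM sx.
have l0 : 0 < l by rewrite -(pmulr_lgt0 _ M0) lM.
have sE : E <= s by rewrite sx lerDr addr_ge0// sqr_ge0.
have s0 : 0 < s by exact: lt_le_trans sE.
have sM : 0 < s + M by rewrite addr_gt0.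
have h1 : 4 / (s + M) <= l * barrier M E x.
  by rewrite -lM -mulrA ler_wpM2l ?(ltW l0)// sx barrier_ge.
have h2 : 4 * (M + E) / (s + M) ^+ 2 <= 4 / (s + M).
  rewrite ler_pdivrMr ?exprn_gt0// expr2 mulrA divfK ?gt_eqF// ler_wpM2l//; lra.
lra.
Qed.

End Barrier.

(** * Maximum principle for mollified solutions *)

Section Comparison.
Variable R : realType.
Local Notation PT := (R * R)%type.
Local Notation P := (measurableTypeR R * measurableTypeR R)%type.
Local Notation mu := (@leb2 R).
Local Notation sf := (summable_fun mu).
Local Notation J := (Rintegral mu setT).
Implicit Types (f h w rho : PT -> R) (x y z e : PT).

(** At a maximum of the difference the second derivatives along [e] are ordered; the two minus signs
    of [cor_derive] cancel. *)
Lemma axis_second_max w rho f (z e : PT) (x0 : PT) (c : R) (p' : R -> R) (b : R) : axis e ->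
  l2 w -> test_function rho -> z = c *: e + x0 ->
  (forall t, is_derive t (1 : R) (fun t => f (t *: e + x0)) (p' t)) -> is_derive c (1 : R) p' b ->
  (forall y, cor w rho y - f y <= cor w rho z - f z) ->
  cor w ('D_e ('D_e rho)) z <= b.
Proof.
move=> he lw tr zE fp pb hmax.
have tD := test_derive he tr.
have D1 t : is_derive t (1 : R) (fun t => cor w rho (t *: e + x0) - f (t *: e + x0))
    (- cor w ('D_e rho) (t *: e + x0) - p' t).
  by apply: is_deriveB; apply/is_derive_line; exact: cor_derive.
have D2 : is_derive c (1 : R) (fun t => - cor w ('D_e rho) (t *: e + x0) - p' t) (cor w ('D_e ('D_e rho)) z - b).
  apply: is_deriveB => //.
  have : is_derive c (1 : R) (fun t => cor w ('D_e rho) (t *: e + x0)) (- cor w ('D_e ('D_e rho)) z).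
    by apply/is_derive_line; rewrite -zE; exact: cor_derive.
  by move=> /is_deriveN; rewrite opprK.
rewrite -subr_le0; apply: (second_derivative_max D1 D2) => t.
by rewrite -zE; exact: hmax.
Qed.

Section Green.
Variables (w : PT -> R) (l k : R).
Hypotheses (l0 : 0 < l) (k1 : `|k| <= 1) (lw : l2 w).
Hypothesis green : forall f, test_function f ->
  J (fun x => w x * (- laplacian f x + l * f x)) = k * f (0, 0).

Lemma test_laplacian f : test_function f -> test_function (laplacian f).
Proof.
move=> tf; apply: test_add.
- by apply: test_derive; [left|apply: test_derive => //; left].
- by apply: test_derive; [right|apply: test_derive => //; right].
Qed.

Lemma laplacian_trans f y : test_function f -> laplacian (trans f y) = trans (laplacian f) y.
Proof.
move=> tf; apply/funext => x; rewrite /laplacian.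
have a1 : axis (e1 R) by left. have a2 : axis (e2 R) by right.
have E e : axis e -> 'D_e ('D_e (trans f y)) = trans ('D_e ('D_e f)) y.
  move=> ae; have E1 := derive_trans y ae tf; rewrite E1.
  exact: (derive_trans y ae (test_derive ae tf)).
exact: (congr2 +%R (congr1 (@^~ x) (E _ a1)) (congr1 (@^~ x) (E _ a2))).
Qed.

(** Testing with a translated kernel makes the equation hold pointwise for the mollification. The
    weight [k] is 1 for the real part of the Green's function, 0 for its imaginary part, and changes
    sign with [w]. *)
Lemma cor_green rho y : test_function rho ->
  l * cor w rho y = k * rho (- y) + cor w (laplacian rho) y.
Proof.
move=> tr; have := green (test_trans y tr).
rewrite /trans sub0r -/(trans rho y) => <-.
have s1 := sf_cor y lw tr; have s2 := sf_cor y lw (test_laplacian tr).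
rewrite /cor -JZ// -JD//; last first.
  have := sfB (sfZ l s1) s2; congr (summable_fun mu _); apply/funext => x.
  rewrite laplacian_trans// /trans; ring.
congr Rintegral; apply/funext => x; rewrite laplacian_trans// /trans; ring.
Qed.

(** If [D] were positive somewhere, it would have a positive maximum, since [cor w rho] vanishes at
    infinity; there the Laplacians are ordered, against the supersolution property. The choice
    [l * M = 4] lets the zeroth-order term of the barrier absorb the Laplacian of its logarithm
    containing [M]. *)
Lemma cor_le_barrier rho (A M E : R) : test_function rho -> 0 < A -> 0 < M -> 0 < E -> l * M = 4 ->
  (forall x, 0 <= rho x) ->
  (forall y, rho (- y) <= A * (4 * E / (y.1 ^+ 2 + y.2 ^+ 2 + E) ^+ 2)) ->
  forall y, cor w rho y <= A * barrier M E y.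
Proof.
move=> tr A0 M0 E0 lM r0 hr y; rewrite leNgt; apply/negP => hy.
pose D x := cor w rho x - A * barrier M E x.
have Dy : 0 < D y by rewrite subr_gt0.
have cD : continuous D.
  move=> x; have cA : {for x, continuous (fun x => A * barrier M E x)}.
    by apply: continuousM; [exact: cst_continuous|exact: barrier_continuous].
  by rewrite /D; apply: continuousB; [exact: cor_continuous|exact: cA].
(* Outside this box [D] is at most half of its value at [y], so its maximum over the box is
   global. *)
have [N N0 hN] := cor_vanish lw tr (divr_gt0 Dy (ltr0n _ 2) : 0 < D y / 2).
have outb x : ~ box N x -> D x <= D y / 2.
  move=> /hN; rewrite ler_norml => /andP[_ h].
  have := barrier_ge0 x M0 E0; move=> /(mulr_ge0 (ltW A0)) h2; rewrite {1}/D; lra.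
have by_ : box N y.
  by apply: contrapT => /outb; lra.
have [||z zb hz] := @compact_EVT_max _ R D (box N) _ (@box_compact R N).
- by exists y.
- exact: continuous_subspaceT.
have zmax x : D x <= D z.
  have [bx|/outb h] := pselect (box N x); first by apply: hz; rewrite inE.
  have := hz y; rewrite inE => /(_ by_); lra.
have Dz : 0 < D z by apply: lt_le_trans (zmax y).
pose s := z.1 ^+ 2 + z.2 ^+ 2 + E.
have s0 : 0 < s by rewrite ltr_wpDl// addr_ge0// sqr_ge0.
have sM0 : 0 < s + M by rewrite addr_gt0.
have kp a b : 0 < b -> 0 < a ^+ 2 + b :> R by move=> b0; rewrite ltr_wpDl// sqr_ge0.
(* The first and second derivatives of $\ln(t^2 + k)$. *)
pose q k t : R := 2 * t / (t ^+ 2 + k).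
pose q' k t : R := (2 * (t ^+ 2 + k) - 4 * t ^+ 2) / (t ^+ 2 + k) ^+ 2.
have L1 : cor w ('D_(e1 R) ('D_(e1 R) rho)) z <= A * (q' (z.2 ^+ 2 + (M + E)) z.1 - q' (z.2 ^+ 2 + E) z.1).
  have ME : 0 < M + E by rewrite addr_gt0.
  have H := @axis_second_max w rho (fun x => A * barrier M E x) z (e1 R) (0, z.2) z.1
    (fun t => A * (q (z.2 ^+ 2 + (M + E)) t - q (z.2 ^+ 2 + E) t))
    (A * (q' (z.2 ^+ 2 + (M + E)) z.1 - q' (z.2 ^+ 2 + E) z.1)) (or_introl erefl) lw tr.
  apply: H.
  - case: (z) => a b; rewrite /e1; congr pair; rewrite /= ?[_ *: _]mulr1 ?[_ *: _]mulr0 ?addr0 ?add0r//.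
  - move=> t; apply: is_deriveZ.
    rewrite (_ : (fun t => _) = (fun t => ln (t ^+ 2 + (z.2 ^+ 2 + (M + E))) - ln (t ^+ 2 + (z.2 ^+ 2 + E)))); last first.
      by apply/funext => r; rewrite /barrier /= [r *: 1]mulr1 [r *: 0]mulr0 addr0 add0r.
    by apply: is_deriveB; apply: is_derive_ln_sqr; exact: kp.
  - by apply: is_deriveZ; apply: is_deriveB; apply: is_derive_ln_sqr2; exact: kp.
  - exact: zmax.
have L2 : cor w ('D_(e2 R) ('D_(e2 R) rho)) z <= A * (q' (z.1 ^+ 2 + (M + E)) z.2 - q' (z.1 ^+ 2 + E) z.2).
  have ME : 0 < M + E by rewrite addr_gt0.
  have H := @axis_second_max w rho (fun x => A * barrier M E x) z (e2 R) (z.1, 0) z.2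
    (fun t => A * (q (z.1 ^+ 2 + (M + E)) t - q (z.1 ^+ 2 + E) t))
    (A * (q' (z.1 ^+ 2 + (M + E)) z.2 - q' (z.1 ^+ 2 + E) z.2)) (or_intror erefl) lw tr.
  apply: H.
  - case: (z) => a b; rewrite /e2; congr pair; rewrite /= ?[_ *: _]mulr1 ?[_ *: _]mulr0 ?addr0 ?add0r//.
  - move=> t; apply: is_deriveZ.
    rewrite (_ : (fun t => _) = (fun t => ln (t ^+ 2 + (z.1 ^+ 2 + (M + E))) - ln (t ^+ 2 + (z.1 ^+ 2 + E)))); last first.
      by apply/funext => r; rewrite /barrier /= [r *: 1]mulr1 [r *: 0]mulr0 addr0 add0r !addrA [z.1 ^+ 2 + _]addrC.
    by apply: is_deriveB; apply: is_derive_ln_sqr; exact: kp.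
  - by apply: is_deriveZ; apply: is_deriveB; apply: is_derive_ln_sqr2; exact: kp.
  - exact: zmax.
have L : cor w (laplacian rho) z <= A * (4 * (M + E) / (s + M) ^+ 2 - 4 * E / s ^+ 2).
  have -> : cor w (laplacian rho) z = cor w ('D_(e1 R) ('D_(e1 R) rho)) z + cor w ('D_(e2 R) ('D_(e2 R) rho)) z.
    rewrite /cor -JD; last 2 first.
    - by apply: sf_cor => //; apply: test_derive; [left|apply: test_derive => //; left].
    - by apply: sf_cor => //; apply: test_derive; [right|apply: test_derive => //; right].
    by congr Rintegral; apply/funext => x; rewrite /trans /laplacian mulrDr.
  apply: (le_trans (lerD L1 L2)); rewrite -mulrDr le_eqVlt; apply/orP; left; apply/eqP; congr (_ * _).
  rewrite /q' (_ : z.1 ^+ 2 + (z.2 ^+ 2 + (M + E)) = s + M); last by rewrite /s; ring.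
  rewrite (_ : z.1 ^+ 2 + (z.2 ^+ 2 + E) = s); last by rewrite /s; ring.
  rewrite (_ : z.2 ^+ 2 + (z.1 ^+ 2 + (M + E)) = s + M); last by rewrite /s; ring.
  rewrite (_ : z.2 ^+ 2 + (z.1 ^+ 2 + E) = s); last by rewrite /s; ring.
  (* For $S = r^2 + k$ the two second derivatives of $\ln S$ add up to $(4S - 4r^2)/S^2 = 4k/S^2$,
     once $r^2$ is expressed as $s - E$. *)
  have -> : z.1 ^+ 2 = s - E - z.2 ^+ 2 by rewrite /s; ring.
  by clearbody s; field; rewrite !gt_eqF.
have B := barrier_super M0 E0 lM (erefl s).
have AB : A * (4 * E / s ^+ 2) <= A * (- (4 * (M + E) / (s + M) ^+ 2 - 4 * E / s ^+ 2) + l * barrier M E z).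
  by rewrite ler_wpM2l// ltW.
have h1 : k * rho (- z) <= A * (4 * E / s ^+ 2).
  apply: le_trans (hr z); apply: (le_trans (ler_norm _)); rewrite normrM (ger0_norm (r0 _)).
  by rewrite ler_piMl.
have h2 : l * cor w rho z <= l * (A * barrier M E z).
  rewrite cor_green//; apply: (le_trans (lerD h1 L)); apply: (le_trans (lerD AB (lexx _))).
  by rewrite -mulrDr addrAC addNr add0r mulrCA.
move: h2; rewrite ler_pM2l// => h2.
by move: Dz; rewrite /D subr_gt0 ltNge h2.
Qed.

End Green.
End Comparison.

(** * Fourth-power integrability of the Green's function *)

Section GreenFourth.
Variable R : realType.
Local Notation PT := (R * R)%type.
Local Notation mR := (measurableTypeR R).
Local Notation P := (measurableTypeR R * measurableTypeR R)%type.
Local Notation mu := (@leb2 R).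
Local Notation leb := (@lebesgue_measure R).
Local Notation sf := (summable_fun mu).
Local Notation J := (Rintegral mu setT).
Implicit Types (f h w rho : PT -> R) (x y z e : PT).

(** The power $(t^2 + E)^{-1/4}$, integrable at 0 uniformly in [E]. *)
Definition qroot (E t : R) : R := expR (- 4^-1 * ln (t ^+ 2 + E)).
(* The derivative of [t (t ^ 2 + E) ^ (-1/4)]: up to a factor 2 it dominates
   [(t ^ 2 + E) ^ (-1/4)], and its integral over [-1, 1] is explicit. *)
Definition qroot_weight (E t : R) : R := qroot E t * (1 - t ^+ 2 / (2 * (t ^+ 2 + E))).

Lemma sqrD_gt0 (E t : R) : 0 < E -> 0 < t ^+ 2 + E.
Proof. by move=> E0; rewrite ltr_wpDl// sqr_ge0. Qed.

Lemma is_derive_qroot0 (E t : R) : 0 < E ->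
  is_derive t (1 : R) (qroot E) (qroot E t * (- 4^-1 * (2 * t / (t ^+ 2 + E)))).
Proof.
move=> E0; have d1 := is_deriveZ (- 4^-1 : R) (is_derive_ln_sqr t E0).
have := @is_derive1_comp _ _ (fun t => - 4^-1 * ln (t ^+ 2 + E)) t _ _ (is_derive_expR _) d1.
by rewrite /qroot; congr is_derive.
Qed.

Lemma is_derive_qroot (E t : R) : 0 < E ->
  is_derive t (1 : R) (fun t => t * qroot E t) (qroot_weight E t).
Proof.
move=> E0; have s0 := sqrD_gt0 t E0.
have := is_deriveM (is_derive_id t (1 : R)) (is_derive_qroot0 t E0).
rewrite [X in is_derive _ _ _ X](_ : _ = qroot_weight E t)// /GRing.scale/= /qroot_weight.
by set q := qroot E t; clearbody q; field; rewrite gt_eqF.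
Qed.

Lemma qroot_weight_ge (E t : R) : 0 < E -> qroot E t <= 2 * qroot_weight E t.
Proof.
move=> E0; have s0 := sqrD_gt0 t E0; rewrite /qroot_weight mulrCA ler_peMr ?expR_ge0//.
have : t ^+ 2 / (2 * (t ^+ 2 + E)) <= 2^-1.
  by rewrite ler_pdivrMr ?mulr_gt0// mulrA mulVf// mul1r lerDl ltW.
lra.
Qed.

Lemma qroot_weight_ge0 (E t : R) : 0 < E -> 0 <= qroot_weight E t.
Proof. by move=> E0; have := qroot_weight_ge t E0; have := expR_ge0 (- 4^-1 * ln (t ^+ 2 + E)); rewrite -/(qroot E t); lra. Qed.

Lemma qroot_weight_continuous (E : R) : 0 < E -> continuous (qroot_weight E).
Proof.
move=> E0 t.
have cs : {for t, continuous (fun t : R => t * t)} by apply: continuousM; exact: cvg_id.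
have cq : {for t, continuous (qroot E)}.
  by have [/derivable1_diffP/differentiable_continuous] := is_derive_qroot0 t E0.
apply: continuousM => //; apply: continuousB; first exact: cst_continuous.
rewrite (_ : (fun x : R => _) = (fun x : R => x * x * (2 * (x * x + E))^-1)); last by apply/funext => x; rewrite expr2.
apply: continuousM => //; apply: continuousV.
  by rewrite gt_eqF// mulr_gt0// -expr2 sqrD_gt0.
apply: continuousM; first exact: cst_continuous.
by apply: continuousD => //; exact: cst_continuous.
Qed.

(** The primitive $t(t^2 + E)^{-1/4}$ has boundary values that stay bounded as [E] tends to 0. *)
Lemma int_qroot_weight (E : R) : 0 < E ->
  (\int[leb]_(t in `[(-1)%R, 1%R]) (qroot_weight E t)%:E <= (2 * qroot E 1)%:E)%E.
Proof.
move=> E0; have cF : continuous (fun t : R => t * qroot E t).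
  by move=> t; have [/derivable1_diffP/differentiable_continuous] := is_derive_qroot t E0.
rewrite (@continuous_FTC2 R (qroot_weight E) (fun t => t * qroot E t)).
- rewrite -EFinB lee_fin /qroot sqrrN; lra.
- by lra.
- by apply: continuous_subspaceT; exact: qroot_weight_continuous.
- split.
  + by move=> t _; case: (is_derive_qroot t E0).
  + by apply: cvg_at_right_filter; exact: cF.
  + by apply: cvg_at_left_filter; exact: cF.
- by move=> t _; rewrite derive1E; case: (is_derive_qroot t E0).
Qed.

(** From $b \le 8e^{b/8}$ the square of the barrier is at most $64e^{b/4}$, that is 64 times the
    fourth root of $(s + M)/s$. As $s \ge t^2 + E$ for either coordinate, the bound depends on one
    variable only, as [fourth_le_product] requires. *)
Lemma barrier_qroot (M E t : R) x : 0 < M -> 0 < E -> E <= 2 -> box 1 x -> t = x.1 \/ t = x.2 ->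
  barrier M E x ^+ 2 <= 64 * expR (4^-1 * ln (M + 4)) * qroot E t.
Proof.
move=> M0 E0 E2 [x1 x2] tx; pose s := x.1 ^+ 2 + x.2 ^+ 2 + E.
have sq1 (r : R) : `|r| <= 1 -> r ^+ 2 <= 1 by move=> h; rewrite -real_normK ?num_real// expr_le1.
have q1 := sq1 _ x1; have q2 := sq1 _ x2; have p1 := sqr_ge0 x.1; have p2 := sqr_ge0 x.2.
have ts : t ^+ 2 + E <= s by rewrite /s; case: tx => ->; lra.
have t0 := sqrD_gt0 t E0.
have s0 : 0 < s by apply: lt_le_trans ts.
have s4 : s <= 4 by rewrite /s; lra.
have bE : barrier M E x = ln (s + M) - ln s.
  by rewrite /barrier /s; congr (ln _ - ln _); ring.
have b0 := barrier_ge0 x M0 E0.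
have h1 : barrier M E x <= 8 * expR (8^-1 * barrier M E x).
  by have := expR_ge1Dx (8^-1 * barrier M E x); lra.
have h2 : barrier M E x ^+ 2 <= 64 * expR (4^-1 * barrier M E x).
  apply: (@le_trans _ _ ((8 * expR (8^-1 * barrier M E x)) ^+ 2)).
    by rewrite ler_sqr ?nnegrE// mulr_ge0// expR_ge0.
  rewrite exprMn -expRM_natl.
  have -> : (8 ^+ 2 : R) = 64 by ring.
  by have -> : 2%:R * (8^-1 * barrier M E x) = 4^-1 * barrier M E x by field.
apply: (le_trans h2); rewrite -mulrA ler_wpM2l// /qroot -expRD ler_expR bE.
have l1 : ln (s + M) <= ln (M + 4) by rewrite ler_ln ?posrE; lra.
have l2 : ln (t ^+ 2 + E) <= ln s by rewrite ler_ln ?posrE.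
lra.
Qed.

Variables (w : PT -> R) (l k : R).
Hypotheses (l0 : 0 < l) (k1 : `|k| <= 1) (lw : l2 w).
Hypothesis green : forall f, test_function f ->
  J (fun x => w x * (- laplacian f x + l * f x)) = k * f (0, 0).

Lemma cor_abs_le_barrier rho (A M E : R) : test_function rho -> 0 < A -> 0 < M -> 0 < E -> l * M = 4 ->
  (forall x, 0 <= rho x) ->
  (forall y, rho (- y) <= A * (4 * E / (y.1 ^+ 2 + y.2 ^+ 2 + E) ^+ 2)) ->
  forall y, `|cor w rho y| <= A * barrier M E y.
Proof.
move=> tr A0 M0 E0 lM r0 hr y; rewrite ler_norml lerNl; apply/andP; split; last first.
  exact: (cor_le_barrier l0 k1 lw green tr A0 M0 E0 lM r0 hr).
have lNw : l2 (fun x => - w x) by have := l2_scale (-1) lw; congr l2; apply/funext => x; rewrite mulN1r.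
have NE f : test_function f -> J (fun x => - w x * f x) = - J (fun x => w x * f x).
  move=> tf; rewrite -JN; last exact: l2_mul (test_l2 tf).
  by congr Rintegral; apply/funext => x; rewrite mulNr.
have -> : - cor w rho y = cor (fun x => - w x) rho y by rewrite /cor NE//; exact: test_trans.
apply: (@cor_le_barrier R (fun x => - w x) l (- k)) => //; first by rewrite normrN.
move=> f tf; rewrite NE ?green ?mulNr//; apply: test_add; last exact: test_scale.
exact/test_opp/test_laplacian.
Qed.

(** Inside the unit box the one-variable bounds of [barrier_qroot] apply. Outside it the barrier is
    at most [M], so two of the four powers are bounded by $(AM)^2$ and the $L^2$ norm controls the
    other two. *)
Lemma cor_fourth_le rho (A M E C : R) : test_function rho -> 0 < A -> 0 < M -> 0 < E -> E <= 2 ->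
  (forall x, 0 <= rho x) -> J rho = 1 ->
  C = A ^+ 2 * (64 * expR (4^-1 * ln (M + 4))) ->
  (forall y, `|cor w rho y| <= A * barrier M E y) ->
  sf (fun x => cor w rho x ^+ 4) /\
  J (fun x => cor w rho x ^+ 4) <= (4 * C) * (4 * C) + (A * M) ^+ 2 * J (fun x => w x ^+ 2).
Proof.
move=> tr A0 M0 E0 E2 r0 r1 CE hb.
have C0 : 0 <= C by rewrite CE mulr_ge0 ?sqr_ge0// mulr_ge0// expR_ge0.
have cW : continuous (cor w rho) by exact: cor_continuous.
have mW : measurable_fun [set: P] (cor w rho) by exact: continuous_measurable_plane.
pose U x := cor w rho x * \1_(box 1) x.
have mU : measurable_fun [set: P] U.
  by apply: measurable_funM => //; apply: measurable_indic; exact: measurable_box.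
pose D := `[(-1)%R, 1%R]%classic : set R.
pose B (t : R) := (if t \in D then (2 * C * qroot_weight E t)%:E else 0)%E.
have mD : measurable (D : set mR) by exact: measurable_itv.
have mq : measurable_fun [set: mR] (fun t => 2 * C * qroot_weight E t).
  by apply: measurable_funM => //; apply: continuous_measurable_fun; exact: qroot_weight_continuous.
have Bp : B = (fun t => (2 * C * qroot_weight E t)%:E) \_ D by [].
have mB : measurable_fun [set: mR] B.
  rewrite Bp; apply/(measurable_restrictT _ mD); apply/measurable_EFinP.
  exact: measurable_funS mq.
have qC0 (t : R) : 0 <= 2 * C * qroot_weight E t.
  by apply: mulr_ge0; [exact: mulr_ge0|exact: qroot_weight_ge0].
have B0 t : (0 <= B t)%E by rewrite /B; case: ifP => // _; rewrite lee_fin.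
have UB x t : t = x.1 \/ t = x.2 -> ((U x ^+ 2)%:E <= B t)%E.
  move=> tx; rewrite /U; have [bx|nbx] := pselect (box 1 x); last first.
    by rewrite indicE memNset// mulr0 expr0n.
  have tD : t \in D.
    rewrite inE /D /= in_itv/= -ler_norml; move: bx => [b1 b2].
    by case: tx => ->.
  rewrite /B tD indicE mem_set// mulr1 lee_fin.
  have h1 : cor w rho x ^+ 2 <= A ^+ 2 * barrier M E x ^+ 2.
    rewrite -[leLHS]real_normK ?num_real// -exprMn ler_sqr ?nnegrE// mulr_ge0 ?(ltW A0)//.
    exact: barrier_ge0.
  apply: (le_trans h1).
  have h2 := barrier_qroot M0 E0 E2 bx tx.
  have h3 := qroot_weight_ge t E0.
  apply: (@le_trans _ _ (C * qroot E t)).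
    by rewrite CE -[leRHS]mulrA ler_wpM2l ?sqr_ge0.
  by rewrite -mulrA mulrCA ler_wpM2l.
(* The integral is at most [2 * C] times [2 * qroot E 1], and [qroot E 1 <= 1]. *)
have iB : (\int[leb]_t B t <= (4 * C)%:E)%E.
  rewrite Bp -integral_mkcond.
  have q1 : qroot E 1 <= 1.
    rewrite /qroot -[leRHS]expR0 ler_expR.
    have : 0 <= ln (1 ^+ 2 + E) :> R by rewrite ln_ge0// expr1n; lra.
    lra.
  under eq_integral do rewrite EFinM.
  rewrite ge0_integralZl//.
  - apply: (@le_trans _ _ ((2 * C)%:E * (2 * qroot E 1)%:E)%E).
      by apply: lee_wpmul2l; [rewrite lee_fin mulr_ge0|exact: int_qroot_weight].
    rewrite -EFinM lee_fin; nra.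
  - apply/measurable_EFinP; apply: (@measurable_funS _ _ _ _ setT) => //.
    by apply: continuous_measurable_fun; exact: qroot_weight_continuous.
  - by move=> t _; rewrite lee_fin qroot_weight_ge0.
  - by rewrite lee_fin mulr_ge0.
have [s4 J4] := fourth_le_product mU mB mB B0 B0 (fun x => UB x _ (or_intror erefl))
  (fun x => UB x _ (or_introl erefl)) iB iB.
have [[_ sc2] Jc2] := cor_l2 tr r0 r1 lw.
have sS : sf (fun x => U x ^+ 4 + (A * M) ^+ 2 * cor w rho x ^+ 2) by apply: sfD => //; exact: sfZ.
have bd x : cor w rho x ^+ 4 <= U x ^+ 4 + (A * M) ^+ 2 * cor w rho x ^+ 2.
  have [bx|nbx] := pselect (box 1 x).
    by rewrite {1}/U indicE mem_set// mulr1 lerDl mulr_ge0// sqr_ge0.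
  rewrite {1}/U indicE memNset// mulr0 expr0n add0r (_ : 4 = (2 + 2))%N// exprD ler_wpM2r ?sqr_ge0//.
  rewrite -[leLHS]real_normK ?num_real// ler_sqr ?nnegrE ?mulr_ge0 ?(ltW A0) ?(ltW M0)//.
  apply: (le_trans (hb x)); rewrite ler_wpM2l ?(ltW A0)//.
  have s1 : 1 <= x.1 ^+ 2 + x.2 ^+ 2 + E.
    have h (r : R) : 1 < `|r| -> 1 < r ^+ 2 by move=> ?; rewrite -real_normK ?num_real// exprn_egt1.
    have p1 := sqr_ge0 x.1; have p2 := sqr_ge0 x.2.
    have [n1|/h] := leP `|x.1| 1; last lra.
    have [n2|/h] := leP `|x.2| 1; last lra.
    by case: nbx.
  rewrite barrierE//; apply: (@le_trans _ _ (M / (x.1 ^+ 2 + x.2 ^+ 2 + E))).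
    by apply: le_ln1Dx; rewrite (@lt_le_trans _ _ 0)// ?ltrN10// divr_ge0 ?(ltW M0)//; lra.
  by rewrite ler_pdivrMr ?ler_peMr ?(ltW M0)//; lra.
have m4 : measurable_fun [set: P] (fun x => cor w rho x ^+ 4) by exact: measurable_funX.
have c40 x : 0 <= cor w rho x ^+ 4 by rewrite (_ : 4 = (2 * 2))%N// exprM sqr_ge0.
have sc4 : sf (fun x => cor w rho x ^+ 4).
  by apply: (@sf_le _ P R mu _ (fun x => U x ^+ 4 + (A * M) ^+ 2 * cor w rho x ^+ 2)) => // x; rewrite ger0_norm.
split => //; apply: (le_trans (leJ sc4 sS bd)).
rewrite JD ?JZ//; last exact: sfZ.
by apply: lerD => //; rewrite ler_wpM2l ?sqr_ge0.
Qed.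

Lemma green_fourth : sf (fun x => w x ^+ 4).
Proof.
have [c c0 hc] := mollifier R.
pose M := 4 / l; have M0 : 0 < M by rewrite divr_gt0.
have lM : l * M = 4 by rewrite /M mulrC divfK ?gt_eqF.
(* [A] and [E] are matched to the kernel: on its support $r^2 \le 2/N^2 = E$, so the source term is
   at least $A \cdot 4E/(2E)^2 = A/E = cN^2$, the bound on the height. *)
pose A := 2 * c; have A0 : 0 < A by rewrite mulr_gt0.
apply: (sf_fourth_of_mollified (C := (4 * (A ^+ 2 * (64 * expR (4^-1 * ln (M + 4))))) * (4 * (A ^+ 2 * (64 * expR (4^-1 * ln (M + 4)))))
   + (A * M) ^+ 2 * J (fun x => w x ^+ 2)) lw) => n.
have [rho [tr r01 r1 sr]] := hc n.
have r0 x : 0 <= rho x by case/andP: (r01 x).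
pose N : R := n.+1%:R; have N1 : 1 <= N by rewrite ler1n.
pose E := 2 / N ^+ 2.
have N20 : 0 < N ^+ 2 by rewrite exprn_gt0//; lra.
have E0 : 0 < E by rewrite divr_gt0.
have E2 : E <= 2 by rewrite ler_pdivrMr// ler_peMr// expr_ge1//; lra.
have hr y : rho (- y) <= A * (4 * E / (y.1 ^+ 2 + y.2 ^+ 2 + E) ^+ 2).
  have s0 : 0 < y.1 ^+ 2 + y.2 ^+ 2 + E by rewrite ltr_wpDl// addr_ge0// sqr_ge0.
  have [by_|nby] := pselect (box N^-1 (- y)); last first.
    by rewrite sr// mulr_ge0 ?(ltW A0)// divr_ge0 ?sqr_ge0// mulr_ge0// ltW.
  have sE : y.1 ^+ 2 + y.2 ^+ 2 + E <= 2 * E.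
    move: by_ => [/=]; rewrite !normrN => b1 b2.
    have h (r : R) : `|r| <= N^-1 -> r ^+ 2 <= (N ^+ 2)^-1.
      by move=> ?; rewrite -real_normK ?num_real// -exprVn ler_sqr ?nnegrE// invr_ge0; lra.
    have := h _ b1; have := h _ b2; rewrite /E; move: (y.1 ^+ 2) (y.2 ^+ 2) (N ^- 2) => p q r; lra.
  case/andP: (r01 (- y)) => _ /le_trans; apply.
  have -> : c * n.+1%:R ^+ 2 = A * (4 * E / (2 * E) ^+ 2).
    by rewrite /A /E -/N; field; rewrite gt_eqF//; lra.
  apply: ler_wpM2l; first exact: ltW.
  apply: ler_wpM2l; first by apply: mulr_ge0 => //; exact: ltW.
  have E20 : 0 < 2 * E by rewrite mulr_gt0.
  rewrite lef_pV2 ?posrE; [|exact: exprn_gt0|exact: exprn_gt0].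
  by rewrite ler_sqr ?nnegrE; [|exact: ltW|exact: ltW].
have hb := cor_abs_le_barrier tr A0 M0 E0 lM r0 hr.
have [s4 h4] := cor_fourth_le tr A0 M0 E0 E2 r0 r1 erefl hb.
by exists rho.
Qed.

End GreenFourth.

(** * Complex-valued functions *)

Section ComplexLayer.
Variable R : realType.
Local Open Scope complex_scope.
Local Notation PT := (R * R)%type.
Local Notation P := (measurableTypeR R * measurableTypeR R)%type.
Local Notation mu := (@leb2 R).
Local Notation sf := (summable_fun mu).
Local Notation J := (Rintegral mu setT).
Implicit Types (f h w : PT -> R) (u v g : PT -> R[i]) (x y e : PT) (z c : R[i]).

Definition nsq z : R := complex.Re z ^+ 2 + complex.Im z ^+ 2.
Definition rp u : PT -> R := fun x => complex.Re (u x).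
Definition ip u : PT -> R := fun x => complex.Im (u x).

Lemma normc_sqr z : normc z ^+ 2 = nsq z.
Proof. by case: z => a b; rewrite /normc sqr_sqrtr// addr_ge0 ?sqr_ge0. Qed.

Lemma normc_ge0 z : 0 <= normc z.
Proof. by case: z => a b; rewrite /normc sqrtr_ge0. Qed.

Lemma nsq_ge0 z : 0 <= nsq z. Proof. by rewrite addr_ge0 ?sqr_ge0. Qed.

Lemma nsqM z z' : nsq (z * z') = nsq z * nsq z'.
Proof. by rewrite -!normc_sqr normcM exprMn. Qed.

Lemma nsq_eq0 z : nsq z = 0 -> z = 0.
Proof. by rewrite -normc_sqr => /eqP; rewrite sqrf_eq0 => /eqP /eq0_normc. Qed.

Lemma nsq0 : nsq 0 = 0. Proof. by rewrite /nsq/= expr0n addr0. Qed.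

Lemma nsq_real (r : R) : nsq r%:C = r ^+ 2. Proof. by rewrite /nsq/= expr0n addr0. Qed.

Lemma Lnorm_normc n u : (0 < n)%N ->
  ('N[mu]_(n%:R%:E)[ (fun x => (normc (u x))%:E) ] `^ n%:R = \int[mu]_x (normc (u x) ^+ n)%:E)%E.
Proof.
move=> n0; rewrite poweR_Lnorm ?pnatr_eq0 -?lt0n//; apply: eq_integral => x _.
by rewrite /= ger0_norm ?normc_ge0// powR_mulrn ?normc_ge0.
Qed.

(** No integrability is assumed: if the norm is infinite, both sides are 0 through [fine]. *)
Lemma cnormE n u : (0 < n)%N -> cnorm n%:R u ^+ n = J (fun x => normc (u x) ^+ n).
Proof.
move=> n0; have nR : (n%:R : R) != 0 by rewrite pnatr_eq0 -lt0n.
have := Lnorm_normc u n0; rewrite /cnorm /Rintegral.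
have := Lnorm_ge0 mu n%:R%:E (fun x => (normc (u x))%:E).
case: (Lnorm _ _ _) => [r|_|//]; last first.
  by rewrite poweRyr// => <-; rewrite /= expr0n eqn0Ngt n0.
by rewrite lee_fin => r0 <-; rewrite poweR_EFin/= powR_mulrn.
Qed.

Lemma cnorm2E u : cnorm 2 u ^+ 2 = J (fun x => nsq (u x)).
Proof. by rewrite (@cnormE 2)//; congr Rintegral; apply/funext => x; rewrite normc_sqr. Qed.

Lemma cnorm4E u : cnorm 4 u ^+ 4 = J (fun x => nsq (u x) ^+ 2).
Proof.
rewrite (@cnormE 4)//; congr Rintegral; apply/funext => x.
by rewrite -normc_sqr -exprM.
Qed.

Lemma couplingE u v : coupling u v = J (fun x => nsq (u x) * nsq (v x)).
Proof. by congr Rintegral; apply/funext => x; rewrite normc_sqr nsqM. Qed.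

Lemma L2P u : L2 u <-> l2 (rp u) /\ l2 (ip u).
Proof.
have S : (\int[mu]_x (normc (u x) ^+ 2)%:E = \int[mu]_x (nsq (u x))%:E)%E.
  by apply: eq_integral => x _; rewrite normc_sqr.
have := @Lnorm_normc 2 u erefl; rewrite S => N.
have Nge := Lnorm_ge0 mu 2%:E (fun x => (normc (u x))%:E).
split.
  move=> [[mr mi] fin].
  have m2 : measurable_fun [set: P] (fun x => nsq (u x)) by apply: measurable_funD; exact: measurable_funX.
  have s : sf (fun x => nsq (u x)).
    apply/ge0_sfP => //; first by move=> x; exact: nsq_ge0.
    by rewrite -N; apply: poweR_lty.
  split; split => //; apply: (@sf_le _ P R mu _ (fun x => nsq (u x))) => //.
  - exact: measurable_funX.
  - by move=> x; rewrite ger0_norm ?sqr_ge0// lerDl sqr_ge0.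
  - exact: measurable_funX.
  - by move=> x; rewrite ger0_norm ?sqr_ge0// lerDr sqr_ge0.
move=> [[mr sr] [mi si]]; split; first by split.
have s : sf (fun x => nsq (u x)) by exact: sfD.
move/ge0_sfP : (s) => /(_ (sf_meas s) (fun x => nsq_ge0 (u x))).
have key (r : \bar R) : (0 <= r -> r `^ 2 < +oo -> r < +oo)%E.
  by case: r => [r _ _|_|//]; [exact: ltry|rewrite poweRyr ?pnatr_eq0].
by rewrite -N => hN; exact: (key _ Nge hN).
Qed.

Lemma sf_nsq u : L2 u -> sf (fun x => nsq (u x)).
Proof. by move=> /L2P[[_ h1] [_ h2]]; exact: sfD. Qed.

Lemma L2_meas_nsq u : L2 u -> measurable_fun [set: P] (fun x => nsq (u x)).
Proof. by move=> h; exact: sf_meas (sf_nsq h). Qed.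

Lemma rpD u v : rp (fun x => u x + v x) = (fun x => rp u x + rp v x).
Proof. by apply/funext => x; rewrite /rp; case: (u x) (v x) => ? ? [? ?]. Qed.
Lemma ipD u v : ip (fun x => u x + v x) = (fun x => ip u x + ip v x).
Proof. by apply/funext => x; rewrite /ip; case: (u x) (v x) => ? ? [? ?]. Qed.
Lemma rpZ c u : rp (fun x => c * u x) = (fun x => complex.Re c * rp u x + - complex.Im c * ip u x).
Proof. by apply/funext => x; rewrite /rp /ip; case: c (u x) => ? ? [? ?] /=; rewrite mulNr. Qed.
Lemma ipZ c u : ip (fun x => c * u x) = (fun x => complex.Re c * ip u x + complex.Im c * rp u x).
Proof. by apply/funext => x; rewrite /rp /ip; case: c (u x) => ? ? [? ?]. Qed.

Lemma L2_add u v : L2 u -> L2 v -> L2 (fun x => u x + v x).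
Proof.
by move=> /L2P[? ?] /L2P[? ?]; apply/L2P; rewrite rpD ipD; split; exact: l2_add.
Qed.

Lemma L2_scale c u : L2 u -> L2 (fun x => c * u x).
Proof.
by move=> /L2P[? ?]; apply/L2P; rewrite rpZ ipZ; split; apply: l2_add; exact: l2_scale.
Qed.

Lemma L2_0 : L2 (cst 0 : PT -> R[i]).
Proof.
have h : l2 (fun _ : PT => 0 : R) by exact: test_l2 (test0 R).
by apply/L2P; split; exact: h.
Qed.

Lemma weak_derivativeP e u g : is_weak_derivative e u g <-> wderiv e (rp u) (rp g) /\ wderiv e (ip u) (ip g).
Proof.
have E v f : (cintegral (fun x => v x * (f x)%:C)) = (J (fun x => rp v x * f x)) +i* (J (fun x => ip v x * f x)).
  rewrite /cintegral; congr (_ +i* _); congr Rintegral; apply/funext => x; rewrite /rp /ip; case: (v x) => a b /=;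
    by rewrite mulr0 ?subr0 ?add0r.
split.
  by move=> h; split => f tf; have := h f tf; rewrite !E => -[].
by move=> [h1 h2] f tf; rewrite !E h1// h2.
Qed.

Lemma greenP l g : is_green l g -> [/\ L2 g,
  forall f, test_function f -> J (fun x => rp g x * (- laplacian f x + l * f x)) = f (0, 0) &
  forall f, test_function f -> J (fun x => ip g x * (- laplacian f x + l * f x)) = 0].
Proof.
move=> [Lg h]; split => // f tf; have := h f tf; rewrite /cintegral => -[].
  move=> h1 _; rewrite -h1; congr Rintegral; apply/funext => x; rewrite /rp; case: (g x) => a b /=; ring.
move=> _ h1; rewrite -[RHS]h1; congr Rintegral; apply/funext => x; rewrite /ip; case: (g x) => a b /=; ring.
Qed.

(** The class in which all quartic and coupling integrals converge; it contains [H1] and the Green's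
    functions. *)
Definition L24 u := L2 u /\ sf (fun x => nsq (u x) ^+ 2).

Lemma L24_intro u : L2 u -> sf (fun x => rp u x ^+ 4) -> sf (fun x => ip u x ^+ 4) -> L24 u.
Proof.
move=> Lu h1 h2; split => //.
apply: (@sf_le _ P R mu _ (fun x => 2 * (rp u x ^+ 4 + ip u x ^+ 4))).
- by apply: measurable_funX; exact: L2_meas_nsq.
- move=> x; rewrite ger0_norm ?sqr_ge0// /nsq -/(rp u x) -/(ip u x).
  have : 0 <= (rp u x ^+ 2 - ip u x ^+ 2) ^+ 2 by rewrite sqr_ge0.
  by move: (rp u x) (ip u x) => a b; rewrite (_ : 4 = (2 * 2))%N// !exprM; lra.
- by apply: sfZ; exact: sfD.
Qed.

Lemma L24_add u v : L24 u -> L24 v -> L24 (fun x => u x + v x).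
Proof.
move=> [Lu u4] [Lv v4]; have L := L2_add Lu Lv; split => //.
apply: (@sf_le _ P R mu _ (fun x => 8 * (nsq (u x) ^+ 2 + nsq (v x) ^+ 2))).
- by apply: measurable_funX; exact: L2_meas_nsq.
- move=> x; rewrite ger0_norm ?sqr_ge0//.
  have : nsq (u x + v x) <= 2 * (nsq (u x) + nsq (v x)).
    have A (a b : R) : (a + b) ^+ 2 <= 2 * (a ^+ 2 + b ^+ 2) by have := sqr_ge0 (a - b); lra.
    by rewrite /nsq; case: (u x) (v x) => a b [a' b'] /=; have := A a a'; have := A b b'; lra.
  have := nsq_ge0 (u x + v x); have := nsq_ge0 (u x); have := nsq_ge0 (v x).
  move: (nsq (u x + v x)) (nsq (u x)) (nsq (v x)) => a b c c0 b0 a0 h.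
  have : a ^+ 2 <= (2 * (b + c)) ^+ 2 by rewrite ler_sqr ?nnegrE// mulr_ge0// addr_ge0.
  have := sqr_ge0 (b - c); lra.
- by apply: sfZ; exact: sfD.
Qed.

Lemma L24_scale c u : L24 u -> L24 (fun x => c * u x).
Proof.
move=> [Lu u4]; split; first exact: L2_scale.
have := sfZ (nsq c ^+ 2) u4; congr (summable_fun mu _); apply/funext => x.
by rewrite nsqM exprMn.
Qed.

Lemma sf_nsqM u v : L24 u -> L24 v -> sf (fun x => nsq (u x) * nsq (v x)).
Proof.
move=> [Lu u4] [Lv v4]; apply: l2_mul; split => //; exact: L2_meas_nsq.
Qed.

Lemma H1_L24 u : H1 u -> L24 u.
Proof.
move=> [Lu [g1 [Lg1 /weak_derivativeP[a1 b1]]] [g2 [Lg2 /weak_derivativeP[a2 b2]]]].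
have [lr li] := (L2P u).1 Lu; have [lr1 li1] := (L2P g1).1 Lg1; have [lr2 li2] := (L2P g2).1 Lg2.
by apply: L24_intro => //; [exact: (weak_ladyzhenskaya lr lr1 lr2)|exact: (weak_ladyzhenskaya li li1 li2)].
Qed.

Lemma green_L24 l g : 0 < l -> is_green l g -> L24 g.
Proof.
move=> l0 /greenP[Lg h1 h2]; have [lr li] := (L2P g).1 Lg.
apply: L24_intro => //.
  by apply: (@green_fourth R _ l 1) => //; [rewrite normr1|move=> f tf; rewrite h1// mul1r].
by apply: (@green_fourth R _ l 0) => //; [rewrite normr0|move=> f tf; rewrite h2// mul0r].
Qed.

Lemma wderiv_unique e w f f' : l2 f -> l2 f' -> wderiv e w f -> wderiv e w f' ->
  {ae mu, forall x, f x = f' x}.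
Proof.
move=> lg lg' d d'.
have [] := @test_orthogonal R (fun x => f x - f' x) (l2_locsum (l2_sub lg lg')) _.
  move=> h tf; have -> : (fun x => (f x - f' x) * h x) = (fun x => f x * h x - f' x * h x).
    by apply/funext => x; rewrite mulrBl.
  rewrite JB; [|exact: l2_mul (test_l2 tf)..].
  by apply/eqP; rewrite subr_eq0 -(inj_eq oppr_inj) -d// -d'.
move=> N [mN N0 hN]; exists N; split => // x /= nx; apply: hN => /=.
by move=> /eqP; rewrite subr_eq0 => /eqP.
Qed.

(** [weak_derivative] is selected by [xget]; almost everywhere uniqueness makes its norm equal to
    that of any other representative. *)
Lemma J_weak_derivative e u g : L2 g -> is_weak_derivative e u g ->
  cnorm 2 (weak_derivative e u) ^+ 2 = J (fun x => nsq (g x)).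
Proof.
move=> Lg dg; rewrite cnorm2E.
have [LD dD] : L2 (weak_derivative e u) /\ is_weak_derivative e u (weak_derivative e u).
  by apply: (@xgetPex _ _ [set g | L2 g /\ is_weak_derivative e u g]); exists g.
have [rD iD] := (L2P _).1 LD; have [rg ig] := (L2P _).1 Lg.
have [dDr dDi] := (weak_derivativeP _ _ _).1 dD; have [dgr dgi] := (weak_derivativeP _ _ _).1 dg.
apply: eq_ae_J; [exact: L2_meas_nsq|exact: L2_meas_nsq|].
apply: ae_impl2 (wderiv_unique rD rg dDr dgr) (wderiv_unique iD ig dDi dgi) => x.
by rewrite /rp /ip /nsq => -> ->.
Qed.

Lemma dirichletE u g1 g2 : L2 g1 -> L2 g2 -> is_weak_derivative (e1 R) u g1 -> is_weak_derivative (e2 R) u g2 ->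
  dirichlet u = J (fun x => nsq (g1 x)) + J (fun x => nsq (g2 x)).
Proof.
by move=> L1 L2' d1 d2; exact: (congr2 +%R (J_weak_derivative L1 d1) (J_weak_derivative L2' d2)).
Qed.

Lemma wderiv_comb e w w' h h' (a b : R) : axis e -> l2 w -> l2 w' -> l2 h -> l2 h' ->
  wderiv e w h -> wderiv e w' h' ->
  wderiv e (fun x => a * w x + b * w' x) (fun x => a * h x + b * h' x).
Proof.
move=> he lw lw' lg lg' d d' f tf.
have E k k' q : l2 k -> l2 k' -> test_function q ->
    J (fun x => (a * k x + b * k' x) * q x) = a * J (fun x => k x * q x) + b * J (fun x => k' x * q x).
  move=> lk lk' th; have s := l2_mul lk (test_l2 th); have s' := l2_mul lk' (test_l2 th).
  rewrite -!JZ// -JD; [|exact: sfZ..].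
  by congr Rintegral; apply/funext => x; ring.
by rewrite !E ?d ?d' ?mulrN ?opprD//; exact: test_derive.
Qed.

Lemma is_weak_derivative_comb e u v g g' c : axis e -> L2 u -> L2 v -> L2 g -> L2 g' ->
  is_weak_derivative e u g -> is_weak_derivative e v g' ->
  is_weak_derivative e (fun x => u x + c * v x) (fun x => g x + c * g' x).
Proof.
move=> he /L2P[ru iu] /L2P[rv iv] /L2P[rg ig] /L2P[rh ih] /weak_derivativeP[a1 b1] /weak_derivativeP[a2 b2].
apply/weak_derivativeP; rewrite !rpD !ipD !rpZ !ipZ; split.
- have d := wderiv_comb (complex.Re c) (- complex.Im c) he rv iv rh ih a2 b2.
  have := wderiv_comb 1 1 he ru (l2_add (l2_scale _ rv) (l2_scale _ iv)) rg (l2_add (l2_scale _ rh) (l2_scale _ ih)) a1 d.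
  by congr wderiv; apply/funext => x; rewrite !mul1r.
- have d := wderiv_comb (complex.Re c) (complex.Im c) he iv rv ih rh b2 a2.
  have := wderiv_comb 1 1 he iu (l2_add (l2_scale _ iv) (l2_scale _ rv)) ig (l2_add (l2_scale _ ih) (l2_scale _ rh)) b1 d.
  by congr wderiv; apply/funext => x; rewrite !mul1r.
Qed.

Lemma is_weak_derivative0 e : axis e -> is_weak_derivative e (cst 0 : PT -> R[i]) (cst 0).
Proof.
move=> he; have D : wderiv e (fun _ : PT => 0 : R) (fun _ => 0).
  move=> f tf; under [LHS]eq_Rintegral do rewrite mul0r.
  by under [in RHS]eq_Rintegral do rewrite mul0r; rewrite !J0 oppr0.
by apply/weak_derivativeP; split; exact: D.
Qed.

Lemma is_weak_derivative_scale e u g c : axis e -> L2 u -> L2 g -> is_weak_derivative e u g ->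
  is_weak_derivative e (fun x => c * u x) (fun x => c * g x).
Proof.
move=> he Lu Lg d.
have := is_weak_derivative_comb c he L2_0 Lu L2_0 Lg (is_weak_derivative0 he) d.
by congr is_weak_derivative; apply/funext => x; rewrite add0r.
Qed.

Lemma H1_comb u v c : H1 u -> H1 v -> H1 (fun x => u x + c * v x).
Proof.
move=> [Lu [g1 [Lg1 d1]] [g2 [Lg2 d2]]] [Lv [h1 [Lh1 k1]] [h2 [Lh2 k2]]].
have a1 : axis (e1 R) by left. have a2 : axis (e2 R) by right.
split; first by apply: L2_add => //; exact: L2_scale.
- exists (fun x => g1 x + c * h1 x); split; first by apply: L2_add => //; exact: L2_scale.
  exact: is_weak_derivative_comb.
- exists (fun x => g2 x + c * h2 x); split; first by apply: L2_add => //; exact: L2_scale.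
  exact: is_weak_derivative_comb.
Qed.

Lemma H1_0 : H1 (cst 0 : PT -> R[i]).
Proof.
have a1 : axis (e1 R) by left. have a2 : axis (e2 R) by right.
have L := L2_0.
by split => //; exists (cst 0); split => //; apply: is_weak_derivative0.
Qed.

Lemma H1_scale u c : H1 u -> H1 (fun x => c * u x).
Proof.
move=> h; have := H1_comb c H1_0 h; congr H1; apply/funext => x; exact: add0r.
Qed.

(* If [u] has no weak derivative, both sides vanish. *)
Lemma weak_derivative_scale e u (t : R) : axis e -> t != 0 -> L2 u ->
  cnorm 2 (weak_derivative e (fun x => t%:C * u x)) ^+ 2 = t ^+ 2 * cnorm 2 (weak_derivative e u) ^+ 2.
Proof.
move=> he t0 Lu; have tC : (t%:C : R[i]) != 0 by rewrite eq_complex /= negb_and t0.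
have [[g [Lg dg]]|no] := pselect (exists g, L2 g /\ is_weak_derivative e u g).
  rewrite (J_weak_derivative Lg dg).
  rewrite (J_weak_derivative (L2_scale t%:C Lg) (is_weak_derivative_scale t%:C he Lu Lg dg)).
  rewrite -JZ; last exact: sf_nsq.
  by congr Rintegral; apply/funext => x; rewrite nsqM nsq_real.
rewrite /weak_derivative !xgetPN.
- by rewrite cnorm2E /= nsq0 J0 mulr0.
- by move=> g [Lg dg]; apply: no; exists g.
- move=> g [Lg dg]; apply: no; exists (fun x => t%:C^-1 * g x); split; first exact: L2_scale.
  have := is_weak_derivative_scale t%:C^-1 he (L2_scale t%:C Lu) Lg dg.
  by congr is_weak_derivative; apply/funext => x; rewrite mulrA mulVf// mul1r.
Qed.

Lemma dirichlet_scale u (t : R) : t != 0 -> L2 u ->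
  dirichlet (fun x => t%:C * u x) = t ^+ 2 * dirichlet u.
Proof.
move=> t0 Lu; rewrite /dirichlet mulrDr.
have a1 : axis (e1 R) by left. have a2 : axis (e2 R) by right.
exact: (congr2 +%R (weak_derivative_scale a1 t0 Lu) (weak_derivative_scale a2 t0 Lu)).
Qed.

Lemma dirichlet_ge0 u : 0 <= dirichlet u.
Proof. by rewrite addr_ge0 ?sqr_ge0. Qed.

Lemma ae_zeroP u : L2 u -> ae_zero u <-> J (fun x => nsq (u x)) = 0.
Proof.
move=> Lu; split => h.
  rewrite -[RHS](@J0 _ P R mu); apply: eq_ae_J; [exact: L2_meas_nsq|exact: measurable_cst|].
  by apply: (@ae_impl _ _ _ mu _ _ _ h) => x ->; exact: nsq0.
have := J_eq0_ae (sf_nsq Lu) (fun x => nsq_ge0 (u x)) h.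
by apply: ae_impl => x; exact: nsq_eq0.
Qed.

End ComplexLayer.

(** * Reflection and uniqueness of the charge *)

Section Flip.
Variable R : realType.
Local Open Scope complex_scope.
Local Notation PT := (R * R)%type.
Local Notation P := (measurableTypeR R * measurableTypeR R)%type.
Local Notation mu := (@leb2 R).
Local Notation sf := (summable_fun mu).
Local Notation J := (Rintegral mu setT).
Implicit Types (f h w : PT -> R) (u v g : PT -> R[i]) (x y e : PT) (z : PT) (c : R[i]).

Definition reflect T (z : PT) (u : PT -> T) : PT -> T := fun x => u (flip z x).

Lemma flipE z x : flip z x = z + (-1 : R) *: x.
Proof. by case: z x => a b [a' b']; rewrite /flip /= scaleN1r. Qed.

Lemma flipK z x : flip z (flip z x) = x.
Proof. by case: z x => a b [a' b']; rewrite /flip /=; congr pair; ring. Qed.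

Lemma reflectE f z : reflect z f = fun x => f (z + (-1 : R) *: x).
Proof. by apply/funext => x; rewrite /reflect flipE. Qed.

Lemma test_reflect f z : test_function f -> test_function (reflect z f).
Proof. by move=> tf; rewrite reflectE; apply: test_affine => //; rewrite oppr_eq0 oner_eq0. Qed.

Lemma derive_reflect f z e : axis e -> test_function f ->
  'D_e (reflect z f) = fun x => - 'D_e f (flip z x).
Proof.
move=> he tf; rewrite reflectE; apply/funext => x.
have := @derive_affine R f z (-1) e x (smooth_derivable he (test_smooth tf)).
by move=> [_ ->]; rewrite mulN1r flipE.
Qed.

Lemma l2_reflect w z : l2 w -> l2 (reflect z w).
Proof. by move=> [mw sw]; split; [exact: meas_flip|exact: (sf_flip z sw)]. Qed.

Lemma J_reflect_mul w f z : l2 w -> test_function f ->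
  J (fun x => reflect z w x * f x) = J (fun x => w x * f (flip z x)).
Proof.
move=> lw tf; rewrite -[RHS](J_flip z); last exact: l2_mul (test_l2 (test_reflect z tf)).
by congr Rintegral; apply/funext => x; rewrite flipK.
Qed.

Lemma wderiv_reflect e w h z : axis e -> l2 w -> l2 h -> wderiv e w h ->
  wderiv e (reflect z w) (fun x => - reflect z h x).
Proof.
move=> he lw lh d f tf; rewrite J_reflect_mul//; last exact: test_derive.
have tr := test_reflect z tf.
have -> : (fun x => w x * 'D_e f (flip z x)) = (fun x => - (w x * 'D_e (reflect z f) x)).
  apply/funext => x; have Dx : 'D_e (reflect z f) x = - 'D_e f (flip z x) := congr1 (@^~ x) (derive_reflect z he tf).
  by rewrite Dx mulrN opprK.
have -> : (fun x => - reflect z h x * f x) = (fun x => - (reflect z h x * f x)).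
  by apply/funext => x; rewrite mulNr.
rewrite !JN; [|exact: l2_mul (l2_reflect z lh) (test_l2 tf)|exact: l2_mul (test_l2 (test_derive he tr))].
by rewrite d// J_reflect_mul.
Qed.

Lemma L2_reflect u z : L2 u -> L2 (reflect z u).
Proof. by move=> /L2P[h1 h2]; apply/L2P; split; [exact: (l2_reflect z h1)|exact: (l2_reflect z h2)]. Qed.

Lemma L24_reflect u z : L24 u -> L24 (reflect z u).
Proof. by move=> [Lu su]; split; [exact: L2_reflect|exact: (sf_flip z su)]. Qed.

Lemma J_reflect f z : sf f -> J (reflect z f) = J f.
Proof. exact: J_flip. Qed.

Lemma is_weak_derivative_reflect e u g z : axis e -> L2 u -> L2 g -> is_weak_derivative e u g ->
  is_weak_derivative e (reflect z u) (fun x => -1 * reflect z g x).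
Proof.
move=> he /L2P[lr li] /L2P[gr gi] /weak_derivativeP[d1 d2]; apply/weak_derivativeP; split.
- have := wderiv_reflect z he lr gr d1; congr wderiv; apply/funext => x.
  by rewrite /rp /reflect mulN1r; case: (g _).
- have := wderiv_reflect z he li gi d2; congr wderiv; apply/funext => x.
  by rewrite /ip /reflect mulN1r; case: (g _).
Qed.

Lemma H1_reflect u z : H1 u -> H1 (reflect z u) /\ dirichlet (reflect z u) = dirichlet u.
Proof.
move=> [Lu [g1 [Lg1 d1]] [g2 [Lg2 d2]]].
have a1 : axis (e1 R) by left. have a2 : axis (e2 R) by right.
have k1 := is_weak_derivative_reflect z a1 Lu Lg1 d1.
have k2 := is_weak_derivative_reflect z a2 Lu Lg2 d2.
have L1 : L2 (fun x => -1 * reflect z g1 x) by apply: L2_scale; exact: L2_reflect.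
have L2' : L2 (fun x => -1 * reflect z g2 x) by apply: L2_scale; exact: L2_reflect.
have N g : (fun x => nsq (-1 * reflect z g x)) = reflect z (fun x => nsq (g x)).
  by apply/funext => x; rewrite nsqM /nsq/= oppr0 sqrrN expr1n expr0n addr0 mul1r.
split; first by split; [exact: L2_reflect|exists (fun x => -1 * reflect z g1 x)|exists (fun x => -1 * reflect z g2 x)].
rewrite (dirichletE L1 L2' k1 k2) (dirichletE Lg1 Lg2 d1 d2) !N.
exact: (congr2 +%R (J_reflect z (sf_nsq Lg1)) (J_reflect z (sf_nsq Lg2))).
Qed.

End Flip.

(** * Uniqueness of the charge *)

Section ChargeUnique.
Variable R : realType.
Local Open Scope complex_scope.
Local Notation PT := (R * R)%type.
Local Notation P := (measurableTypeR R * measurableTypeR R)%type.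
Local Notation mu := (@leb2 R).
Local Notation sf := (summable_fun mu).
Local Notation J := (Rintegral mu setT).
Implicit Types (f h w p m : PT -> R) (u v g : PT -> R[i]) (x y e : PT) (c q : R[i]).

(** The indicators decrease to that of [box 0], a single point and hence a null set. *)
Lemma cvg_J_shrinking_box p (M : R) : 0 <= M -> l2 p ->
  J (fun x => p x ^+ 2 * \1_(box (M / n.+1%:R)) x) @[n --> \oo] --> (0 : R).
Proof.
move=> M0 [mp sp].
have ni (n : nat) : 0 <= M / n.+1%:R :> R by rewrite divr_ge0.
have mb (r : R) : measurable_fun [set: P] (fun x => p x ^+ 2 * \1_(box r) x).
  by apply: measurable_funM; [exact: measurable_funX|apply: measurable_indic; exact: measurable_box].
have := @dominated_J _ P R mu (fun n x => p x ^+ 2 * \1_(box (M / n.+1%:R)) x)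
  (fun x => p x ^+ 2 * \1_(box 0) x) (fun x => p x ^+ 2).
case.
- by move=> n; exact: mb.
- exact: mb.
- exact: sp.
- move=> n x; rewrite normrM ger0_norm ?sqr_ge0// ler_piMr ?sqr_ge0// indicE.
  by case: (_ \in _); rewrite ?normr1 ?normr0.
- move=> x; have [b0|nb] := pselect (box 0 x).
    rewrite indicE mem_set// (_ : (fun n : nat => _) = fun=> p x ^+ 2 * 1); first exact: cvg_cst.
    apply/funext => n; rewrite indicE mem_set//; exact: le_box b0.
  rewrite [X in _ --> X](_ : _ = 0); last by rewrite indicE memNset// mulr0.
  have x0 : 0 < `|x|.
    by rewrite lt_neqAle normr_ge0 andbT eq_sym; apply/negP => /eqP E; apply: nb; apply/box_norm; rewrite E.
  apply: cvg_near_cst.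
  have [k hk] : exists k : nat, M / `|x| < k%:R.
    by exists (Num.Def.archi_bound (M / `|x|)); rewrite archi_boundP// divr_ge0.
  near=> n; rewrite indicE memNset ?mulr0// => /box_norm.
  rewrite leNgt => /negP; apply; rewrite ltr_pdivrMr ?ltr0n// mulrC -ltr_pdivrMr//.
  apply: (lt_trans hk); rewrite ltr_nat ltnS.
  by near: n; exact: nbhs_infty_ge.
move=> _; suff -> : J (fun x => p x ^+ 2 * \1_(box 0) x) = 0 by [].
rewrite -[RHS](@J0 _ P R mu); apply: eq_ae_J; [exact: mb|exact: measurable_cst|].
have : {ae mu, forall x, \1_(box 0) x = 0 :> R}.
  apply: J_eq0_ae; first exact: sf_box.
    by move=> x; rewrite indicE ler0n.
  by rewrite J_box// mulr0 expr0n.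
by apply: ae_impl => x ->; rewrite mulr0.
Unshelve. all: by end_near.
Qed.

(** In dimension two, height of order [n] on a box of side of order [1/n] keeps the $L^2$ norm of
    [h n] bounded, while the mass of [p] on that box tends to 0. *)
Lemma cvg_J_concentrated p (h : nat -> PT -> R) (C M : R) : 0 < C -> 0 <= M -> l2 p ->
  (forall n, test_function (h n)) ->
  (forall n x, `|h n x| <= C * n.+1%:R * \1_(box (M / n.+1%:R)) x) ->
  J (fun x => p x * h n x) @[n --> \oo] --> (0 : R).
Proof.
move=> C0 M0 lp th hb; apply/cvgrPdist_le => d d0.
(* A weight for Young's inequality: [t] times the bound $C^2(2M)^2$ on the squared norm of [h n] is
   at most [d]. *)
pose t : R := d / (C ^+ 2 * (2 * M) ^+ 2 + 1).
have D0 : 0 < C ^+ 2 * (2 * M) ^+ 2 + 1 by rewrite ltr_pwDr// mulr_ge0 ?sqr_ge0.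
have t0 : 0 < t by rewrite divr_gt0.
have td : t * (C ^+ 2 * (2 * M) ^+ 2) <= d.
  by rewrite /t mulrAC ler_pdivrMr// ler_pM2l// lerDl.
have /cvgrPdist_le/(_ _ (mulr_gt0 t0 d0)) := cvg_J_shrinking_box M0 lp.
apply: filterS => n; rewrite !sub0r !normrN; set N : R := n.+1%:R; set B := \1_(box (M / N)).
set A := J (fun x => p x ^+ 2 * B x) => hA.
have N0 : 0 < N by rewrite ltr0n.
have sB : sf B by apply: sf_box; rewrite divr_ge0// ltW.
have B2 x : B x ^+ 2 = B x by rewrite /B indicE; case: (_ \in _); rewrite ?expr1n ?expr0n.
have sA : sf (fun x => p x ^+ 2 * B x).
  apply: (@sf_le _ P R mu _ (fun x => p x ^+ 2)); [|move=> x|by case: lp].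
    by apply: measurable_funM; [apply: measurable_funX; case: lp|exact: sf_meas sB].
  rewrite normrM ger0_norm ?sqr_ge0// ler_piMr ?sqr_ge0// /B indicE.
  by case: (_ \in _); rewrite ?normr1 ?normr0.
have bd x : `|p x * h n x| <= 2^-1 * (t^-1 * (p x ^+ 2 * B x) + t * (C * N) ^+ 2 * B x).
  have : `|p x * h n x| <= `|p x * B x * (C * N * B x)|.
    have -> : p x * B x * (C * N * B x) = p x * (C * N * B x) by rewrite -[in RHS]B2; ring.
    rewrite !normrM ler_wpM2l// (le_trans (hb n x))// -/N -/B -!normrM; exact: ler_norm.
  move/le_trans; apply; apply: (le_trans (amgm _ _ t0)).
  by rewrite !exprMn B2 !mulrA.
have sR : sf (fun x => 2^-1 * (t^-1 * (p x ^+ 2 * B x) + t * (C * N) ^+ 2 * B x)).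
  by apply: sfZ; apply: sfD; apply: sfZ.
apply: (le_trans (normJ_le (l2_mul lp (test_l2 (th n))) sR bd)).
rewrite JZ; last by apply: sfD; exact: sfZ.
rewrite JD; [|exact: sfZ..].
rewrite JZ// JZ// J_box ?divr_ge0 ?(ltW N0)// -/A.
have h1 : t^-1 * A <= d by rewrite ler_pdivrMl//; move: hA; rewrite ler_norml => /andP[].
have -> : t * (C * N) ^+ 2 * (2 * (M / N)) ^+ 2 = t * (C ^+ 2 * (2 * M) ^+ 2).
  by field; rewrite gt_eqF.
lra.
Qed.

(** A point mass is not the divergence of an $L^2$ field plus an $L^2$ function: the rescaled
    functions $\varphi((n+1)x)$ keep their value at 0, while their gradients concentrate exactly at
    the scale of [cvg_J_concentrated]. *)
Lemma point_charge_eq0 (a : R) p1 p2 m : l2 p1 -> l2 p2 -> l2 m ->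
  (forall f, test_function f ->
    a * f (0, 0) = J (fun x => p1 x * 'D_(e1 R) f x) + J (fun x => p2 x * 'D_(e2 R) f x) + J (fun x => m x * f x)) ->
  a = 0.
Proof.
move=> lp1 lp2 lm H.
have [k phi0] := cutoff_gt0 ((0, 0) : PT).
have tphi := test_cutoff R k; set phi := cutoff k in phi0 tphi.
have [M M0 sM] := test_supported tphi.
pose f n x := phi (0 + n.+1%:R *: x).
have tf n : test_function (f n) by apply: test_affine => //; rewrite pnatr_eq0.
have sc (n : nat) x : box M (0 + n.+1%:R *: x) -> box (M / n.+1%:R) x.
  move=> /box_norm; rewrite add0r normrZ ger0_norm// => h.
  by apply/box_norm; rewrite ler_pdivlMr ?ltr0n// mulrC.
have ind (g : PT -> R) (D : R) n x : supported g M -> (forall y, `|g y| <= D) -> 0 < D ->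
    `|g (0 + n.+1%:R *: x)| <= D * \1_(box (M / n.+1%:R)) x.
  move=> sg gD D0; rewrite indicE; have [b|nb] := pselect (box (M / n.+1%:R) x).
    by rewrite mem_set// mulr1.
  rewrite memNset// mulr0 sg ?normr0//; by move=> /sc.
have df n e x : axis e -> 'D_e (f n) x = n.+1%:R * 'D_e phi (0 + n.+1%:R *: x).
  move=> he; by have [_ ->] := @derive_affine R phi 0 n.+1%:R e x (smooth_derivable he (test_smooth tphi)).
have cD p e : axis e -> l2 p -> J (fun x => p x * 'D_e (f n) x) @[n --> \oo] --> (0 : R).
  move=> he lp; have [C C0 hC] := test_bounded (test_derive he tphi).
  apply: (cvg_J_concentrated C0 (ltW M0) lp) => [n|n x]; first exact: test_derive.
  rewrite df// normrM ger0_norm// [C * _]mulrC -mulrA ler_wpM2l//.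
  by apply: (ind ('D_e phi) C n x) => //; exact: supported_derive.
have cm : J (fun x => m x * f n x) @[n --> \oo] --> (0 : R).
  have [C C0 hC] := test_bounded tphi.
  apply: (cvg_J_concentrated C0 (ltW M0) lm) => // n x.
  apply: (le_trans (ind _ _ n x sM hC C0)); rewrite ler_wpM2r ?indicE ?ler0n//.
  by rewrite ler_peMr ?(ltW C0)// ler1n.
have c1 := cD p1 _ (or_introl erefl) lp1; have c2 := cD p2 _ (or_intror erefl) lp2.
have c3 := cvgD (cvgD c1 c2) cm.
have E : (fun n : nat => a * phi (0, 0)) @ \oo --> (0 + 0 + 0 : R).
  suff -> : (fun n : nat => a * phi (0, 0)) =
    (fun n => J (fun x => p1 x * 'D_(e1 R) (f n) x) + J (fun x => p2 x * 'D_(e2 R) (f n) x) + J (fun x => m x * f n x)) by exact: c3.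
  apply/funext => n; rewrite -(H _ (tf n)); congr (_ * phi _).
  by congr pair; rewrite /= scaler0 addr0.
have E2 : a * phi (0, 0) = 0 + 0 + 0 by apply: (cvg_unique _ (cvg_cst _) E).
by move/eqP: E2; rewrite !addr0 mulf_eq0 (gt_eqF phi0) orbF => /eqP.
Qed.

(** Subtracting the equations leaves $(a_1 - a_2)\delta_0 = -\Delta(w_1 - w_2) + (l_1w_1 - k_2w_2)$,
    where the Laplacian is the divergence of the $L^2$ field with components [p1] and [p2]. *)
Lemma wgreen_charge_unique w1 w2 p1 p2 (a1 a2 l1 k2 : R) : l2 w1 -> l2 w2 -> l2 p1 -> l2 p2 ->
  (forall f, test_function f -> J (fun x => w1 x * (- laplacian f x + l1 * f x)) = a1 * f (0, 0)) ->
  (forall f, test_function f -> J (fun x => w2 x * (- laplacian f x + k2 * f x)) = a2 * f (0, 0)) ->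
  wderiv (e1 R) (fun x => w1 x - w2 x) p1 -> wderiv (e2 R) (fun x => w1 x - w2 x) p2 ->
  a1 = a2.
Proof.
move=> lw1 lw2 lp1 lp2 h1 h2 d1 d2.
apply/eqP; rewrite -subr_eq0; apply/eqP.
apply: (@point_charge_eq0 _ p1 p2 (fun x => l1 * w1 x - k2 * w2 x)) => //.
  by apply: l2_sub; exact: l2_scale.
move=> f tf; rewrite mulrBl -h1// -h2//.
have a1' : axis (e1 R) by left. have a2' : axis (e2 R) by right.
have t1 := test_derive a1' tf; have t2 := test_derive a2' tf.
have t11 := test_derive a1' t1; have t22 := test_derive a2' t2.
have lt := test_laplacian tf.
have D1 := d1 _ t1; have D2 := d2 _ t2.
have lh := l2_sub lw1 lw2.
have -> : J (fun x => p1 x * 'D_(e1 R) f x) + J (fun x => p2 x * 'D_(e2 R) f x) = - J (fun x => (w1 x - w2 x) * laplacian f x).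
  have -> : J (fun x => (w1 x - w2 x) * laplacian f x) =
     J (fun x => (w1 x - w2 x) * 'D_(e1 R) ('D_(e1 R) f) x) + J (fun x => (w1 x - w2 x) * 'D_(e2 R) ('D_(e2 R) f) x).
    rewrite -JD; [|exact: l2_mul lh (test_l2 t11)|exact: l2_mul lh (test_l2 t22)].
    by congr Rintegral; apply/funext => x; rewrite /laplacian mulrDr.
  have key (a b c d : R) : a = - c -> b = - d -> c + d = - (a + b) by move=> -> ->; rewrite opprD !opprK.
  exact: (key _ _ _ _ D1 D2).
have ll := test_l2 lt; have lf := test_l2 tf.
have lg k : l2 (fun x => - laplacian f x + k * f x).
  by apply: test_l2; apply: test_add; [exact: test_opp|exact: test_scale].
rewrite -JN; last exact: l2_mul.
rewrite -JB; [|exact: l2_mul|exact: l2_mul].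
rewrite -JD; last 2 first.
- by apply: sfN; exact: l2_mul.
- by apply: l2_mul => //; apply: l2_sub; exact: l2_scale.
by congr Rintegral; apply/funext => x; ring.
Qed.

Variable G : R -> PT -> R[i].
Hypothesis hG : forall l : R, 0 < l -> is_green l (G l).

(** The difference of two regular parts lies in $H^1$ and equals $qG_l - q'G_{l'}$, even for
    different parameters; real and imaginary parts are then compared separately. *)
Lemma charge_unique u q q' : is_charge G u q -> is_charge G u q' -> q = q'.
Proof.
move=> [l [l0 h]] [l' [l'0 h']].
have [LG gr gi] := greenP (hG l0); have [LG' gr' gi'] := greenP (hG l'0).
have := H1_comb (-1) h' h => -[_ [g1 [Lg1 d1]] [g2 [Lg2 d2]]].
have [rG iG] := (L2P _).1 LG; have [rG' iG'] := (L2P _).1 LG'.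
have [rg1 ig1] := (L2P _).1 Lg1; have [rg2 ig2] := (L2P _).1 Lg2.
have [dr1 di1] := (weak_derivativeP _ _ _).1 d1; have [dr2 di2] := (weak_derivativeP _ _ _).1 d2.
(* By linearity [c * g] carries the real charges [Re c] and [Im c], as [g] itself carries 1 and
   0. *)
have E c (k : R) g : L2 g -> (forall f, test_function f -> J (fun x => rp g x * (- laplacian f x + k * f x)) = f (0, 0)) ->
   (forall f, test_function f -> J (fun x => ip g x * (- laplacian f x + k * f x)) = 0) ->
   forall f, test_function f -> J (fun x => rp (fun x => c * g x) x * (- laplacian f x + k * f x)) = complex.Re c * f (0, 0) /\
     J (fun x => ip (fun x => c * g x) x * (- laplacian f x + k * f x)) = complex.Im c * f (0, 0).
  move=> /L2P[rg ig] hr hi f tf; rewrite -(hr f tf).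
  have lf : l2 (fun x => - laplacian f x + k * f x).
    by apply: test_l2; apply: test_add; [exact/test_opp/test_laplacian|exact: test_scale].
  have s1 := l2_mul rg lf; have s2 := l2_mul ig lf; have i0 := hi f tf.
  rewrite rpZ ipZ; split.
    have -> : (fun x => (complex.Re c * rp g x + - complex.Im c * ip g x) * (- laplacian f x + k * f x)) =
      (fun x => complex.Re c * (rp g x * (- laplacian f x + k * f x)) + - complex.Im c * (ip g x * (- laplacian f x + k * f x))).
      by apply/funext => x; ring.
    by rewrite JD ?JZ// ?i0 ?mulr0 ?addr0//; exact: sfZ.
  have -> : (fun x => (complex.Re c * ip g x + complex.Im c * rp g x) * (- laplacian f x + k * f x)) =
    (fun x => complex.Re c * (ip g x * (- laplacian f x + k * f x)) + complex.Im c * (rp g x * (- laplacian f x + k * f x))).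
    by apply/funext => x; ring.
  by rewrite JD ?JZ// ?i0 ?mulr0 ?add0r//; exact: sfZ.
have D : (fun x => regular_part G l' q' u x + -1 * regular_part G l q u x) =
  (fun x => q * G l x + (-1) * (q' * G l' x)).
  by apply/funext => x; rewrite /regular_part; ring.
have LqG := L2_scale q LG; have LqG' := L2_scale q' LG'.
have [a1 b1] := (L2P _).1 LqG; have [a2 b2] := (L2P _).1 LqG'.
have Dr : rp (fun x => q * G l x + (-1) * (q' * G l' x)) = (fun x => rp (fun x => q * G l x) x - rp (fun x => q' * G l' x) x).
  by apply/funext => x; rewrite /rp mulN1r; case: (q * _) (q' * _) => ? ? [? ?].
have Di : ip (fun x => q * G l x + (-1) * (q' * G l' x)) = (fun x => ip (fun x => q * G l x) x - ip (fun x => q' * G l' x) x).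
  by apply/funext => x; rewrite /ip mulN1r; case: (q * _) (q' * _) => ? ? [? ?].
rewrite D Dr in dr1 dr2; rewrite D Di in di1 di2.
have Er : complex.Re q = complex.Re q'.
  apply: (wgreen_charge_unique a1 a2 rg1 rg2 _ _ dr1 dr2).
  - by move=> f tf; exact: (E q l _ LG gr gi f tf).1.
  - by move=> f tf; exact: (E q' l' _ LG' gr' gi' f tf).1.
have Ei : complex.Im q = complex.Im q'.
  apply: (wgreen_charge_unique b1 b2 ig1 ig2 _ _ di1 di2).
  - by move=> f tf; exact: (E q l _ LG gr gi f tf).2.
  - by move=> f tf; exact: (E q' l' _ LG' gr' gi' f tf).2.
by case: (q) (q') Er Ei => ? ? [? ?] /= -> ->.
Qed.

Lemma charge_ofE u q : is_charge G u q -> charge_of G u = q.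
Proof.
move=> h; apply: (@charge_unique u) => //.
by apply: (@xgetPex _ _ [set q | is_charge G u q]); exists q.
Qed.

End ChargeUnique.

(** * Convolution with the Green's function *)

Section ConvolutionGreen.
Variable R : realType.
Local Notation PT := (R * R)%type.
Local Notation P := (measurableTypeR R * measurableTypeR R)%type.
Local Notation mu := (@leb2 R).
Local Notation sf := (summable_fun mu).
Local Notation J := (Rintegral mu setT).
Implicit Types (f h K g A B : PT -> R) (x y z : PT).

Lemma l2_trans g y : l2 g -> l2 (trans g y).
Proof.
move=> [mg sg]; split; first exact: (meas_translate (- y.1, - y.2) mg).
exact: (sf_trans y sg).
Qed.

(** Both sides are double integrals of the terms $h(z)K_i(y)g_i(z - y)$. The domination by
    [A x + B y] bounds the integral over [y] uniformly in [z], and [h] provides integrability in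
    [z]. *)
Lemma conv_fubini K1 K2 g1 g2 A B h :
  measurable_fun [set: P] K1 -> measurable_fun [set: P] K2 -> l2 g1 -> l2 g2 -> sf A -> sf B ->
  (forall x y, `|K1 x * g1 y| <= A x + B y) -> (forall x y, `|K2 x * g2 y| <= A x + B y) ->
  test_function h ->
  J (fun z => h z * J (fun x => K1 (flip z x) * g1 x + K2 (flip z x) * g2 x)) =
  J (fun y => K1 y * J (fun x => g1 x * h (x + y)) + K2 y * J (fun x => g2 x * h (x + y))).
Proof.
move=> mK1 mK2 lg1 lg2 sA sB b1 b2 th.
have sh := test_sf th; have mh := test_measurable th.
pose S (K g : PT -> R) := [/\ measurable_fun [set: P] K, l2 g & forall x y, `|K x * g y| <= A x + B y].
have mS K g : S K g -> forall z, measurable_fun [set: P] (fun x => K x * g (flip z x)).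
  by move=> [mK [mg _] _] z; apply: measurable_funM => //; exact: meas_flip.
have sS K g z : S K g -> sf (fun x => K x * g (flip z x)).
  move=> H; apply: (@sf_le _ P R mu _ (fun x => A x + B (flip z x))).
  - exact: mS.
  - by case: H => _ _ H x; exact: H.
  - by apply: sfD => //; exact: sf_flip.
have JS K g z : S K g -> J (fun x => K (flip z x) * g x) = J (fun x => K x * g (flip z x)) /\ sf (fun x => K (flip z x) * g x).
  move=> H; have E : (fun x => K (flip z x) * g x) = (fun x => K (flip z x) * g (flip z (flip z x))).
    by apply/funext => x; rewrite flipK.
  by rewrite E; split; [exact: (J_flip z (sS K g z H))|exact: (sf_flip z (sS K g z H))].
have S1 : S K1 g1 by split.
have S2 : S K2 g2 by split.
pose F (p : P * P) := h p.1 * (K1 p.2 * g1 (p.1.1 - p.2.1, p.1.2 - p.2.2) + K2 p.2 * g2 (p.1.1 - p.2.1, p.1.2 - p.2.2)).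
have mF : measurable_fun [set: P * P] F.
  have mm K g : S K g -> measurable_fun [set: P * P] (fun p => K p.2 * g (p.1.1 - p.2.1, p.1.2 - p.2.2)).
    move=> [mK [mg _] _]; apply: measurable_funM; last exact: measurable_sub2.
    by apply: (measurableT_comp mK); exact: measurable_snd.
  apply: measurable_funM; first by apply: (measurableT_comp mh); exact: measurable_fst.
  by apply: measurable_funD; exact: mm.
have s1 z : sf (fun x => F (z, x)).
  exact: (sfZ (h z) (sfD (sS _ _ z S1) (sS _ _ z S2))).
have sz K g y : S K g -> sf (fun z => h z * (K y * trans g y z)).
  move=> [_ lg _]; have := sfZ (K y) (l2_mul (l2_trans y lg) (test_l2 th)).
  by congr (summable_fun mu _); apply/funext => z; ring.
have s2 y : sf (fun z => F (z, y)).
  have := sfD (sz _ _ y S1) (sz _ _ y S2); congr (summable_fun mu _).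
  by apply/funext => z; rewrite /F -mulrDr.
have s3 : sf (fun z => `|h z| * (2 * (J A + J B))).
  have := sfZ (2 * (J A + J B)) (sf_norm sh); congr (summable_fun mu _); apply/funext => z; exact: mulrC.
have bF z : J (fun x => `|F (z, x)|) <= `|h z| * (2 * (J A + J B)).
  have sAB : sf (fun x => A x + B (flip z x)) by apply: sfD => //; exact: sf_flip.
  have sR : sf (fun x => `|h z| * (2 * (A x + B (flip z x)))) by do 2 apply: sfZ.
  apply: (le_trans (leJ (sf_norm (s1 z)) sR _)).
    move=> x; rewrite /F normrM ler_wpM2l//= mulr2n mulrDl mul1r.
    by apply: (le_trans (ler_normD _ _)); apply: lerD; [exact: b1|exact: b2].
  rewrite JZ; last exact: sfZ.
  by rewrite JZ// JD ?J_flip//; exact: sf_flip.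
have E := fubini_plane mF s1 s2 s3 bF.
transitivity (J (fun z => J (fun x => F (z, x)))).
  congr Rintegral; apply/funext => z; have [e1 k1] := JS _ _ z S1; have [e2 k2] := JS _ _ z S2.
  rewrite JD// e1 e2 -JD; [|exact: sS..].
  by rewrite -JZ//; apply: sfD; exact: sS.
rewrite E; congr Rintegral; apply/funext => y.
have T K g : S K g -> J (fun z => h z * (K y * trans g y z)) = K y * J (fun x => g x * h (x + y)).
  move=> H; have [_ lg _] := H.
  have lhy : l2 (fun x => h (x + y)).
    by have := test_l2 (test_trans (- y) th); rewrite /trans opprK.
  rewrite -(J_trans y (l2_mul lg lhy)) -JZ; last first.
    exact: (sf_trans y (l2_mul lg lhy)).
  by congr Rintegral; apply/funext => z; rewrite /trans subrK; ring.
rewrite -(T _ _ S1) -(T _ _ S2) -JD; [|exact: sz..].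
by congr Rintegral; apply/funext => z; rewrite /F -mulrDr.
Qed.

(* Apply [conv_fubini] to [h = - Delta f + l f]: its correlations with [g1] and
   [g2] are [f] and [0]. *)
Lemma conv_green_eq0 K1 K2 g1 g2 A B (l : R) :
  measurable_fun [set: P] K1 -> measurable_fun [set: P] K2 -> l2 g1 -> l2 g2 -> sf A -> sf B ->
  (forall x y, `|K1 x * g1 y| <= A x + B y) -> (forall x y, `|K2 x * g2 y| <= A x + B y) ->
  (forall f, test_function f -> J (fun x => g1 x * (- laplacian f x + l * f x)) = f (0, 0)) ->
  (forall f, test_function f -> J (fun x => g2 x * (- laplacian f x + l * f x)) = 0) ->
  (forall z, J (fun x => K1 (flip z x) * g1 x + K2 (flip z x) * g2 x) = 0) ->
  forall f, test_function f -> J (fun x => K1 x * f x) = 0.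
Proof.
move=> mK1 mK2 lg1 lg2 sA sB b1 b2 G1 G2 H f tf.
pose h x := - laplacian f x + l * f x.
have th : test_function h by apply: test_add; [exact/test_opp/test_laplacian|exact: test_scale].
have := conv_fubini mK1 mK2 lg1 lg2 sA sB b1 b2 th.
rewrite (_ : (fun z => _) = fun=> 0); last by apply/funext => z; rewrite H mulr0.
rewrite J0 => ->; congr Rintegral; apply/funext => y.
have hy : (fun x => h (x + y)) = (fun x => - laplacian (trans f (- y)) x + l * trans f (- y) x).
  by apply/funext => x; rewrite /h laplacian_trans// /trans opprK.
have -> : (fun x => g1 x * h (x + y)) = (fun x => g1 x * (- laplacian (trans f (- y)) x + l * trans f (- y) x)).
  by apply/funext => x; rewrite -(congr1 (@^~ x) hy).
have -> : (fun x => g2 x * h (x + y)) = (fun x => g2 x * (- laplacian (trans f (- y)) x + l * trans f (- y) x)).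
  by apply/funext => x; rewrite -(congr1 (@^~ x) hy).
rewrite G1 ?G2 ?mulr0 ?addr0; [|exact: test_trans..].
by rewrite /trans opprK (_ : (0, 0) + y = y)//; case: (y) => a b; congr pair; exact: add0r.
Qed.

End ConvolutionGreen.

(** * The variational problem *)

Section Variational.
Variable R : realType.
Local Open Scope complex_scope.
Local Notation PT := (R * R)%type.
Local Notation P := (measurableTypeR R * measurableTypeR R)%type.
Local Notation mu := (@leb2 R).
Local Notation sf := (summable_fun mu).
Local Notation J := (Rintegral mu setT).
Implicit Types (u v b : PT -> R[i]) (x y z : PT) (c q : R[i]).

(** The real part of $u\bar b$. *)
Definition dotp u b x : R := rp u x * rp b x + ip u x * ip b x.

Lemma nsq_line u b (t : R) x :
  nsq (u x + t%:C * b x) = nsq (u x) + 2 * t * dotp u b x + t ^+ 2 * nsq (b x).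
Proof. by rewrite /nsq /dotp /rp /ip; case: (u x) (b x) => a a' [d d'] /=; ring. Qed.

Lemma dotp_sqr_le u b x : dotp u b x ^+ 2 <= nsq (u x) * nsq (b x).
Proof.
rewrite /dotp /nsq -/(rp u x) -/(ip u x) -/(rp b x) -/(ip b x) -subr_ge0.
move: (rp u x) (ip u x) (rp b x) (ip b x) => a a' d d'.
by rewrite (_ : _ - _ = (a * d' - a' * d) ^+ 2) ?sqr_ge0//; ring.
Qed.

Lemma meas_dotp u b : L2 u -> L2 b -> measurable_fun [set: P] (dotp u b).
Proof.
move=> /L2P[[h1 _] [h2 _]] /L2P[[h3 _] [h4 _]].
by apply: measurable_funD; exact: measurable_funM.
Qed.

Lemma sf_dotp u b : L2 u -> L2 b -> sf (dotp u b).
Proof. by move=> /L2P[h1 h2] /L2P[h3 h4]; apply: sfD; exact: l2_mul. Qed.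

Definition quartic (beta : R) u v x : R :=
  nsq (u x) ^+ 2 + nsq (v x) ^+ 2 + 2 * beta * (nsq (u x) * nsq (v x)).

Lemma sf_quartic beta u v : L24 u -> L24 v -> sf (quartic beta u v).
Proof.
move=> hu hv; apply: sfD; last by apply: sfZ; exact: sf_nsqM.
by apply: sfD; [case: hu|case: hv].
Qed.

Lemma J_quarticE beta u v : L24 u -> L24 v -> J (quartic beta u v) =
  J (fun x => nsq (u x) ^+ 2) + J (fun x => nsq (v x) ^+ 2) + 2 * beta * J (fun x => nsq (u x) * nsq (v x)).
Proof.
move=> hu hv; have [_ u4] := hu; have [_ v4] := hv; have suv := sf_nsqM hu hv.
by rewrite -JZ// -JD// -JD//; [exact: sfD|exact: sfZ].
Qed.

Lemma J_quartic_ae_zero (beta : R) u v : L24 u -> L24 v -> ae_zero u -> ae_zero v -> J (quartic beta u v) = 0.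
Proof.
move=> hu hv zu zv; rewrite -[RHS](@J0 _ P R mu); apply: eq_ae_J.
- exact: sf_meas (sf_quartic beta hu hv).
- exact: measurable_cst.
- apply: ae_impl2 zu zv => x ux vx.
  by rewrite /quartic ux vx nsq0 mulr0 expr0n mulr0 !addr0.
Qed.

Lemma sf_weighted_dotp (a beta : R) u v b : L24 u -> L24 v -> L24 b ->
  sf (fun x => (a * nsq (u x) + beta * nsq (v x)) * dotp u b x).
Proof.
move=> hu hv hb; have [Lu u4] := hu; have [Lv v4] := hv; have [Lb b4] := hb.
have S w : L24 w -> sf (fun x => nsq (w x) * dotp u b x).
  move=> hw; have [Lw w4] := hw.
  apply: (@sf_le _ P R mu _ (fun x => nsq (w x) ^+ 2 + nsq (u x) * nsq (b x))).
  - by apply: measurable_funM; [exact: L2_meas_nsq|exact: meas_dotp].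
  - by move=> x; apply: (le_trans (norm_mul_le _ _)); rewrite lerD2l; exact: dotp_sqr_le.
  - by apply: sfD => //; exact: sf_nsqM.
have := sfD (sfZ a (S _ hu)) (sfZ beta (S _ hv)); congr (summable_fun mu _).
by apply/funext => x; ring.
Qed.

(* Convexity of the quartic part along lines *)
Lemma J_quartic_line (beta t : R) u v b : 0 <= beta -> L24 u -> L24 v -> L24 b ->
  J (quartic beta u v) + 4 * t * J (fun x => (1 * nsq (u x) + beta * nsq (v x)) * dotp u b x)
  <= J (quartic beta (fun x => u x + t%:C * b x) v).
Proof.
move=> b0 hu hv hb.
have s1 := sf_quartic beta hu hv; have s2 := sf_weighted_dotp 1 beta hu hv hb.
have s3 := sf_quartic beta (L24_add hu (L24_scale t%:C hb)) hv.
rewrite -JZ// -JD//; last exact: sfZ.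
apply: leJ => //; first by apply: sfD => //; exact: sfZ.
move=> x; rewrite /quartic nsq_line.
have := nsq_ge0 (u x); have := nsq_ge0 (v x); have := nsq_ge0 (b x).
move: (nsq (u x)) (nsq (v x)) (nsq (b x)) (dotp u b x) => p q s r s0 q0 p0.
rewrite -subr_ge0.
rewrite (_ : _ - _ = (2 * t * r + t ^+ 2 * s) ^+ 2 + 2 * p * (t ^+ 2 * s) + 2 * beta * (t ^+ 2 * s * q)); last by ring.
apply: addr_ge0; last by apply: mulr_ge0; [exact: mulr_ge0|apply: mulr_ge0 => //; apply: mulr_ge0 => //; exact: sqr_ge0].
apply: addr_ge0; first exact: sqr_ge0.
by apply: mulr_ge0; [exact: mulr_ge0|apply: mulr_ge0 => //; exact: sqr_ge0].
Qed.

(** Both sides equal $Q_0^2$ at $t = 0$, so the first-order terms $4Q_0td$ and $4Q_0ta$ must agree,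
    [t] taking both signs. *)
Lemma first_order_eq (Q0 a d c : R) : 0 < Q0 ->
  (forall t, Q0 * (Q0 + 4 * t * d) <= (Q0 + 2 * t * a + t ^+ 2 * c) ^+ 2) -> a = d.
Proof.
move=> Q00 H; apply/eqP; rewrite -subr_eq0; apply/negPn/negP => ad.
pose e := a - d; have e2 : 0 < e ^+ 2 by rewrite exprn_even_gt0.
(* A bound for the factor of $t^2$ in the expanded square, valid for $|t| \le 1$. *)
pose K := 4 * a ^+ 2 + 2 * Q0 * `|c| + 4 * `|a * c| + c ^+ 2 + 1.
have K0 : 0 < K.
  have k1 : 0 <= 2 * Q0 * `|c| by apply: mulr_ge0 => //; apply: mulr_ge0 => //; exact: ltW.
  have k2 := sqr_ge0 a; have k3 := sqr_ge0 c; have k4 := normr_ge0 (a * c); rewrite /K; lra.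
have le0 : 0 < `|e| + 1 by rewrite ltr_wpDl.
(* With this [s] the step $t = -se$ satisfies $|t| \le 1$ and makes the quadratic remainder at most
   a quarter of the linear gap $4se^2Q_0$. *)
pose s := Num.min ((`|e| + 1)^-1) (Q0 / K).
have s0 : 0 < s by rewrite lt_min invr_gt0 le0 divr_gt0.
have s1 : s * `|e| <= 1.
  apply: (@le_trans _ _ ((`|e| + 1)^-1 * `|e|)); first by rewrite ler_wpM2r// ge_min lexx.
  by rewrite mulrC ler_pdivrMr// mul1r lerDl.
have s2 : s * K <= Q0 by rewrite -ler_pdivlMr// ge_min lexx orbT.
pose t : R := - s * e.
have t1 : `|t| <= 1 by rewrite /t mulNr normrN normrM (gtr0_norm s0).
have tt : t ^+ 2 <= 1 by rewrite -real_normK ?num_real// expr_le1.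
have h := H t.
have h1 : t ^+ 2 * (4 * a ^+ 2 + 2 * Q0 * c + 4 * t * (a * c) + t ^+ 2 * c ^+ 2) <= t ^+ 2 * K.
  apply: ler_wpM2l; first exact: sqr_ge0.
  have i1 : 2 * Q0 * c <= 2 * Q0 * `|c| by rewrite ler_wpM2l ?ler_norm// mulr_ge0// ltW.
  have i2 : 4 * t * (a * c) <= 4 * `|a * c|.
    rewrite -mulrA ler_wpM2l//; apply: (le_trans (ler_norm _)); rewrite normrM.
    by rewrite ler_piMl.
  have i3 : t ^+ 2 * c ^+ 2 <= c ^+ 2 by rewrite ler_piMl ?sqr_ge0.
  by rewrite /K; lra.
have h2 : t ^+ 2 * K <= s * e ^+ 2 * Q0.
  rewrite (_ : t ^+ 2 * K = s * e ^+ 2 * (s * K)); last by rewrite /t; ring.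
  by rewrite ler_wpM2l// mulr_ge0 ?(ltW s0) ?(ltW e2).
have h3 : Q0 * (4 * t * (d - a)) = 4 * (s * e ^+ 2 * Q0) by rewrite /t /e; ring.
have pos : 0 < s * e ^+ 2 * Q0 by rewrite mulr_gt0// mulr_gt0.
have : Q0 * (4 * t * (d - a)) <= t ^+ 2 * (4 * a ^+ 2 + 2 * Q0 * c + 4 * t * (a * c) + t ^+ 2 * c ^+ 2).
  rewrite -subr_ge0; move: h; rewrite -subr_ge0; congr (0 <= _); ring.
move: pos h2 h1; rewrite h3; lra.
Qed.

Lemma quartic_scale (beta t : R) u v x :
  quartic beta (fun x => t%:C * u x) (fun x => t%:C * v x) x = t ^+ 4 * quartic beta u v x.
Proof. by rewrite /quartic !nsqM !nsq_real; ring. Qed.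

End Variational.

(** * Positivity of the quadratic form and scaling onto the Nehari manifold *)

Section Problem.
Variables (R : realType) (G : R -> R * R -> R[i]).
Hypothesis hG : forall l : R, 0 < l -> is_green l (G l).
Variables (alpha omega tomega lambda : R).
Hypotheses (htomega : 0 < tomega) (hlambda : omega_ alpha < lambda <= omega).
Local Open Scope complex_scope.
Local Notation PT := (R * R)%type.
Local Notation P := (measurableTypeR R * measurableTypeR R)%type.
Local Notation mu := (@leb2 R).
Local Notation sf := (summable_fun mu).
Local Notation J := (Rintegral mu setT).
Implicit Types (u v b : PT -> R[i]) (x y z : PT) (c q : R[i]).

Lemma omega_gt0 : 0 < omega_ alpha.
Proof. by rewrite mulr_gt0// expR_gt0. Qed.

Lemma lambda_gt0 : 0 < lambda.
Proof. by case/andP: hlambda => h _; exact: lt_trans omega_gt0 h. Qed.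

(** $\theta_\lambda$ increases with $\lambda$, and $\alpha + \theta_\lambda$ vanishes exactly at
    [omega_ alpha]; logarithms make the comparison linear. *)
Lemma charge_weight_gt0 : 0 < alpha + theta lambda.
Proof.
have l0 := lambda_gt0; have p0 := pi_gt0 R; case/andP: hlambda => h _.
have s0 : 0 < Num.sqrt lambda by rewrite sqrtr_gt0.
have : ln (omega_ alpha) < ln lambda by rewrite ltr_ln ?posrE// omega_gt0.
rewrite /omega_ lnM ?posrE ?expR_gt0// expRK.
have -> : ln 4 = 2 * ln 2 :> R.
  by rewrite (_ : 4 = 2 ^+ 2) ?lnXn//; [rewrite mulr_natl|ring].
have -> : ln lambda = 2 * ln (Num.sqrt lambda).
  by rewrite -{1}(sqr_sqrtr (ltW l0)) lnXn// mulr_natl.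
rewrite /theta ln_div ?posrE//; set g := euler_gamma R; move: (ln (Num.sqrt lambda)) (ln 2) => L T H.
have -> : alpha + (L - T + g) / (2 * pi) = (2 * pi * alpha + (L - T + g)) / (2 * pi).
  by move: (pi : R) p0 => p p0; field; rewrite gt_eqF.
by rewrite divr_gt0 ?mulr_gt0//; lra.
Qed.

Lemma H1alpha_charge u : H1alpha G u -> is_charge G u (charge_of G u).
Proof. by move=> [_ h]; exact: (@xgetPex _ _ [set q | is_charge G u q] h). Qed.

Lemma H1alpha_L24 u : H1alpha G u -> L24 u.
Proof.
move=> [Lu [q [l [l0 hl]]]].
have := L24_add (H1_L24 hl) (L24_scale q (green_L24 l0 (hG l0))).
by congr L24; apply/funext => x; rewrite /regular_part subrK.
Qed.

Lemma H1_charge0 u : H1 u -> is_charge G u 0.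
Proof.
move=> h; exists 1; split => //.
by congr H1: h; apply/funext => x; rewrite /regular_part mul0r subr0.
Qed.

Lemma H1_H1alpha u : H1 u -> H1alpha G u.
Proof. by move=> h; split; [case: h|exists 0; exact: H1_charge0]. Qed.

Lemma L2_regular_part q u : L2 u -> L2 (regular_part G lambda q u).
Proof.
move=> Lu; have [LG _] := hG lambda_gt0.
by have := L2_add Lu (L2_scale (- q) LG); congr L2; apply/funext => x; rewrite /regular_part mulNr.
Qed.

Local Notation qf := (qform G alpha omega lambda).
Definition quadratic u v : R := qf u + dirichlet v + tomega * J (fun x => nsq (v x)).

Lemma qformE u : qf u = dirichlet (regular_part G lambda (charge_of G u) u)
  + lambda * J (fun x => nsq (regular_part G lambda (charge_of G u) u x))
  + (omega - lambda) * J (fun x => nsq (u x)) + (alpha + theta lambda) * nsq (charge_of G u).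
Proof. by rewrite /qform !cnorm2E normc_sqr. Qed.

Lemma J_nsq_ge0 u : 0 <= J (fun x => nsq (u x)).
Proof. by apply: J_ge0 => x; exact: nsq_ge0. Qed.

Lemma omega_ge : 0 <= omega - lambda.
Proof. by rewrite subr_ge0; case/andP: hlambda. Qed.

Lemma qform_ge u : lambda * J (fun x => nsq (regular_part G lambda (charge_of G u) u x))
  + (alpha + theta lambda) * nsq (charge_of G u) <= qf u.
Proof.
rewrite qformE.
have := dirichlet_ge0 (regular_part G lambda (charge_of G u) u).
have := mulr_ge0 omega_ge (J_nsq_ge0 u); lra.
Qed.

Lemma qform_ge0 u : 0 <= qf u.
Proof.
apply: le_trans (qform_ge u); rewrite addr_ge0// mulr_ge0 ?J_nsq_ge0 ?nsq_ge0//.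
- exact: ltW lambda_gt0.
- exact: ltW charge_weight_gt0.
Qed.

(** Both terms of [qform_ge] have positive coefficients, so the charge vanishes; the regular part is
    then [u] itself and has norm 0. *)
Lemma qform_le0 u : H1alpha G u -> qf u <= 0 -> ae_zero u.
Proof.
move=> [Lu _] h; have := le_trans (qform_ge u) h.
set q := charge_of G u; set phi := regular_part G lambda q u.
have A := mulr_ge0 (ltW lambda_gt0) (J_nsq_ge0 phi).
have B := mulr_ge0 (ltW charge_weight_gt0) (nsq_ge0 q).
move=> AB.
have q0 : q = 0.
  apply: nsq_eq0; apply/eqP; have : (alpha + theta lambda) * nsq q = 0 by lra.
  by move/eqP; rewrite mulf_eq0 (gt_eqF charge_weight_gt0).
have : lambda * J (fun x => nsq (phi x)) = 0 by lra.
move/eqP; rewrite mulf_eq0 (gt_eqF lambda_gt0)/= => /eqP E.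
apply/(ae_zeroP Lu); rewrite -E; congr Rintegral; apply/funext => x.
by rewrite /phi q0 /regular_part mul0r subr0.
Qed.

Lemma quadratic_gt0 u v : H1alpha G u -> H1 v -> ~ (ae_zero u /\ ae_zero v) -> 0 < quadratic u v.
Proof.
move=> hu hv nz; rewrite ltNge; apply/negP => h; apply: nz.
have A := qform_ge0 u; have B := dirichlet_ge0 v.
have C := mulr_ge0 (ltW htomega) (J_nsq_ge0 v); rewrite /quadratic in h.
split; first by apply: qform_le0 => //; lra.
have Lv : L2 v by case: hv.
apply/(ae_zeroP Lv); have /eqP : tomega * J (fun x => nsq (v x)) = 0 by lra.
by rewrite mulf_eq0 (gt_eqF htomega)/= => /eqP.
Qed.

Lemma nehariE (beta : R) u v : L24 u -> L24 v ->
  nehari_functional G alpha omega tomega lambda beta (u, v) = quadratic u v - J (quartic beta u v).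
Proof.
move=> hu hv; rewrite /nehari_functional /quadratic /= J_quarticE// !cnorm2E !cnorm4E couplingE.
by ring.
Qed.

Lemma energyE (beta : R) u v : L24 u -> L24 v ->
  energy G alpha omega tomega lambda beta (u, v) = 2^-1 * quadratic u v - 4^-1 * J (quartic beta u v).
Proof.
move=> hu hv; rewrite /energy /quadratic /= J_quarticE// !cnorm2E !cnorm4E couplingE.
by field.
Qed.

Lemma is_charge_scale u q (t : R) : is_charge G u q -> is_charge G (fun x => t%:C * u x) (t%:C * q).
Proof.
move=> [l [l0 h]]; exists l; split => //; have := H1_scale t%:C h; congr H1.
by apply/funext => x; rewrite /regular_part; ring.
Qed.

Lemma H1alpha_scale u (t : R) : H1alpha G u -> H1alpha G (fun x => t%:C * u x).
Proof.
move=> h; split; first by apply: L2_scale; case: h.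
by exists (t%:C * charge_of G u); apply: is_charge_scale; exact: H1alpha_charge.
Qed.

Lemma quadratic_scale u v (t : R) : t != 0 -> H1alpha G u -> H1 v ->
  quadratic (fun x => t%:C * u x) (fun x => t%:C * v x) = t ^+ 2 * quadratic u v.
Proof.
move=> t0 hu hv; have Lu : L2 u by case: hu.
have Lv : L2 v by case: hv.
have N w : L2 w -> J (fun x => nsq (t%:C * w x)) = t ^+ 2 * J (fun x => nsq (w x)).
  move=> Lw; rewrite -JZ; last exact: sf_nsq.
  by congr Rintegral; apply/funext => x; rewrite nsqM nsq_real.
rewrite /quadratic N// dirichlet_scale// !qformE.
rewrite (charge_ofE hG (is_charge_scale t (H1alpha_charge hu))).
set q := charge_of G u.
have -> : regular_part G lambda (t%:C * q) (fun x => t%:C * u x) = (fun x => t%:C * regular_part G lambda q u x).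
  by apply/funext => x; rewrite /regular_part; ring.
have Lp := L2_regular_part q Lu.
by rewrite dirichlet_scale// !N// nsqM nsq_real; ring.
Qed.

Local Notation level := (ground_level G alpha omega tomega lambda).

(** The multiple by [t] with $t^2 = Q/F$ lies on the Nehari manifold and has energy $t^2Q/4 =
    Q^2/(4F)$. *)
Lemma level_le (beta : R) u v : H1alpha G u -> H1 v -> 0 < J (quartic beta u v) ->
  (level beta <= (quadratic u v ^+ 2 / (4 * J (quartic beta u v)))%:E)%E.
Proof.
move=> hu hv F0.
have L4u := H1alpha_L24 hu; have L4v := H1_L24 hv.
have Q0 : 0 < quadratic u v.
  by apply: quadratic_gt0 => // -[zu zv]; move: F0; rewrite J_quartic_ae_zero ?ltxx.
set Q := quadratic u v in Q0 *; set F := J (quartic beta u v) in F0 *.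
pose t := Num.sqrt (Q / F).
have t20 : 0 < Q / F by rewrite divr_gt0.
have t0 : 0 < t by rewrite sqrtr_gt0.
have t2 : t ^+ 2 = Q / F by rewrite sqr_sqrtr// ltW.
have tn : t != 0 by rewrite gt_eqF.
pose u' := (fun x => t%:C * u x) : PT -> R[i]; pose v' := (fun x => t%:C * v x) : PT -> R[i].
have hu' : H1alpha G u' by exact: H1alpha_scale.
have hv' : H1 v' by exact: H1_scale.
have L4u' := H1alpha_L24 hu'; have L4v' := H1_L24 hv'.
have Q' : quadratic u' v' = t ^+ 2 * Q by exact: quadratic_scale.
have F' : J (quartic beta u' v') = t ^+ 4 * F.
  rewrite -JZ; last exact: sf_quartic.
  by congr Rintegral; apply/funext => x; exact: quartic_scale.
have QF : t ^+ 2 * Q = t ^+ 4 * F.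
  by rewrite (_ : 4 = 2 * 2)%N// exprM t2; field; rewrite gt_eqF.
have -> : Q ^+ 2 / (4 * F) = energy G alpha omega tomega lambda beta (u', v').
  by rewrite energyE// Q' F' -QF t2; field; rewrite gt_eqF.
apply: ereal_inf_lbound; exists (u', v') => //; split => //=.
- have N (w : PT -> R[i]) : ae_zero (fun x => t%:C * w x) -> ae_zero w.
    apply: ae_impl => x /eqP; rewrite mulf_eq0 => /orP[|/eqP//].
    by rewrite eq_complex /= (negbTE tn).
  by move=> [/N zu /N zv]; move: F0; rewrite /F J_quartic_ae_zero ?ltxx.
- by rewrite nehariE// Q' F' QF subrr.
Qed.

End Problem.

(** * Properties of minimizers *)

Section Minimizer.
Variables (R : realType) (G : R -> R * R -> R[i]).
Hypothesis hG : forall l : R, 0 < l -> is_green l (G l).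
Variables (alpha omega tomega lambda : R).
Hypotheses (htomega : 0 < tomega) (hlambda : omega_ alpha < lambda <= omega).
Local Open Scope complex_scope.
Local Notation PT := (R * R)%type.
Local Notation P := (measurableTypeR R * measurableTypeR R)%type.
Local Notation mu := (@leb2 R).
Local Notation sf := (summable_fun mu).
Local Notation J := (Rintegral mu setT).
Local Notation qf := (qform G alpha omega lambda).
Local Notation quad := (quadratic G alpha omega tomega lambda).
Local Notation level := (ground_level G alpha omega tomega lambda).
Implicit Types (u v b : PT -> R[i]) (x y z : PT) (c q : R[i]).

Lemma nehari_quadratic (beta : R) u v : nehari G alpha omega tomega lambda beta (u, v) ->
  [/\ H1alpha G u, H1 v, 0 < quad u v, J (quartic beta u v) = quad u v &
    energy G alpha omega tomega lambda beta (u, v) = quad u v / 4].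
Proof.
move=> [/= hu hv nz]; have L4u := H1alpha_L24 hG hu; have L4v := H1_L24 hv.
rewrite nehariE// => /eqP; rewrite subr_eq0 => /eqP E.
split => //; first exact: quadratic_gt0.
by rewrite energyE// -E; field.
Qed.

Lemma level_le0 (beta : R) : 0 <= beta -> (level beta <= level 0)%E.
Proof.
move=> b0; apply/ereal_infP => _ [[u v] /nehari_quadratic[hu hv Q0 FQ ->] <-].
have L4u := H1alpha_L24 hG hu; have L4v := H1_L24 hv.
(* A non-negative coupling only increases the quartic part, so $Q^2/(4F) \le Q/4$ for a pair on the
   manifold of $c_0$. *)
have Fle : quad u v <= J (quartic beta u v).
  rewrite -FQ; apply: leJ; [exact: sf_quartic|exact: sf_quartic|move=> x].
  by rewrite /quartic mulr0 mul0r addr0 lerDl mulr_ge0 ?mulr_ge0// nsq_ge0.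
have F0 : 0 < J (quartic beta u v) by exact: lt_le_trans Fle.
apply: (le_trans (level_le hG htomega hlambda hu hv F0)); rewrite lee_fin.
rewrite ler_pdivrMr ?mulr_gt0// mulrA divfK// expr2 ler_wpM2l//; exact: ltW.
Qed.

Lemma minimizer_vector (beta : R) u v : 0 <= beta -> level beta <> level 0 ->
  is_minimizer G alpha omega tomega lambda beta (u, v) -> vector_pair (u, v).
Proof.
move=> b0 ne [nuv Euv].
(* Once the coupling vanishes, the pair lies on both manifolds with the same energy. *)
suff H : coupling u v = 0 -> False.
  have C0 : ae_zero u \/ ae_zero v -> coupling u v = 0.
    case: nuv => /= hu hv _ _ h; rewrite couplingE.
    have s := sf_nsqM (H1alpha_L24 hG hu) (H1_L24 hv).
    rewrite -[RHS](@J0 _ P R mu); apply: eq_ae_J; [exact: sf_meas s|exact: measurable_cst|].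
    by case: h; apply: ae_impl => x ->; rewrite nsq0 ?mul0r ?mulr0.
  by split => /= h; apply: H; [exact: C0 (or_introl h)|exact: C0 (or_intror h)].
move=> C0; apply: ne; apply/le_anti/andP; split; first exact: level_le0.
rewrite -Euv; have -> : energy G alpha omega tomega lambda beta (u, v) = energy G alpha omega tomega lambda 0 (u, v).
  by rewrite /energy /= C0 !mulr0.
apply: ereal_inf_lbound; exists (u, v) => //.
case: nuv => hu hv nz E; split => //.
by move: E; rewrite /nehari_functional /= C0 !mulr0.
Qed.

Lemma minimizer_ineq (beta : R) u v u' v' : 0 <= beta ->
  is_minimizer G alpha omega tomega lambda beta (u, v) -> H1alpha G u' -> H1 v' ->
  quad u v * J (quartic beta u' v') <= quad u' v' ^+ 2.
Proof.
move=> b0 [/nehari_quadratic[hu hv Q0 FQ E] Euv] hu' hv'.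
(* A non-positive quartic part makes the left side non-positive; otherwise [level_le] applies, the
   minimal energy being a quarter of [quad u v]. *)
have [F0|Fle] := ltP 0 (J (quartic beta u' v')); last first.
  apply: (@le_trans _ _ 0); last exact: sqr_ge0.
  by rewrite mulr_ge0_le0// ltW.
have := level_le hG htomega hlambda hu' hv' F0.
rewrite -Euv E lee_fin ler_pdivlMr ?mulr_gt0//.
by rewrite mulrA divfK.
Qed.

Lemma qform_H1 u : H1 u -> qf u = dirichlet u + omega * J (fun x => nsq (u x)).
Proof.
move=> hu; rewrite qformE (charge_ofE hG (H1_charge0 G hu)) nsq0 mulr0 addr0.
have -> : regular_part G lambda 0 u = u by apply/funext => x; rewrite /regular_part mul0r subr0.
by ring.
Qed.

(** The factor 0 is included, as [qform_line_self] meets it at [t = -1]. *)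
Lemma dirichlet_H1_scale u (t : R) : H1 u -> dirichlet (fun x => t%:C * u x) = t ^+ 2 * dirichlet u.
Proof.
move=> [Lu [g1 [Lg1 d1]] [g2 [Lg2 d2]]].
have a1 : axis (e1 R) by left. have a2 : axis (e2 R) by right.
rewrite (dirichletE Lg1 Lg2 d1 d2).
rewrite (dirichletE (L2_scale t%:C Lg1) (L2_scale t%:C Lg2)
  (is_weak_derivative_scale t%:C a1 Lu Lg1 d1) (is_weak_derivative_scale t%:C a2 Lu Lg2 d2)).
rewrite mulrDr -!JZ; [|exact: sf_nsq..].
by congr (_ + _); congr Rintegral; apply/funext => x; rewrite nsqM nsq_real.
Qed.

Lemma qform_line_self u (t : R) : H1 u ->
  qf (fun x => u x + t%:C * u x) = qf u + 2 * t * qf u + t ^+ 2 * qf u.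
Proof.
move=> hu; have -> : (fun x => u x + t%:C * u x) = (fun x => (1 + t)%:C * u x).
  by apply/funext => x; rewrite rmorphD/= mulrDl mul1r.
rewrite !qform_H1//; last exact: H1_scale.
have Lu : L2 u by case: hu.
have -> : J (fun x => nsq ((1 + t)%:C * u x)) = (1 + t) ^+ 2 * J (fun x => nsq (u x)).
  rewrite -JZ; last exact: sf_nsq.
  by congr Rintegral; apply/funext => x; rewrite nsqM nsq_real.
by rewrite dirichlet_H1_scale//; ring.
Qed.

Lemma qform_line_green u c (t : R) : H1 u ->
  qf (fun x => u x + t%:C * (c * G lambda x)) = qf u +
    2 * t * ((omega - lambda) * J (dotp u (fun x => c * G lambda x))) +
    t ^+ 2 * ((omega - lambda) * J (fun x => nsq (c * G lambda x)) + (alpha + theta lambda) * nsq c).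
Proof.
move=> hu; have Lu : L2 u by case: hu.
have l0 := lambda_gt0 hlambda; have [LG _] := hG l0.
have LcG := L2_scale c LG.
pose w := (fun x => u x + t%:C * (c * G lambda x)) : PT -> R[i].
have reg : regular_part G lambda (t%:C * c) w = u.
  by apply/funext => x; rewrite /regular_part /w; ring.
(* Uniqueness of the charge allows it to be read off from this one decomposition. *)
have cw : is_charge G w (t%:C * c) by exists lambda; rewrite reg.
rewrite qformE (charge_ofE hG cw) reg qform_H1// nsqM nsq_real.
have -> : J (fun x => nsq (w x)) = J (fun x => nsq (u x)) + 2 * t * J (dotp u (fun x => c * G lambda x))
    + t ^+ 2 * J (fun x => nsq (c * G lambda x)).
  have s1 := sf_nsq Lu; have s2 := sf_dotp Lu LcG; have s3 := sf_nsq LcG.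
  rewrite -JZ// -JZ// -JD; [|by []|exact: sfZ]; rewrite -JD; [|by apply: sfD => //; exact: sfZ|exact: sfZ].
  by congr Rintegral; apply/funext => x; exact: (nsq_line u (fun x => c * G lambda x) t x).
by ring.
Qed.

Lemma H1alpha_line_green u c (t : R) : H1 u -> H1alpha G (fun x => u x + t%:C * (c * G lambda x)).
Proof.
move=> hu; have l0 := lambda_gt0 hlambda; have [LG _] := hG l0.
split; first by apply: L2_add; [case: hu|exact/L2_scale/L2_scale].
exists (t%:C * c), lambda; split => //; congr H1: hu.
by apply/funext => x; rewrite /regular_part; ring.
Qed.

(** * Minimizers without charge *)

Section Regular.
Variables (beta : R) (u v : PT -> R[i]).
Hypotheses (b0 : 0 <= beta) (hu : H1 u) (huv : is_minimizer G alpha omega tomega lambda beta (u, v)).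

Let hv : H1 v. Proof. by case: huv => -[]. Qed.

(** The coefficients [a] and [c] of the expanded quadratic form are left abstract, so that one
    argument serves both the direction [u] and the singular direction. *)
Lemma euler_lagrange z b (a c : R) : L24 b ->
  (forall t : R, H1alpha G (fun x => reflect z u x + t%:C * b x)) ->
  (forall t : R, qf (fun x => reflect z u x + t%:C * b x) = qf (reflect z u) + 2 * t * a + t ^+ 2 * c) ->
  a = J (fun x => (1 * nsq (reflect z u x) + beta * nsq (reflect z v x)) * dotp (reflect z u) b x).
Proof.
move=> hb hw Hq; have L4u := H1_L24 hu; have L4v := H1_L24 hv.
have [huz Duz] := H1_reflect z hu; have [hvz Dvz] := H1_reflect z hv.
have [/nehari_quadratic[_ _ Q0 FQ _] _] := huv.
have Lu : L2 u by case: hu.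
have Lv : L2 v by case: hv.
have Nu : J (fun x => nsq (reflect z u x)) = J (fun x => nsq (u x)) by exact: (J_reflect z (sf_nsq Lu)).
have Nv : J (fun x => nsq (reflect z v x)) = J (fun x => nsq (v x)) by exact: (J_reflect z (sf_nsq Lv)).
have quz : qf (reflect z u) = qf u by rewrite !qform_H1// Duz Nu.
have Fuz : J (quartic beta (reflect z u) (reflect z v)) = quad u v.
  by rewrite -FQ; exact: (J_reflect z (sf_quartic beta L4u L4v)).
apply: (@first_order_eq R (quad u v) a _ c Q0) => t.
have := J_quartic_line t b0 (L24_reflect z L4u) (L24_reflect z L4v) hb; rewrite Fuz => h1.
have := minimizer_ineq b0 huv (hw t) hvz.
have -> : quad (fun x => reflect z u x + t%:C * b x) (reflect z v) = quad u v + 2 * t * a + t ^+ 2 * c.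
  by rewrite /quadratic Hq quz Dvz Nv; ring.
by apply: le_trans; rewrite ler_pM2l.
Qed.

(** The variation is made around the pair reflected at [z = 0], and the reflection is undone by a
    change of variables. *)
Lemma euler_lagrange_self :
  qf u = J (fun x => (1 * nsq (u x) + beta * nsq (v x)) * nsq (u x)).
Proof.
have r0 (w : PT -> R[i]) : reflect 0 (reflect 0 w) = w by apply/funext => x; rewrite /reflect flipK.
have [hu0 Du0] := H1_reflect 0 hu.
have E := @euler_lagrange 0 (reflect 0 u) (qf (reflect 0 u)) (qf (reflect 0 u)) (L24_reflect 0 (H1_L24 hu)).
have Lu : L2 u by case: hu.
have -> : qf u = qf (reflect 0 u).
  by rewrite !qform_H1// Du0; congr (_ + _ * _); rewrite -(J_reflect 0 (sf_nsq Lu)).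
rewrite E.
- have L4u := H1_L24 hu; have L4v := H1_L24 hv.
  have s := sf_weighted_dotp 1 beta L4u L4v L4u.
  have D w : dotp w w = fun x => nsq (w x) by apply/funext => x; rewrite /dotp /nsq !expr2.
  by rewrite D in s *; rewrite -(J_reflect 0 s).
- by move=> t; apply: H1_H1alpha; exact: H1_comb.
- by move=> t; exact: qform_line_self.
Qed.

Lemma euler_lagrange_green z c :
  (omega - lambda) * J (dotp (reflect z u) (fun x => c * G lambda x)) =
  J (fun x => (1 * nsq (reflect z u x) + beta * nsq (reflect z v x)) * dotp (reflect z u) (fun x => c * G lambda x) x).
Proof.
have l0 := lambda_gt0 hlambda; have [huz _] := H1_reflect z hu.
apply: euler_lagrange.
- exact/L24_scale/(green_L24 l0 (hG l0)).
- by move=> t; exact: H1alpha_line_green.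
- by move=> t; exact: qform_line_green.
Qed.

Definition residual x : R := 1 * nsq (u x) + beta * nsq (v x) - (omega - lambda).

Let c0 : 0 <= omega - lambda := omega_ge hlambda.

(** The part depending on [x] in the splitting [A x + B y] that [conv_green_eq0] requires. *)
Definition residual_dominant x : R :=
  2 * (nsq (u x) ^+ 2 + beta ^+ 2 * nsq (v x) ^+ 2) + nsq (u x) ^+ 2 + (omega - lambda) * nsq (u x).

(** Repeated use of $|ab| \le a^2 + b^2$ separates the variables. What results are second and fourth
    powers, integrable because [u], [v] and the Green's function all belong to [L24]. *)
Lemma residual_bound x (a g N : R) : a ^+ 2 <= nsq (u x) -> g ^+ 2 <= N ->
  `|residual x * a * g| <= residual_dominant x + (N ^+ 2 + (omega - lambda) * N).
Proof.
rewrite /residual /residual_dominant; have := nsq_ge0 (u x); have := nsq_ge0 (v x); have := c0.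
move: (nsq (u x)) (nsq (v x)) (omega - lambda) => p q k k0 q0 p0 ap gN.
have pq0 : 0 <= p + beta * q by rewrite addr_ge0// mulr_ge0.
have a2 := sqr_ge0 a; have g2 := sqr_ge0 g.
have -> : (1 * p + beta * q - k) * a * g = (p + beta * q) * (a * g) - k * (a * g) by ring.
apply: (le_trans (ler_normB _ _)).
have h1 := norm_mul_le (p + beta * q) (a * g).
have h2 : `|k * (a * g)| <= k * (a ^+ 2 + g ^+ 2).
  by rewrite normrM (ger0_norm k0) ler_wpM2l// norm_mul_le.
have h3 : k * (a ^+ 2 + g ^+ 2) <= k * p + k * N by rewrite -mulrDr ler_wpM2l// lerD.
have h4 : (a * g) ^+ 2 <= p * N by rewrite exprMn ler_pM.
have h5 : p * N <= p ^+ 2 + N ^+ 2.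
  by have := norm_mul_le p N; apply: le_trans; exact: ler_norm.
have h6 : (p + beta * q) ^+ 2 <= 2 * (p ^+ 2 + beta ^+ 2 * q ^+ 2).
  by rewrite -exprMn; have := sqr_ge0 (p - beta * q); lra.
lra.
Qed.

Lemma sf_residual_dominant : sf residual_dominant.
Proof.
have [Lu u4] := H1_L24 hu; have [Lv v4] := H1_L24 hv.
apply: sfD; last exact/sfZ/sf_nsq.
by apply: sfD => //; apply: sfZ; apply: sfD => //; exact: sfZ.
Qed.

Lemma meas_residual : measurable_fun [set: P] residual.
Proof.
have [Lu u4] := H1_L24 hu; have [Lv v4] := H1_L24 hv.
apply: measurable_funB => //; apply: measurable_funD; apply: measurable_funM => //; exact: L2_meas_nsq.
Qed.

(** The directions $G_\lambda$ and $iG_\lambda$ give two real convolution identities; in each of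
    them [conv_green_eq0] isolates the factor paired with the real part of $G_\lambda$, which
    carries the point mass. *)
Lemma residual_orthogonal (f : PT -> R) : test_function f ->
  J (fun x => residual x * rp u x * f x) = 0 /\ J (fun x => residual x * ip u x * f x) = 0.
Proof.
move=> tf; have L4u := H1_L24 hu; have L4v := H1_L24 hv.
have Lu := L4u.1; have [[mr _] [mi _]] := (L2P u).1 Lu.
have l0 := lambda_gt0 hlambda; have L4G := green_L24 l0 (hG l0).
have [LG gr gi] := greenP (hG l0); have [lrG liG] := (L2P _).1 LG.
have mK := meas_residual.
pose B y : R := nsq (G lambda y) ^+ 2 + (omega - lambda) * nsq (G lambda y).
have sB : sf B by apply: sfD; [case: L4G|exact/sfZ/sf_nsq].
have r2 w x : rp w x ^+ 2 <= nsq (w x) by rewrite lerDl sqr_ge0.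
have i2 w x : ip w x ^+ 2 <= nsq (w x) by rewrite lerDr sqr_ge0.
have EL c z : J (fun x => residual (flip z x) * dotp (reflect z u) (fun x => c * G lambda x) x) = 0.
  have L4uz := L24_reflect z L4u; have L4vz := L24_reflect z L4v; have L4c := L24_scale c L4G.
  have := euler_lagrange_green z c; move/eqP; rewrite eq_sym -subr_eq0 => /eqP <-.
  have sd := sf_dotp L4uz.1 L4c.1.
  rewrite -JZ// -JB; [|exact: sf_weighted_dotp|exact: sfZ].
  by congr Rintegral; apply/funext => x; rewrite /residual /reflect mulrBl.
split.
- apply: (@conv_green_eq0 R (fun x => residual x * rp u x) (fun x => residual x * ip u x)
    (rp (G lambda)) (ip (G lambda)) residual_dominant B lambda) => //.
  + exact: measurable_funM.
  + exact: measurable_funM.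
  + exact: sf_residual_dominant.
  + by move=> x y; apply: residual_bound; [exact: r2|exact: r2].
  + by move=> x y; apply: residual_bound; [exact: i2|exact: i2].
  + move=> z; rewrite -[RHS](EL 1 z); congr Rintegral; apply/funext => x.
    by rewrite /dotp /rp /ip /reflect !mul1r; ring.
- apply: (@conv_green_eq0 R (fun x => residual x * ip u x) (fun x => residual x * - rp u x)
    (rp (G lambda)) (ip (G lambda)) residual_dominant B lambda) => //.
  + exact: measurable_funM.
  + by apply: measurable_funM => //; apply: measurableT_comp.
  + exact: sf_residual_dominant.
  + by move=> x y; apply: residual_bound; [exact: i2|exact: r2].
  + by move=> x y; apply: residual_bound; [rewrite sqrrN; exact: r2|exact: i2].
  (* Multiplying the direction by $i$ replaces the factors [rp u] and [ip u] by [ip u] and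
     [- rp u]. *)
  + move=> z; rewrite -[RHS](EL 'i z); congr Rintegral; apply/funext => x.
    by rewrite /dotp /rp /ip /reflect; case: (G lambda x) => a d /=; ring.
Qed.

Lemma regular_ae_zero : ae_zero u.
Proof.
have L4u := H1_L24 hu; have L4v := H1_L24 hv; have Lu := L4u.1.
have [[mr _] [mi _]] := (L2P u).1 Lu.
have mK := meas_residual.
have Z (a : PT -> R) : measurable_fun [set: P] a -> (forall x, a x ^+ 2 <= nsq (u x)) ->
    (forall f, test_function f -> J (fun x => residual x * a x * f x) = 0) ->
    {ae mu, forall x, residual x * a x = 0}.
  move=> ma a2 H; have mKa : measurable_fun [set: P] (fun x => residual x * a x) by exact: measurable_funM.
  apply: test_orthogonal => //; split => // f tf.
  (* The domination used for the Green's function also serves here, with the test function in its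
     place. *)
  apply: (@sf_le _ P R mu _ (fun x => residual_dominant x + ((f x ^+ 2) ^+ 2 + (omega - lambda) * f x ^+ 2))).
  - by apply: measurable_funM => //; exact: test_measurable.
  - by move=> x; exact: residual_bound.
  - have tf2 : test_function (fun x => f x ^+ 2).
      by have := test_mul tf tf; congr test_function.
    have tf4 : test_function (fun x => (f x ^+ 2) ^+ 2).
      by have := test_mul tf2 tf2; congr test_function.
    apply: sfD; first exact: sf_residual_dominant.
    by apply: sfD; [exact: test_sf|apply: sfZ; exact: test_sf].
have z1 := Z _ mr (fun x => _) (fun f tf => (residual_orthogonal tf).1).
have z2 := Z _ mi (fun x => _) (fun f tf => (residual_orthogonal tf).2).
have h1 x : rp u x ^+ 2 <= nsq (u x) by rewrite lerDl sqr_ge0.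
have h2 x : ip u x ^+ 2 <= nsq (u x) by rewrite lerDr sqr_ge0.
have {z1 z2} zK : {ae mu, forall x, residual x * nsq (u x) = 0}.
  apply: ae_impl2 (z1 h1) (z2 h2) => x k1 k2.
  rewrite /nsq -/(rp u x) -/(ip u x) mulrDr !expr2 !mulrA k1 k2 !mul0r addr0//.
have sw : sf (fun x => (1 * nsq (u x) + beta * nsq (v x)) * nsq (u x)).
  have D : dotp u u = fun x => nsq (u x) by apply/funext => x; rewrite /dotp /nsq !expr2.
  by have := sf_weighted_dotp 1 beta L4u L4v L4u; rewrite D.
have : J (fun x => residual x * nsq (u x)) = 0.
  rewrite -[RHS](@J0 _ P R mu); apply: eq_ae_J => //.
  by apply: measurable_funM => //; exact: L2_meas_nsq.
have -> : (fun x => residual x * nsq (u x)) =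
  (fun x => (1 * nsq (u x) + beta * nsq (v x)) * nsq (u x) - (omega - lambda) * nsq (u x)).
  by apply/funext => x; rewrite /residual mulrBl.
have su := sf_nsq Lu.
rewrite JB ?JZ//; last exact: sfZ.
rewrite -euler_lagrange_self qform_H1// => E.
have D0 := dirichlet_ge0 u; have l0 := lambda_gt0 hlambda.
have P0 := mulr_ge0 (ltW l0) (J_nsq_ge0 u).
apply/(ae_zeroP Lu); have /eqP : lambda * J (fun x => nsq (u x)) = 0 by lra.
by rewrite mulf_eq0 (gt_eqF l0)/= => /eqP.
Qed.

End Regular.
End Minimizer.

Theorem theorem1p14 (R : realType) (G : R -> R * R -> R[i])
    (hG : forall l : R, 0 < l -> is_green l (G l))
    (alpha omega tomega : R)
    (homega : omega_ alpha < omega) (htomega : 0 < tomega)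
    (lambda : R) (hlambda : omega_ alpha < lambda <= omega)
    (beta_star : R)
    (hstar : is_beta_star G alpha omega tomega lambda beta_star)
    (beta : R) (hbeta : beta_star < beta) :
  forall uv : (R * R -> R[i]) * (R * R -> R[i]),
    is_minimizer G alpha omega tomega lambda beta uv ->
    vector_pair uv /\ singular_pair G uv.
Proof.
move=> [u v] huv.
have b0 : 0 <= beta by have [[h _] _] := hstar; exact: le_trans h (ltW hbeta).
have ne : ground_level G alpha omega tomega lambda beta <> ground_level G alpha omega tomega lambda 0.
  (* Equality of the levels would put [beta] among the values bounded by [beta_star]. *)
  by move=> E; have := hstar.2 beta (conj b0 E); rewrite leNgt hbeta.
have vec := minimizer_vector hG htomega hlambda b0 ne huv; split => //.
apply/eqP => q0; apply: vec.1.
have [[hu _ _ _] _] := huv.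
(* The decomposition may use any parameter [l]; with charge 0 its regular part is [u] in every case,
   so [u] lies in $H^1$. *)
have [l [l0 hl]] := H1alpha_charge hu; rewrite q0 in hl.
apply: (regular_ae_zero hG htomega hlambda b0 _ huv).
by congr H1: hl; apply/funext => x; rewrite /regular_part mul0r subr0.
Qed.
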